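(* Let $\mathcal{G}\rightrightarrows M$ be a Lie groupoid. For any Ehresmann connection $\sigma$ on $\mathcal{G}$ there is a canonical isomorphism (determined by $\sigma$) $H^*_{\mathrm{def}}(\mathcal{G})\cong H^*(\mathcal{G},Ad_\sigma)$, where $Ad_\sigma$ is the adjoint representation (up to homotopy) of $\mathcal{G}$ associated to $\sigma$.
   Context: Notation. For a Lie groupoid $\mathcal{G}\rightrightarrows M$, $s,t,m,u,i$ are the source, target, multiplication, unit and inversion; $gh$ is defined when $s(g)=t(h)$; $g:x\to y$ means $x=s(g)$, $y=t(g)$; $\mathcal{G}^{(k)}=\{(g_1,\dots,g_k): s(g_i)=t(g_{i+1})\}$; $\bar m(p,q)=pq^{-1}$ for $s(p)=s(q)$ (division map). For $g:x\to y$, $r_g$ and $l_g$ are the differentials of right translation $s^{-1}(y)\to s^{-1}(x)$ and left translation $t^{-1}(x)\to t^{-1}(y)$. The Lie algebroid $A$ has fibres $A_x=T_{1_x}s^{-1}(x)$ and anchor $\rho=dt|_A:A\to TM$. For $\alpha\in\Gamma(A)$ put $\overrightarrow{\alpha}(g)=r_g\alpha_{t(g)}$ and $\overleftarrow{\alpha}(g)=l_g(di(\alpha_{s(g)}))$. Deformation complex $(C^*_{\mathrm{def}}(\mathcal{G}),\delta)$ with cohomology $H^*_{\mathrm{def}}(\mathcal{G})$. For $k\ge 1$, $C^k_{\mathrm{def}}(\mathcal{G})$ consists of smooth maps $c:\mathcal{G}^{(k)}\to T\mathcal{G}$ with $c(g_1,\dots,g_k)\in T_{g_1}\mathcal{G}$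 such that $ds(c(g_1,\dots,g_k))=:s_c(g_2,\dots,g_k)$ does not depend on $g_1$; and $$(\delta c)(g_1,\dots,g_{k+1})=-d\bar m\big(c(g_1g_2,g_3,\dots,g_{k+1}),c(g_2,\dots,g_{k+1})\big)+\sum_{i=2}^k(-1)^ic(g_1,\dots,g_ig_{i+1},\dots,g_{k+1})+(-1)^{k+1}c(g_1,\dots,g_k).$$ $C^0_{\mathrm{def}}(\mathcal{G})=\Gamma(A)$ and $\delta(\alpha)=\overrightarrow{\alpha}+\overleftarrow{\alpha}$. An Ehresmann connection on $\mathcal{G}$ is a smooth vector bundle map $\sigma:s^*TM\to T\mathcal{G}$ with $ds\circ\sigma=\mathrm{id}$ and $\sigma_{1_x}=(du)_x$ at units. Let $\omega:T\mathcal{G}\to t^*A$, $\omega_g(X)=r_{g^{-1}}(X-\sigma_g(ds(X)))$. Adjoint representation $Ad_\sigma$. For a vector bundle $E\to M$, $C^k(\mathcal{G},E)$ is the space of smooth maps $v:\mathcal{G}^{(k)}\to E$ with $v(g_1,\dots,g_k)\in E_{t(g_1)}$ ($C^0=\Gamma(E)$, zero for $k<0$). For a quasi-action $\lambda$ (linear maps $\lambda_g:E_{s(g)}\to E_{t(g)}$ depending smoothly on $g$) put $(\delta_\lambda v)(g_1,\dots,g_{k+1})=\lambda_{g_1}v(g_2,\dots,g_{k+1})+\sum_{i=1}^k(-1)^iv(\dots,g_ig_{i+1},\dots)+(-1)^{k+1}v(g_1,\dots,g_k)$. The connection $\sigma$ defines quasi-actions: on $TM$, $\lambda_g(X)=dt(\sigma_g(X))$;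 on $A$, $\lambda_g(\alpha)=-\omega_g(l_g(di(\alpha)))$. It also defines the basic curvature: for composable $(g,h)$ and $v\in T_{s(h)}M$, $K(g,h)v\in A_{t(g)}$ is determined by $r_{gh}(K(g,h)v)=\sigma_{gh}(v)-dm(\sigma_g(\lambda_h(v)),\sigma_h(v))$. $Ad_\sigma$ is the graded vector bundle $A\oplus TM$ ($A$ in degree $0$, $TM$ in degree $1$) with $H^*(\mathcal{G},Ad_\sigma)$ the cohomology of $C(\mathcal{G},Ad)^k=C^k(\mathcal{G},A)\oplus C^{k-1}(\mathcal{G},TM)$ under $D_\sigma(u,v)=(\delta_\lambda(u)+K\cdot v,\ -\delta_\lambda(v)+\rho\circ u)$, where $(K\cdot v)(g_1,\dots,g_{k+1})=K(g_1,g_2)(v(g_3,\dots,g_{k+1}))$. *)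

(* Defs.v *)
From HB Require Import structures.
From mathcomp Require Import all_boot all_order all_algebra.
From mathcomp Require Import all_classical all_reals all_analysis.

Set Implicit Arguments.
Unset Strict Implicit.
Unset Printing Implicit Defensive.

Import Order.TTheory GRing.Theory Num.Theory.
Import numFieldNormedType.Exports.
Local Open Scope classical_set_scope.
Local Open Scope ring_scope.

Section SmoothMaps.
Variable R : realType.

Fixpoint Ck (k : nat) (V W : normedModType R) (U : set V) (f : V -> W) : Prop :=
  if k is k'.+1 then
    (forall x, U x -> differentiable f x) /\
    (forall v, Ck k' U (fun x => 'd f x v))
  else forall x, U x -> {for x, continuous f}.

Definition Csmooth (V W : normedModType R) (U : set V) (f : V -> W) :=
  forall k, Ck k U f.

(* The part of a manifold structure that is needed to speak of smooth maps:
   for each point x a preferred chart phi x : dom x -> V around x, with inverse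
   psi x.  The domain of phi x is dom x and that of psi x is phi x @` dom x;
   values outside these sets are junk.  The tangent space at x is V itself, a
   tangent vector being represented by its coordinates in the preferred chart
   phi x at its base point. *)
Record charted := Charted {
  csort :> Type;
  model : normedModType R;
  dom : csort -> set csort;
  phi : csort -> csort -> model;
  psi : csort -> model -> csort }.

Definition cnbhs (X : charted) (x : X) (O : set X) : Prop :=
  nbhs (phi x x) (psi x @^-1` O).

(* F is smooth on a neighbourhood of x: it is so when read in a chart around x
   and a chart around F x. *)
Definition smooth_at (X Y : charted) (F : X -> Y) (x : X) : Prop :=
  exists U : set (model X),
    [/\ open U, U (phi x x), U `<=` phi x @` dom x,
        forall a, U a -> dom (F x) (F (psi x a)) &
        Csmooth U (phi (F x) \o F \o psi x)].

Definition smooth (X Y : charted) (F : X -> Y) := forall x, smooth_at F x.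

Definition mdiff (X Y : charted) (F : X -> Y) (x : X) : model X -> model Y :=
  'd (phi (F x) \o F \o psi x) (phi x x).

Definition submersion (X Y : charted) (F : X -> Y) :=
  smooth F /\ forall x w, exists v, mdiff F x v = w.

(* A map defined on a subset S (in practice an embedded submanifold) is smooth
   when it extends locally to smooth maps on the ambient space. *)
Definition local_extension (X Y : charted) (S : set X) (f : {x : X | S x} -> Y)
    (x : X) (F : X -> Y) : Prop :=
  smooth_at F x /\ cnbhs x [set y | forall Sy : S y, F y = f (exist _ y Sy)].

Definition smooth_sub (X Y : charted) (S : set X) (f : {x : X | S x} -> Y) :=
  forall x : {x : X | S x}, exists F, local_extension f (sval x) F.

Definition restr (X Y : charted) (S : set X) (f : X -> Y) :
    {x : X | S x} -> Y := fun x => f (sval x).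

Definition smooth_on (X Y : charted) (S : set X) (f : X -> Y) :=
  smooth_sub (restr (S := S) f).

(* The differential at x of f restricted to S, computed from some local smooth
   extension.  It is meaningful (independent of the extension) on the vectors
   tangent to S, and is only applied to these. *)
Definition sdiff (X Y : charted) (S : set X) (f : X -> Y) (x : X) :
    model X -> model Y :=
  xget (fun=> 0) [set L | exists F,
    local_extension (restr (S := S) f) x F /\ L = mdiff F x].

Definition prodC (X Y : charted) : charted :=
  @Charted (X * Y)%type (model X * model Y)%type
    (fun p => dom p.1 `*` dom p.2)
    (fun p q => (phi p.1 q.1, phi p.2 q.2))
    (fun p a => (psi p.1 a.1, psi p.2 a.2)).

(* Tangent bundle. *)
Definition tanC (X : charted) : charted :=
  @Charted (X * model X)%type (model X * model X)%type
    (fun p => [set q | dom p.1 q.1])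
    (fun p q => (phi p.1 q.1, 'd (phi p.1 \o psi q.1) (phi q.1 q.1) q.2))
    (fun p a => let y := psi p.1 a.1 in
                (y, 'd (phi y \o psi p.1) (a.1) (a.2))).

(* Smooth manifolds, with an atlas indexed by the points: mphi x is a chart
   around x (every smooth structure is given by an atlas of this form). *)
Record manifold := Manifold {
  msort : topologicalType;
  mdim : nat;
  mdom : msort -> set msort;
  mphi : msort -> msort -> 'rV[R]_mdim;
  mpsi : msort -> 'rV[R]_mdim -> msort;
  mhausdorff : hausdorff_space msort;
  msecond_countable : @second_countable msort;
  mdomx : forall x, mdom x x;
  mdom_open : forall x, open (mdom x);
  mphiK : forall x, {in mdom x, cancel (mphi x) (mpsi x)};
  mphi_open : forall x, open (mphi x @` mdom x);
  mphi_cont : forall x, {in mdom x, continuous (mphi x)};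
  mpsi_cont : forall x, {in mphi x @` mdom x, continuous (mpsi x)};
  mtransition : forall x y,
    Csmooth (mphi x @` (mdom x `&` mdom y)) (mphi y \o mpsi x) }.

Definition charted_of (M : manifold) : charted :=
  @Charted (msort M) 'rV[R]_(mdim M) (@mdom M) (@mphi M) (@mpsi M).

Coercion charted_of : manifold >-> charted.

Definition powC (M : manifold) (k : nat) : charted :=
  @Charted ('I_k -> M) 'M[R]_(k, mdim M)
    (fun p => [set q | forall i, dom (p i) (q i)])
    (fun p q => \matrix_(i < k) phi (p i) (q i))
    (fun p A i => psi (p i) (row i A)).

End SmoothMaps.

Section LieGroupoids.
Variable R : realType.

(* The multiplication mul g h = gh is a total function of which only the values
   on composable pairs (s g = t h) are meaningful. *)
Record lie_groupoid := LieGroupoid {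
  arrows :> manifold R;
  objects : manifold R;
  src : arrows -> objects;
  tgt : arrows -> objects;
  unt : objects -> arrows;
  inv : arrows -> arrows;
  mul : arrows -> arrows -> arrows;
  src_unt : forall x, src (unt x) = x;
  tgt_unt : forall x, tgt (unt x) = x;
  src_inv : forall g, src (inv g) = tgt g;
  tgt_inv : forall g, tgt (inv g) = src g;
  src_mul : forall g h, src g = tgt h -> src (mul g h) = src h;
  tgt_mul : forall g h, src g = tgt h -> tgt (mul g h) = tgt g;
  mulA : forall g h k, src g = tgt h -> src h = tgt k ->
    mul g (mul h k) = mul (mul g h) k;
  mul_unt : forall g, mul g (unt (src g)) = g;
  unt_mul : forall g, mul (unt (tgt g)) g = g;
  mul_inv : forall g, mul g (inv g) = unt (tgt g);
  inv_mul : forall g, mul (inv g) g = unt (src g);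
  src_submersion : submersion src;
  tgt_submersion : submersion tgt;
  unt_smooth : smooth unt;
  inv_smooth : smooth inv;
  mul_smooth : smooth_on [set p : prodC arrows arrows | src p.1 = tgt p.2]
                 (fun p => mul p.1 p.2) }.

Variable G : lie_groupoid.
Local Notation M := (objects G).
Local Notation s := (@src G).
Local Notation t := (@tgt G).
Local Notation "1_ x" := (unt x) (at level 9, x at level 2).
Local Notation "g ∘ h" := (mul g h) (at level 40, left associativity).

Definition TG := 'rV[R]_(mdim G).
Definition TM := 'rV[R]_(mdim M).

(* dm at (g, h), on vectors X, Y with ds X = dt Y, and the differential of the
   division map at (p, q), on vectors X, Y with ds X = ds Y *)
Definition dmul (g h : G) (X Y : TG) : TG :=
  @sdiff R (prodC G G) G [set p | s p.1 = t p.2] (fun p => p.1 ∘ p.2)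
    (g, h) (X, Y).
Definition ddiv (p q : G) (X Y : TG) : TG :=
  @sdiff R (prodC G G) G [set a | s a.1 = s a.2] (fun a => a.1 ∘ inv a.2)
    (p, q) (X, Y).

(* rtr g a and ltr g a are r_g and l_g at the point a, for s a = t g, resp.
   t a = s g *)
Definition rtr (g a : G) : TG -> TG :=
  @sdiff R G G [set b | s b = t g] (fun b => b ∘ g) a.
Definition ltr (g a : G) : TG -> TG :=
  @sdiff R G G [set b | t b = s g] (fun b => g ∘ b) a.

(* The tangent space at 1_x of the fibre of s, as a subspace of T_(1_x) G.  A
   section of A, or an A-valued map, is smooth when it is smooth as a map to the tangent
   bundle of G, in which A is embedded. *)
Definition algebroid (x : M) : set TG := [set X | mdiff s 1_x X = 0].
Definition anchor (x : M) : TG -> TM := mdiff t 1_x.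

Definition rinv_field (a : M -> TG) (g : G) : TG := rtr g 1_(t g) (a (t g)).
Definition linv_field (a : M -> TG) (g : G) : TG :=
  ltr g 1_(s g) (mdiff (@inv G) 1_(s g) (a (s g))).

Section Nerve.

(* Composable strings of length k form a subset of the k-fold power of G for
   k > 0, and the manifold of objects for k = 0. *)
Definition nerve_ambient (k : nat) : charted R :=
  if k is k'.+1 then powC G k'.+1 else M.

Definition composable k (g : 'I_k -> G) : Prop :=
  forall i j : 'I_k, j = i.+1 :> nat -> s (g i) = t (g j).

Definition nerve_set (k : nat) : set (nerve_ambient k) :=
  match k return set (nerve_ambient k) with
  | 0%N => setT
  | k'.+1 => @composable k'.+1
  end.

Definition nerve (k : nat) : Type := {g : nerve_ambient k | nerve_set g}.

Definition arr1 k (g : nerve k.+1) : G := sval g ord0.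
Definition arr2 k (g : nerve k.+2) : G := sval g (lift ord0 ord0).

Definition base k : nerve k -> M :=
  match k return nerve k -> M with
  | 0%N => fun x => sval x
  | k'.+1 => fun g => t (arr1 g)
  end.

(* face_arr i (g_1, ..., g_(k+1)) is (g_2, ..., g_(k+1)) for i = 0,
   (..., g_i g_(i+1), ...) for 1 <= i <= k, (g_1, ..., g_k) for i = k.+1;
   the faces of a string g of length 1 are s g for i = 0 and t g for i = 1 *)
Definition face_arr k (i : nat) (g : 'I_k.+1 -> G) (j : 'I_k) : G :=
  let g0 := g (widen_ord (leqnSn k) j) in
  let g1 := g (lift ord0 j) in
  if (j.+1 < i)%N then g0 else if j.+1 == i then g0 ∘ g1 else g1.

Lemma face_arr_composable k i (g : 'I_k.+1 -> G) :
  composable g -> composable (face_arr i g).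
Proof.
move=> cg a b ab; rewrite /face_arr ab.
have e0 : s (g (widen_ord (leqnSn k) a)) = t (g (lift ord0 a)) by exact: cg.
have e1 : s (g (widen_ord (leqnSn k) b)) = t (g (lift ord0 b)) by exact: cg.
have eb : widen_ord (leqnSn k) b = lift ord0 a by apply: val_inj; rewrite /= ab.
case: (ltngtP a.+2 i) => [lt_i|gt_i|eq_i].
- by rewrite eb.
- by case: eqP => _; rewrite -?e1 ?eb ?(src_mul e0).
- by rewrite (tgt_mul e1) eb.
Qed.

Definition face k (i : nat) : nerve k.+1 -> nerve k :=
  match k return nerve k.+1 -> nerve k with
  | 0%N => fun g => exist _ (if i == 0%N then s (arr1 g) else t (arr1 g)) I
  | k'.+1 => fun g =>
      exist _ (face_arr i (sval g)) (face_arr_composable i (svalP g))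
  end.

(* (g_1, ..., g_k) |-> (1, g_1, ..., g_k) *)
Definition cons_unt_arr k (x : M) (g : 'I_k -> G) (j : 'I_k.+1) : G :=
  if unlift ord0 j is Some j' then g j' else 1_x.

Lemma cons_unt_composable k (g : 'I_k.+1 -> G) :
  composable g -> composable (cons_unt_arr (t (g ord0)) g).
Proof.
move=> cg a b; rewrite /cons_unt_arr.
case: (unliftP ord0 b) => [b' ->|-> //] [eb].
have {}eb : b' = a :> nat by [].
case: (unliftP ord0 a) => [a' ea|ea].
  by apply: cg; rewrite eb ea.
by rewrite src_unt; congr (t (g _)); apply: val_inj; rewrite /= eb ea.
Qed.

Lemma cons_unt_composable0 (x : M) :
  composable (cons_unt_arr x (fun i : 'I_0 => 1_x)).
Proof. by move=> a b; rewrite !ord1. Qed.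

Definition cons_unt k : nerve k -> nerve k.+1 :=
  match k return nerve k -> nerve k.+1 with
  | 0%N => fun x => exist _ _ (cons_unt_composable0 (sval x))
  | k'.+1 => fun g => exist _ _ (cons_unt_composable (svalP g))
  end.

End Nerve.

(* Cochain complexes, given by operators on ambient vector spaces preserving
   subspaces of cochains (these facts are not part of the structure).
   Cohomology classes are cosets of coboundaries, with the linear operations
   on cosets given by hlin. *)
Record complex := Complex {
  ambient : nat -> lmodType R;
  cochain : forall k, set (ambient k);
  codiff : forall k, ambient k -> ambient k.+1 }.

Definition cocycle (C : complex) k : set (ambient C k) :=
  [set c | cochain c /\ codiff c = 0].
Definition coboundary (C : complex) k : set (ambient C k) :=
  match k return set (ambient C k) with
  | 0%N => [set 0]
  | k'.+1 => @codiff C k' @` @cochain C k'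
  end.
Definition hclass (C : complex) k (c : ambient C k) : set (ambient C k) :=
  [set c + b | b in @coboundary C k].
Definition cohomology (C : complex) k : set (set (ambient C k)) :=
  [set hclass c | c in @cocycle C k].

(* a [c] + [d] *)
Definition hlin (V : lmodType R) (a : R) (A B : set V) : set V :=
  [set a *: x + y | x in A & y in B].

Definition cohomology_iso (C C' : complex)
    (Phi : forall k, set (ambient C k) -> set (ambient C' k)) : Prop :=
  forall k,
    set_bij (@cohomology C k) (@cohomology C' k) (Phi k) /\
    forall a A B, @cohomology C k A -> @cohomology C k B ->
      Phi k (hlin a A B) = hlin a (Phi k A) (Phi k B).

Definition def_cochain (k : nat) : set (nerve k -> TG) :=
  match k return set (nerve k -> TG) with
  | 0%N => [set a |
      (forall x : nerve 0, algebroid (base x) (a x)) /\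
      smooth_sub (Y := tanC G) (fun x : nerve 0 => (1_(base x), a x))]
  | k'.+1 => [set c |
      smooth_sub (Y := tanC G) (fun g : nerve k'.+1 => (arr1 g, c g)) /\
      forall g g' : nerve k'.+1, face 0 g = face 0 g' ->
        mdiff s (arr1 g) (c g) = mdiff s (arr1 g') (c g')]
  end.

Definition def_codiff (k : nat) : (nerve k -> TG) -> (nerve k.+1 -> TG) :=
  match k return (nerve k -> TG) -> (nerve k.+1 -> TG) with
  | 0%N => fun a g =>
      let a' := fun x : M => a (exist _ x I) in
      rinv_field a' (arr1 g) + linv_field a' (arr1 g)
  | k'.+1 => fun c g =>
      - ddiv (arr1 g ∘ arr2 g) (arr2 g) (c (face 1 g)) (c (face 0 g))
      + \sum_(2 <= i < k'.+2) (-1) ^+ i *: c (face i g)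
      + (-1) ^+ k'.+2 *: c (face k'.+2 g)
  end.

Definition def_complex : complex :=
  @Complex (fun k => (nerve k -> TG : lmodType R)) def_cochain def_codiff.

(* s_c(g_2, ..., g_k), computed at g_1 = a unit *)
Definition symbol k (c : nerve k.+1 -> TG) (p : nerve k) : TM :=
  mdiff s (arr1 (cons_unt p)) (c (cons_unt p)).

Record ehresmann := Ehresmann {
  conn :> G -> TM -> TG;
  conn_linear : forall g a v w, conn g (a *: v + w) = a *: conn g v + conn g w;
  conn_smooth : @smooth_on R (prodC G (tanC M)) (tanC G)
    [set p | s p.1 = p.2.1] (fun p => (p.1, conn p.1 p.2.2));
  conn_split : forall g v, mdiff s g (conn g v) = v;
  conn_unt : forall x v, conn 1_x v = mdiff (@unt G) x v }.

Section Adjoint.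
Variable sigma : ehresmann.

Definition omega (g : G) (X : TG) : TG :=
  rtr (inv g) g (X - sigma g (mdiff s g X)).

Definition actTM (g : G) (X : TM) : TM := mdiff t g (sigma g X).
Definition actA (g : G) (a : TG) : TG :=
  - omega g (ltr g 1_(s g) (mdiff (@inv G) 1_(s g) a)).

(* r_(gh) is invertible, with inverse right translation by (gh)^-1 *)
Definition curvature (g h : G) (v : TM) : TG :=
  rtr (inv (g ∘ h)) (g ∘ h)
    (sigma (g ∘ h) v - dmul g h (sigma g (actTM h v)) (sigma h v)).

Definition A_cochain k : set (nerve k -> TG) :=
  [set u | (forall g, algebroid (base g) (u g)) /\
           smooth_sub (Y := tanC G) (fun g : nerve k => (1_(base g), u g))].
Definition TM_cochain k : set (nerve k -> TM) :=
  [set v | smooth_sub (Y := tanC M) (fun g : nerve k => (base g, v g))].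

Definition quasi_codiff (E : lmodType R) (lam : G -> E -> E) k
    (v : nerve k -> E) (g : nerve k.+1) : E :=
  lam (arr1 g) (v (face 0 g))
  + \sum_(1 <= i < k.+1) (-1) ^+ i *: v (face i g)
  + (-1) ^+ k.+1 *: v (face k.+1 g).

Definition ad_ambient (k : nat) : lmodType R :=
  match k return lmodType R with
  | 0%N => (nerve 0 -> TG : lmodType R)
  | k'.+1 => (((nerve k'.+1 -> TG) * (nerve k' -> TM))%type : lmodType R)
  end.

Definition ad_cochain (k : nat) : set (ad_ambient k) :=
  match k return set (ad_ambient k) with
  | 0%N => @A_cochain 0
  | k'.+1 => @A_cochain k'.+1 `*` @TM_cochain k'
  end.

Definition ad_codiff (k : nat) : ad_ambient k -> ad_ambient k.+1 :=
  match k return ad_ambient k -> ad_ambient k.+1 with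
  | 0%N => fun u =>
      (quasi_codiff actA u, fun x : nerve 0 => anchor (base x) (u x))
  | k'.+1 => fun uv =>
      (fun g : nerve k'.+2 => quasi_codiff actA uv.1 g
         + curvature (arr1 g) (arr2 g) (uv.2 (face 0 (face 0 g))),
       fun g : nerve k'.+1 => - quasi_codiff actTM uv.2 g
         + anchor (base g) (uv.1 g))
  end.

Definition ad_complex : complex :=
  @Complex ad_ambient ad_cochain ad_codiff.

(* The cochain map determined by sigma: (u, v) = (- omega (c), s_c) in positive
   degrees.  The signs are forced by the sign conventions of ad_codiff. *)
Definition split_cochain (k : nat) :
    ambient def_complex k -> ambient ad_complex k :=
  match k return ambient def_complex k -> ambient ad_complex k with
  | 0%N => fun a => a
  | k'.+1 => fun c => (fun g : nerve k'.+1 => - omega (arr1 g) (c g), symbol c)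
  end.

End Adjoint.
End LieGroupoids.

Arguments split_cochain {R G} sigma {k} _.

(* Main.v *)
Require Import Defs.
From mathcomp Require Import all_boot all_order all_algebra.
From mathcomp Require Import all_classical all_reals all_analysis.
From HB Require Import structures.
From mathcomp Require Import lra ring.
Import Defs.

(** The connection splits [T G] into [sigma (s^* TM)] and the right translates
    of [A], so a cochain [c] of the deformation complex is the same thing as the
    pair [(- omega c, s_c)], with inverse [(u, v) |-> - r u + sigma v]; smoothness
    of both maps is read off in charts.  That this bijection intertwines [delta]
    and [D_sigma] is a computation in the tangent groupoid, the definition of [K]
    accounting for the failure of [sigma] to be multiplicative.  The identities of
    the tangent groupoid are obtained by differentiating identities between maps
    defined only on submanifolds such as [{s p = t q}]; this requires that the
    differential of a local extension be determined on tangent vectors, which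
    holds because the kernel of the differential of a submersion consists of
    directions in which its level set can be approached. *)

Set Implicit Arguments.
Unset Strict Implicit.
Unset Printing Implicit Defensive.

Import Order.TTheory GRing.Theory Num.Theory.
Import numFieldNormedType.Exports.
Local Open Scope classical_set_scope.
Local Open Scope ring_scope.

(** * Smooth maps between normed modules *)

(** Tangency to a subset is expressed by approximating points rather than by curves: for small eps >
    0 the subset has points at distance o(eps) from x + eps v. Such a condition passes through
    smooth maps, is all that a comparison of first-order expansions needs, and on level sets comes
    out of a fixed-point argument that gives no regularity in eps. Smoothness meets another
    obstacle. A vector at a point is stored in the preferred chart of that very point, so vectors at
    different points must be carried to one fixed chart before their dependence on the point can be
    discussed. On the side of complexes, [symbol] looks at [c] only on strings that begin with a
    unit. The comparison map is thus injective only among the [c] whose ds-projection is independent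
    of the first arrow. This algebraic condition is tracked apart from smoothness, and
    codifferentials inherit it. *)

Section Calculus.
Variable R : realType.

Lemma near_eq_differentiable (V W : normedModType R) (f g : V -> W) (x : V) :
  (\near x, f x = g x) -> differentiable f x ->
  differentiable g x /\ 'd g x = 'd f x :> (V -> W).
Proof.
move=> fg df.
have fgx : f x = g x by exact: nbhs_singleton fg.
have eg : g \o shift x = cst (g x) + 'd f x +o_ 0 id.
  apply/eqaddoP => _/posnumP[e].
  have /eqaddoP/(_ _ (gt0 e)) fe := diff_locally df.
  have sh : \forall y \near (0 : V), f (y + x) = g (y + x).
    by have := fg; rewrite (near_shift 0 x) subr0.
  near=> y.
  have -> : (g \o shift x - (cst (g x) + 'd f x)) y
          = (f \o shift x - (cst (f x) + 'd f x)) y.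
    have e1 : f (y + x) = g (y + x) by near: y; exact: sh.
    by rewrite /= !fctE /= e1 fgx.
  by near: y; exact: fe.
have dgf : 'd g x = 'd f x :> (V -> W).
  by apply: diff_unique => //; exact: diff_continuous.
split=> //; apply/diff_locallyP; rewrite dgf; split => //.
exact: diff_continuous.
Unshelve. all: by end_near. Qed.

Section CkTheory.
Implicit Types V W Z : normedModType R.

Lemma Ck_eq k V W (U : set V) (f g : V -> W) :
  open U -> (forall x, U x -> f x = g x) -> Ck k U f -> Ck k U g.
Proof.
move=> oU; elim: k => [|k IH] in f g * => fg /=.
  move=> cf x Ux; have := cf x Ux; rewrite /prop_for /continuous_at -(fg x Ux).
  apply: cvg_trans; apply: near_eq_cvg; near do apply/esym.
  by apply: filterS (open_nbhs_nbhs (conj oU Ux)) => y /fg.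
have nfg x : U x -> \near x, f x = g x.
  by move=> Ux; apply: filterS (open_nbhs_nbhs (conj oU Ux)) => y /fg.
move=> [df cf]; split=> [x Ux|v].
  by have [] := near_eq_differentiable (nfg x Ux) (df x Ux).
apply: IH (cf v) => x Ux.
by have [_ ->] := near_eq_differentiable (nfg x Ux) (df x Ux).
Unshelve. all: by end_near. Qed.

Lemma Ck_sub k V W (U U' : set V) (f : V -> W) :
  U' `<=` U -> Ck k U f -> Ck k U' f.
Proof.
move=> sU; elim: k f => [|k IH] f /= cf; first by move=> x /sU /cf.
by case: cf => df cf; split=> [x /sU /df//|v]; exact: IH.
Qed.

Lemma Ck_differentiable k V W (U : set V) (f : V -> W) x :
  Ck k.+1 U f -> U x -> differentiable f x.
Proof. by case=> df _ /df. Qed.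

Lemma CkW k V W (U : set V) (f : V -> W) : Ck k.+1 U f -> Ck k U f.
Proof.
elim: k f => [|k IH] f.
  by case=> df _ x /df; exact: differentiable_continuous.
by case=> df cf; split=> // v; exact: IH.
Qed.

Lemma Ck_cst k V W (U : set V) (a : W) : Ck k U (fun=> a).
Proof.
elim: k a => [|k IH] a /=; first by move=> x _; exact: cst_continuous.
split=> [x _|v]; first exact: differentiable_cst.
rewrite (_ : (fun x => _) = fun=> 0); first exact: IH.
by apply/funext => x; rewrite (diff_cst a).
Qed.

Lemma Ck_linear k V W (U : set V) (f : V -> W) :
  linear f -> continuous f -> Ck k U f.
Proof.
move=> lf cf.
pose fM := GRing.isLinear.Build _ _ _ _ _ lf.
pose fL : {linear V -> W} := HB.pack f fM.
case: k => [|k] /=; first by move=> x _; exact: cf.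
split=> [x _|v]; first exact: (@linear_differentiable _ _ _ fL).
rewrite (_ : (fun x => _) = fun=> f v); first exact: Ck_cst.
by apply/funext => x; rewrite (@diff_lin _ _ _ fL).
Qed.

Lemma Ck_add k V W (U : set V) (f g : V -> W) :
  open U -> Ck k U f -> Ck k U g -> Ck k U (fun x => f x + g x).
Proof.
move=> oU; elim: k f g => [|k IH] f g cf cg /=.
  by move=> x Ux; apply: continuousD; [exact: cf|exact: cg].
case: cf cg => [df cf] [dg cg]; split=> [x Ux|v].
  by apply: differentiableD; [exact: df|exact: dg].
apply: Ck_eq (IH _ _ (cf v) (cg v)) => // x Ux.
exact: (esym (congr1 (fun h : V -> W => h v) (diffD (df x Ux) (dg x Ux)))).
Qed.

Lemma Ck_sum k V W (U : set V) I (r : seq I) (f : I -> V -> W) :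
  open U -> (forall i, Ck k U (f i)) -> Ck k U (fun x => \sum_(i <- r) f i x).
Proof.
move=> oU cf; elim: r => [|i r IH].
  by under eq_fun do rewrite big_nil; exact: Ck_cst.
by under eq_fun do rewrite big_cons; exact: Ck_add.
Qed.

Lemma diff_scale V W (a : V -> R) (f : V -> W) x :
  differentiable a x -> differentiable f x ->
  differentiable (fun y => a y *: f y) x /\
  'd (fun y => a y *: f y) x = (fun v => a x *: 'd f x v + 'd a x v *: f x)
    :> (V -> W).
Proof.
move=> da df.
pose b : R -> W -> W := fun r w => r *: w.
have lb : bilinear_for (GRing.Scale.Law.clone _ _ *:%R _)
   (GRing.Scale.Law.clone _ _ *:%R _) b.
  split=> [u'|u] c y z; rewrite /b /=; first by rewrite scalerDl scalerA.
  by rewrite scalerDr !scalerA mulrC.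
pose bM := bilinear_isBilinear.Build R R W W _ _ b lb.
pose bL : {bilinear R -> W -> W} := HB.pack b bM.
have cb : continuous (fun p : R * W => bL p.1 p.2) by exact: scale_continuous.
have dp := differentiable_pair da df.
have db := @differentiable_bilin _ _ _ _ bL (a x, f x) cb.
have e : (fun y => a y *: f y) = (fun p => bL p.1 p.2) \o (fun y => (a y, f y)).
  by [].
split; first by rewrite e; exact: differentiable_comp.
rewrite e diff_comp // (@diff_bilin _ _ _ _ bL) // diff_pair //.
Qed.

Lemma Ck_scale k V W (U : set V) (a : V -> R) (f : V -> W) :
  open U -> Ck k U a -> Ck k U f -> Ck k U (fun x => a x *: f x).
Proof.
move=> oU; elim: k a f => [|k IH] a f ca cf.
  by move=> x Ux; apply: continuousZ; [exact: ca|exact: cf].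
have ca' := CkW ca; have cf' := CkW cf.
case: ca cf => [da ca] [df cf]; split=> [x Ux|v].
  by case: (diff_scale (da x Ux) (df x Ux)).
have := Ck_add oU (IH _ _ ca' (cf v)) (IH _ _ (ca v) cf').
apply: Ck_eq => // x Ux.
by case: (diff_scale (da x Ux) (df x Ux)) => _ ->.
Qed.

Lemma Ck_pair k V W Z (U : set V) (f : V -> W) (g : V -> Z) :
  open U -> Ck k U f -> Ck k U g -> Ck k U (fun x => (f x, g x)).
Proof.
move=> oU; elim: k f g => [|k IH] f g cf cg.
  by move=> x Ux; apply: cvg_pair; [exact: cf|exact: cg].
case: cf cg => [df cf] [dg cg]; split=> [x Ux|v].
  by apply: differentiable_pair; [exact: df|exact: dg].
apply: Ck_eq (IH _ _ (cf v) (cg v)) => // x Ux.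
by rewrite (diff_pair (df x Ux) (dg x Ux)).
Qed.

(** Finite dimension by way of continuous coordinate functionals. [Ck] controls derivatives in fixed
    directions only, so a derivative in a direction that varies with the point is expanded in the
    vectors [e i]. *)
Definition findim V := exists n (e : 'I_n -> V) (l : 'I_n -> V -> R),
  [/\ forall i, linear (l i), forall i, continuous (l i) &
      forall v, v = \sum_i l i v *: e i].

Lemma Ck_lincomp k V W Z (U : set V) (l : W -> Z) (f : V -> W) :
  open U -> linear l -> continuous l -> Ck k U f -> Ck k U (l \o f).
Proof.
move=> oU ll cl.
pose lM := GRing.isLinear.Build _ _ _ _ _ ll.
pose lL : {linear W -> Z} := HB.pack l lM.
elim: k f => [|k IH] f.
  by move=> cf x Ux; apply: continuous_comp; [exact: cf|exact: cl].
case=> df cf.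
have dl x : differentiable l x by exact: (@linear_differentiable _ _ _ lL).
split=> [x Ux|v]; first exact: differentiable_comp (df x Ux) (dl _).
apply: Ck_eq (IH _ (cf v)) => // x Ux /=.
by rewrite (diff_comp (df x Ux) (dl _)) /= (@diff_lin _ _ _ lL).
Qed.

Lemma Ck_comp k V W Z (U : set V) (U' : set W) (f : V -> W) (g : W -> Z) :
  findim W -> open U -> open U' -> (forall x, U x -> U' (f x)) ->
  Ck k U f -> Ck k U' g -> Ck k U (g \o f).
Proof.
move=> [n [e [l [ll lc ev]]]] oU oU' fU.
elim: k g => [|k IH] g cf cg.
  move=> x Ux; apply: continuous_comp; first exact: cf.
  by apply: cg; exact: fU.
have cf' := CkW cf; case: cf cg => [df cf] [dg cg]; split=> [x Ux|v].
  exact: differentiable_comp (df x Ux) (dg _ (fU _ Ux)).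
(* The chain rule, with the moving direction ['d f x v] expanded so that the induction hypothesis
   applies to each partial derivative of [g]. *)
have : Ck k U (fun x => \sum_(i < n) l i ('d f x v) *: 'd g (f x) (e i)).
  apply: Ck_sum => // i; apply: Ck_scale => //; last exact: (IH (fun y => 'd g y (e
    i)) cf' (cg (e i))).
  exact: (Ck_lincomp (f := fun x => 'd f x v) oU (ll i) (lc i) (cf v)).
apply: Ck_eq => // x Ux.
rewrite (diff_comp (df x Ux) (dg _ (fU _ Ux))) /=.
rewrite [in RHS](ev ('d f x v)) linear_sum; apply: eq_bigr => i _.
by rewrite linearZ.
Qed.

Lemma findim_mx m n : findim 'M[R]_(m, n).
Proof.
pose T : finType := ('I_m * 'I_n)%type.
 pose d (k : 'I_(#|T|)) : T := enum_val k.
exists _, (fun k => delta_mx (d k).1 (d k).2),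
  (fun k (A : 'M[R]_(m, n)) => A (d k).1 (d k).2); split=> [k a u v|k|A].
- by rewrite !mxE.
- exact: coord_continuous.
- rewrite {1}(matrix_sum_delta A) pair_big /=.
  rewrite (reindex d) //=.
  exact: (onW_bij _ (enum_val_bij _)).
Qed.

Lemma findim_prod V W : findim V -> findim W -> findim (V * W)%type.
Proof.
move=> [n [e [l [ll lc ev]]]] [n' [e' [l' [ll' lc' ev']]]].
exists (n + n')%N,
  (fun i : 'I_(n + n') => match fintype.split i with inl j => (e j, 0) | inr j => (0, e' j) end),
  (fun (i : 'I_(n + n')) (p : V * W) => match fintype.split i with inl j => l j p.1
    | inr j => l' j p.2 end).
split=> [i|i|[v w]].
- by case: (fintype.split i) => j a u u' /=; [exact: ll|exact: ll'].
- case: (fintype.split i) => j p.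
  + by apply: (@continuous_comp _ _ _ fst (l j)); [exact: cvg_fst|exact: lc].
  + by apply: (@continuous_comp _ _ _ snd (l' j)); [exact: cvg_snd|exact: lc'].
- rewrite big_split_ord /=.
  under eq_bigr do rewrite (unsplitK (inl _)).
  under [X in _ + X]eq_bigr do rewrite (unsplitK (inr _)).
  have fD := big_morph (fun p : V * W => p.1) (id1 := 0) (op1 := +%R) (id2 := 0)
    (op2 := +%R) (fun _ _ => erefl) erefl.
  have sD := big_morph (fun p : V * W => p.2) (id1 := 0) (op1 := +%R) (id2 := 0)
    (op2 := +%R) (fun _ _ => erefl) erefl.
  rewrite [RHS]surjective_pairing; congr pair => /=.
    rewrite !fD [X in _ + X]big1 ?addr0 -?ev // => j _.
    exact: scaler0.
  rewrite !sD [X in X + _]big1 ?add0r -?ev' // => j _.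
  exact: scaler0.
Qed.

End CkTheory.

Section Csmooth.
Variables V W Z : normedModType R.

Lemma Csmooth_eq (U : set V) (f g : V -> W) :
  open U -> (forall x, U x -> f x = g x) -> Csmooth U f -> Csmooth U g.
Proof. by move=> oU fg cf k; exact: Ck_eq (cf k). Qed.

Lemma Csmooth_sub (U U' : set V) (f : V -> W) :
  U' `<=` U -> Csmooth U f -> Csmooth U' f.
Proof. by move=> sU cf k; exact: Ck_sub (cf k). Qed.

Lemma Csmooth_differentiable (U : set V) (f : V -> W) x :
  Csmooth U f -> U x -> differentiable f x.
Proof. by move=> cf; exact: (Ck_differentiable (cf 1%N)). Qed.

Lemma Csmooth_continuous (U : set V) (f : V -> W) x :
  Csmooth U f -> U x -> {for x, continuous f}.
Proof. by move=> /(_ 0%N); apply. Qed.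

Lemma Csmooth_comp (U : set V) (U' : set W) (f : V -> W) (g : W -> Z) :
  findim W -> open U -> open U' -> (forall x, U x -> U' (f x)) ->
  Csmooth U f -> Csmooth U' g -> Csmooth U (fun x => g (f x)).
Proof. by move=> fW oU oU' fU cf cg k; exact: Ck_comp (cf k) (cg k). Qed.

Lemma Csmooth_pair (U : set V) (f : V -> W) (g : V -> Z) :
  open U -> Csmooth U f -> Csmooth U g -> Csmooth U (fun x => (f x, g x)).
Proof. by move=> oU cf cg k; exact: Ck_pair. Qed.

Lemma Csmooth_add (U : set V) (f g : V -> W) :
  open U -> Csmooth U f -> Csmooth U g -> Csmooth U (fun x => f x + g x).
Proof. by move=> oU cf cg k; exact: Ck_add. Qed.

Lemma Csmooth_linear (U : set V) (f : V -> W) :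
  linear f -> continuous f -> Csmooth U f.
Proof. by move=> lf cf k; exact: Ck_linear. Qed.

Lemma Csmooth_cst (U : set V) (a : W) : Csmooth U (fun=> a).
Proof. by move=> k; exact: Ck_cst. Qed.

Lemma Csmooth_opp (U : set V) (f : V -> W) :
  open U -> Csmooth U f -> Csmooth U (fun x => - f x).
Proof.
move=> oU cf k; apply: (@Ck_lincomp _ _ _ _ _ (fun w => - w)) => //.
- by move=> a u v; rewrite opprD scalerN.
- exact: opp_continuous.
Qed.

End Csmooth.

Lemma Csmooth_fst (V W : normedModType R) (U : set (V * W)) : Csmooth U fst.
Proof. by apply: Csmooth_linear => // p; exact: cvg_fst. Qed.

Lemma Csmooth_snd (V W : normedModType R) (U : set (V * W)) : Csmooth U snd.
Proof. by apply: Csmooth_linear => // p; exact: cvg_snd. Qed.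

Lemma Csmooth_id (V : normedModType R) (U : set V) : Csmooth U (fun x => x).
Proof. by apply: Csmooth_linear => // p. Qed.

(** Joint smoothness in the point and the direction: order k of the result uses order k + 1 of [f],
    along each basis direction. *)
Lemma Csmooth_diff (V W Z : normedModType R) (U : set V) (U' : set W)
    (a w : V -> W) (f : W -> Z) :
  findim W -> open U -> open U' -> (forall x, U x -> U' (a x)) ->
  Csmooth U a -> Csmooth U w -> Csmooth U' f ->
  Csmooth U (fun x => 'd f (a x) (w x)).
Proof.
move=> fW oU oU' aU ca cw cf k.
have [n [e [l [ll lc ev]]]] := fW.
have : Ck k U (fun x => \sum_(i < n) l i (w x) *: 'd f (a x) (e i)).
  apply: Ck_sum => // i; apply: Ck_scale => //.
    exact: (Ck_lincomp (l := l i) oU (ll i) (lc i)).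
  by case: (cf k.+1) => _ /(_ (e i)); exact: Ck_comp.
apply: Ck_eq => // x Ux.
rewrite [in RHS](ev (w x)) linear_sum; apply: eq_bigr => i _.
by rewrite linearZ.
Qed.

End Calculus.

(** * Tangent vectors of level sets *)

Section LevelSets.
Variable R : realType.

Lemma nbhs_nbhs_right (P : set R) (x : R) :
  (\forall e \near x, P e) -> \forall e \near x^'+, P e.
Proof. exact: cvg_within. Qed.

Variables (V : normedModType R) (n : nat) (h : V -> 'rV[R]_n).

Lemma diff_along_line (p u : V) (r : R) : differentiable h (r *: u + p) ->
  differentiable (fun r : R => h (r *: u + p)) r /\
  'd (fun r : R => h (r *: u + p)) r 1 = 'd h (r *: u + p) u.
Proof.
move=> dh.
have d1 : is_diff r ( *:%R^~ u : R -> V) ( *:%R^~ u) by exact: is_diff_scalel.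
have dl : differentiable (fun r : R => r *: u + p) r.
  apply: (@differentiableD _ _ _ ( *:%R^~ u : R -> V) (cst p)).
    exact: (@ex_diff _ _ _ _ _ _ _ d1).
  exact: differentiable_cst.
have e : 'd (fun r : R => r *: u + p) r 1 = u.
  have := @diffD _ _ _ ( *:%R^~ u : R -> V) (cst p) r (@ex_diff _ _ _ _ _ _ _ d1)
    (differentiable_cst _ _).
  move/(congr1 (fun k : R -> V => k 1)) => /= ->.
  by rewrite diff_val diff_cst /= addr0 scale1r.
split; first exact: (differentiable_comp dl dh).
have := diff_comp dl dh.
move/(congr1 (fun k : R -> 'rV[R]_n => k 1)) => ->.
by rewrite /= e.
Qed.

(** The mean value theorem holds for real functions, so it is applied to one coordinate along the
    segment; the intermediate point depends on [j]. *)
Lemma mean_value_coord (p u : V) (j : 'I_n) :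
  (forall r : R, 0 <= r <= 1 -> differentiable h (r *: u + p)) ->
  exists2 r : R, 0 <= r <= 1 &
    (h (u + p) - h p) ord0 j = ('d h (r *: u + p) u) ord0 j.
Proof.
move=> dh.
pose k := fun r : R => h (r *: u + p) ord0 j.
have dk (r : R) : 0 <= r <= 1 ->
    differentiable k r /\ 'd k r 1 = ('d h (r *: u + p) u) ord0 j.
  move=> /dh /diff_along_line [d1 e1].
  pose c := fun N : 'rV[R]_n => N ord0 j.
  have lc : linear c by move=> a x y; rewrite /c !mxE.
  pose cM := GRing.isLinear.Build _ _ _ _ _ lc.
  pose cL : {linear 'rV[R]_n -> R} := HB.pack c cM.
  have cc : continuous c by exact: coord_continuous.
  have dc x : differentiable c x by exact: (@linear_differentiable _ _ _ cL).
  have ek : k = c \o (fun r : R => h (r *: u + p)) by [].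
  rewrite ek; split; first exact: differentiable_comp.
  rewrite (diff_comp d1 (dc _)) /= e1.
  by have /(congr1 (@^~ ('d h (r *: u + p) u))) := @diff_lin _ _ _ cL (h (r *: u + p)) cc.
have ider (r : R) : 0 <= r <= 1 -> is_derive r 1 k ('d k r 1).
  move=> /dk [d1 _]; rewrite -deriveE //.
  by apply/derivableP/derivable1_diffP.
have [||r] := @MVT _ k (fun r => 'd k r 1) 0 1 ltr01.
- by move=> x; rewrite in_itv /= => /andP[/ltW x0 /ltW x1]; apply: ider; rewrite x0.
- apply: derivable_within_continuous => x; rewrite in_itv /= => /ider.
  by case.
rewrite in_itv /= => /andP[/ltW r0 /ltW r1]; rewrite subr0 mulr1.
have r01 : 0 <= r <= 1 by rewrite r0.
have [_ ->] := dk _ r01 => e.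
exists r => //; rewrite -e /k scale1r scale0r add0r.
by rewrite !mxE.
Qed.

Lemma mx_norm_coord (w : 'rV[R]_n) (c : R) :
  0 <= c -> (forall j, `|w ord0 j| <= c) -> `|w| <= c.
Proof.
move=> c0 wc; rewrite [leLHS]/Num.Def.normr/= mx_normrE (bigmax_le _ c0)//= => -[i j] _.
by rewrite /= ord1.
Qed.

Lemma coord_mx_norm (w : 'rV[R]_n) j : `|w ord0 j| <= `|w|.
Proof.
rewrite [leRHS]/Num.Def.normr/= mx_normrE.
exact: (le_bigmax _ (fun ij : 'I_1 * 'I_n => `|w ij.1 ij.2|) (ord0, j)).
Qed.

(* A tangent vector of the level set of a submersion is approximated by points
   of the level set: Newton's iteration transverse to the level set is a
   contraction. *)
Lemma level_set_tangent (U : set V) (a X : V) : open U -> U a -> Ck 1 U h ->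
  (forall w, exists v, 'd h a v = w) -> 'd h a X = 0 ->
  forall eta : R, 0 < eta -> \forall eps \near 0^'+,
    exists2 b, `|b - (a + eps *: X)| <= eta * eps & h b = h a.
Proof.
move=> oU Ua [dh ch] surj dX eta eta0.
(* The [e j] lift the standard basis, so [L] below is a right inverse of ['d h a]; corrections are
   made in its image only. *)
have [e he] : exists e : 'I_n -> V, forall j, 'd h a (e j) = delta_mx ord0 j.
  by have [e he] := choice (fun j : 'I_n => surj (delta_mx ord0 j)); exists e.
pose L (w : 'rV[R]_n) : V := \sum_j w ord0 j *: e j.
have LB w w' : L (w - w') = L w - L w'.
  by rewrite /L -sumrB; apply: eq_bigr => j _; rewrite -scalerBl !mxE.
(* A bound for the norm of [L]; the summand 1 keeps it positive when n = 0. *)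
pose C := 1 + \sum_j `|e j|.
have C0 : 0 < C by rewrite /C ltr_wpDr // sumr_ge0.
have LC w : `|L w| <= C * `|w|.
  apply: (le_trans (ler_norm_sum _ _ _)).
  rewrite /C mulrDl mul1r mulr_suml ler_wpDl //; apply: ler_sum => j _.
  by rewrite normrZ mulrC ler_wpM2l // coord_mx_norm.
(* Chosen so that n errors of size [c1] add up to at most 1/2; n + 1 instead of n avoids dividing by
   0. *)
pose c1 : R := (2 * (n%:R + 1))^-1.
have c10 : 0 < c1 by rewrite invr_gt0 mulr_gt0 // ltr_wpDl.
have [rho rho0 hrho] : exists2 rho : R, 0 < rho & forall x, `|x - a| < rho ->
    U x /\ forall i, `|'d h x (e i) - 'd h a (e i)| <= c1.
  have : \forall x \near a, U x /\ forall i, `|'d h x (e i) - 'd h a (e i)| <= c1.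
    apply: filterI; first exact: open_nbhs_nbhs.
    apply: filter_forall => i.
    have /cvgrPdist_le/(_ _ c10) := ch (e i) a Ua.
    by apply: filterS => x; rewrite distrC.
  move=> /nbhs_ballP[rho /= rho0 hrho]; exists rho => // x xa.
  by apply: hrho; rewrite -ball_normE /= distrC.
(* Near [a], [h] read along [L] differs from the identity by a map of Lipschitz constant 1/2, since
   its partial derivatives along the [e i] stay close to the standard basis. *)
have key p w w' : (forall r : R, 0 <= r <= 1 -> `|r *: L (w - w') + p - a| < rho) ->
    `|h (L (w - w') + p) - h p - (w - w')| <= 2^-1 * `|w - w'|.
  move=> hp; apply: mx_norm_coord => [|j]; first by rewrite mulr_ge0.
  have [r r01] := @mean_value_coord p (L (w - w')) j (fun r r01 => dh _ (hrho _ (hp r r01)).1).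
  set q := _ + p in hp * => hj.
  have [_ hq] := hrho _ (hp r r01).
  have -> : (h (L (w - w') + p) - h p - (w - w')) ord0 j =
     \sum_i (w - w') ord0 i * ('d h (r *: L (w - w') + p) (e i) - 'd h a (e i)) ord0 j.
    rewrite [LHS]mxE hj [X in 'd h _ X]/L linear_sum summxE.
    have -> : (- (w - w')) ord0 j = - \sum_i (w - w') ord0 i * (delta_mx ord0 i : 'rV[R]_n) ord0 j.
      rewrite [LHS]mxE; congr (- _); rewrite (bigD1 j) //= [X in _ * X + _]mxE !eqxx mulr1.
      by rewrite big1 ?addr0 // => i ij; rewrite [X in _ * X]mxE eq_sym (negbTE ij) andbF mulr0.
    rewrite -sumrB; apply: eq_bigr => i _.
    by rewrite he linearZ /= !mxE mulrBr.
  apply: (le_trans (ler_norm_sum _ _ _)).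
  apply: (@le_trans _ _ (\sum_(i < n) `|w - w'| * c1)).
    apply: ler_sum => i _; rewrite normrM ler_pM //; first exact: coord_mx_norm.
    exact: le_trans (coord_mx_norm _ _) (hq i).
  rewrite sumr_const card_ord. rewrite -[leLHS]mulr_natr -mulrA [leRHS]mulrC ler_wpM2l //.
  rewrite /c1 invfM -mulrA ler_piMr // mulrC ler_pdivrMr ?ltr_wpDl //.
  by rewrite mul1r lerDl.
(* Radius for the corrections [w], so that |L w| is at most [eta * eps]. *)
pose eta' := eta / C.
have eta'0 : 0 < eta' by rewrite divr_gt0.
have heps1 : \forall eps \near 0^'+, `|eps *: X| + C * (eta' * eps) < rho.
  have : \forall eps \near (0 : R), `|eps *: X| + C * (eta' * eps) < rho.
    have c0 : `|eps *: X| + C * (eta' * eps) @[eps --> (0 : R)] -->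
        `|(0 : R) *: X| + C * (eta' * 0).
      apply: cvgD; first by apply: cvg_norm; exact: scalel_continuous.
      by apply: cvgMl_tmp; apply: cvgMl_tmp; exact: cvg_id.
    rewrite scale0r normr0 !mulr0 addr0 in c0.
    exact: cvgr_lt c0 _ rho0.
  exact: nbhs_nbhs_right.
(* As ['d h a X = 0], the starting point a + eps X misses the level set by o(eps) only. *)
have hT0 : \forall eps \near 0^'+, `|h (eps *: X + a) - h a| <= eta' / 2 * eps.
  have c0 : 0 < eta' / 2 / (1 + `|X|).
    by rewrite !divr_gt0 // ltr_wpDr.
  have /eqaddoP/(_ _ c0) hd := diff_locally (dh a Ua).
  have hX : \forall eps \near (0 : R),
      `|(h \o shift a - (cst (h a) + 'd h a)) (eps *: X)|
        <= eta' / 2 / (1 + `|X|) * `|eps *: X|.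
    have sc : ( *:%R^~ X : R -> V) @ (0 : R) --> (0 : V).
      by rewrite -[X in _ --> X](scale0r X); exact: scalel_continuous.
    exact: sc hd.
  have {}hX := nbhs_nbhs_right hX.
  near=> eps.
  have e0 : 0 < eps by [].
  have : `|(h \o shift a - (cst (h a) + 'd h a)) (eps *: X)|
        <= eta' / 2 / (1 + `|X|) * `|eps *: X| by near: eps.
  rewrite !fctE /= linearZZ dX scaler0 addr0 => /le_trans; apply.
  have q1 : (1 + `|X|)^-1 * `|X| <= 1.
    by rewrite mulrC ler_pdivrMr ?ltr_wpDr // mul1r lerDr.
  have -> : eta' / 2 / (1 + `|X|) * `|eps *: X|
      = eta' / 2 * eps * ((1 + `|X|)^-1 * `|X|).
    by rewrite normrZ (gtr0_norm e0) -!mulrA; do 3 congr (_ * _); rewrite mulrCA.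
  by rewrite ler_piMr // ltW // mulr_gt0 // divr_gt0.
near=> eps.
have e0 : 0 < eps by [].
have sz : `|eps *: X| + C * (eta' * eps) < rho by near: eps.
have T0 : `|h (eps *: X + a) - h a| <= eta' / 2 * eps by near: eps.
pose p0 := eps *: X + a.
(* Newton's map with the derivative frozen at [a]; [w] is a fixed point exactly when L w + p0 lies
   on the level set. *)
pose T w := w - (h (L w + p0) - h a).
pose B := [set w : 'rV[R]_n | `|w| <= eta' * eps].
have ee0 : 0 <= eta' * eps by rewrite mulr_ge0 // ltW.
have TL w w' : B w -> B w' -> `|T w - T w'| <= 2^-1 * `|w - w'|.
  move=> Bw Bw'.
  have -> : T w - T w' = - (h (L (w - w') + (L w' + p0)) - h (L w' + p0) - (w - w')).
    rewrite (addrA (L (w - w'))) LB subrK /T; move: (h (L w + p0)) (h (L w' + p0)) (h a) => x y z.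
    by apply/matrixP => i j; rewrite !mxE; ring.
  rewrite normrN; apply: key => r /andP[r0 r1].
  (* A point of the segment from L w' to L w is a convex combination, hence as small as its ends;
     this keeps the whole segment within [rho] of [a]. *)
  have -> : r *: L (w - w') + (L w' + p0) - a
       = eps *: X + ((1 - r) *: L w' + r *: L w).
    rewrite LB /p0 scalerBl scalerBr scale1r [L w' + (_ + a)]addrA.
    by rewrite [X in X - a]addrA addrK (AC (2*2) (4*(3*2*1)))/=.
  apply: le_lt_trans sz; apply: (le_trans (ler_normD _ _)); rewrite lerD2l.
  apply: (le_trans (ler_normD _ _)); rewrite !normrZ (ger0_norm r0).
  rewrite [`|1 - r|]ger0_norm ?subr_ge0 //.
  have b w1 : B w1 -> `|L w1| <= C * (eta' * eps).
    by move=> Bw1; apply: (le_trans (LC _)); rewrite ler_wpM2l // ltW.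
  apply: (@le_trans _ _ ((1 - r) * (C * (eta' * eps)) + r * (C * (eta' * eps)))).
    by apply: lerD; apply: ler_wpM2l; rewrite ?subr_ge0 //; exact: b.
  by rewrite -mulrDl subrK mul1r.
have B0 : B 0 by rewrite /B /= normr0.
have L0 : L 0 = 0 by rewrite /L big1 // => j _; rewrite mxE scale0r.
have TB : {homo T : w / B w >-> B w}.
  (* Half of the radius is used by the contraction, the other half by the initial defect [T 0]. *)
  move=> w Bw; rewrite /B /= -(subrK (T 0) (T w)).
  apply: (le_trans (ler_normD _ _)).
  have := TL _ _ Bw B0; rewrite subr0 => h1.
  apply: (le_trans (lerD h1 (lexx _))).
  rewrite {1}/T L0 !add0r normrN -/p0.
  apply: (le_trans (lerD (lexx _) T0)).
  have : 2^-1 * `|w| <= 2^-1 * (eta' * eps) by rewrite ler_wpM2l.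
  move=> /(fun h => lerD h (lexx (eta' / 2 * eps))) /le_trans; apply.
  have -> : eta' / 2 * eps = 2^-1 * (eta' * eps) by rewrite mulrAC mulrC.
  by move: (eta' * eps) => q; lra.
have cB : closed B.
  apply: (@preimage_closed _ _ (fun w : 'rV[R]_n => `|w|) [set x : R | x <= eta' * eps]).
    by move=> w _; exact: norm_continuous.
  exact: closed_le.
pose cV : completeNormedModType R := HB.pack 'rV[R]_n (Complete.on 'rV[R]_n).
have [//|||w Bw Tw] := @banach_fixed_point R cV B (mkfun_fun TB).
- exists 2^-1%:nng; split => /=; first by lra.
  move=> [w w'] /= [Bw Bw']; exact: TL.
- exact: cB.
- by exists 0.
exists (L w + p0); last first.
  have : w = T w by [].
  rewrite /T => /esym/eqP; rewrite subr_eq -subr_eq0 opprD addrA subrr sub0r oppr_eq0.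
  by rewrite subr_eq0 => /eqP.
rewrite /p0 [eps *: X + a]addrC addrK; apply: (le_trans (LC _)).
have : C * `|w| <= C * (eta' * eps) by rewrite ler_wpM2l // ltW.
by move=> /le_trans; apply; rewrite /eta' mulrA mulrCA mulfV ?gt_eqF // mulr1.
Unshelve. all: by end_near. Qed.

End LevelSets.

(** * Charts and differentials on subsets *)

Section Charts.
Variable R : realType.

Lemma open_preimage_in (V W : topologicalType) (U : set V) (U' : set W)
    (f : V -> W) : open U -> (forall x, U x -> {for x, continuous f}) ->
  open U' -> open (U `&` f @^-1` U').
Proof.
move=> oU cf oU'; rewrite openE => x [Ux U'fx]; apply: filterI.
  exact: open_nbhs_nbhs (conj oU Ux).
exact: cf Ux _ (open_nbhs_nbhs (conj oU' U'fx)).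
Qed.

Lemma openX (V W : topologicalType) (U : set V) (U' : set W) :
  open U -> open U' -> open (U `*` U').
Proof.
move=> oU oU'; rewrite openE => -[x y] [/= Ux Uy].
exists (U, U') => //=; split; first exact: open_nbhs_nbhs (conj oU Ux).
exact: open_nbhs_nbhs (conj oU' Uy).
Qed.

Lemma findim_linear_continuous (V W : normedModType R) (f : V -> W) :
  findim V -> linear f -> continuous f.
Proof.
move=> [n [e [l [_ lc ev]]]] lf.
pose fM := GRing.isLinear.Build _ _ _ _ _ lf.
pose fL : {linear V -> W} := HB.pack f fM.
have -> : f = fun v => \sum_i l i v *: f (e i).
  apply/funext => v; transitivity (fL (\sum_i l i v *: e i)); first by rewrite -ev.
  by rewrite linear_sum; apply: eq_bigr => i _; rewrite linearZZ.
have c0 : Ck 0 setT (fun v => \sum_i l i v *: f (e i)).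
  apply: Ck_sum => [|i]; first exact: openT.
  apply: Ck_scale; [exact: openT|by move=> v _; exact: lc|exact: Ck_cst].
by move=> v; exact: c0.
Qed.

Definition local_charts (X : charted R) : Prop :=
  [/\ forall x : X, dom x x,
      forall x y : X, dom x y -> psi x (phi x y) = y &
      forall x : X, open (phi x @` dom x)].

Definition atlas (X : charted R) : Prop :=
  [/\ local_charts X, findim (model X),
      forall x y : X, open (phi x @` (dom x `&` dom y)) &
      forall x y : X, Csmooth (phi x @` (dom x `&` dom y)) (phi y \o psi x)].

Section LocalCharts.
Variables (X : charted R) (lX : local_charts X).
Implicit Types x y : X.

Lemma dom_self x : dom x x. Proof. by case: lX. Qed.

Lemma phiK x y : dom x y -> psi x (phi x y) = y.
Proof. by case: lX => _ + _; apply. Qed.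

Lemma open_range x : open (phi x @` dom x). Proof. by case: lX. Qed.

Lemma psiK x a : (phi x @` dom x) a -> phi x (psi x a) = a.
Proof. by move=> [y xy <-]; rewrite phiK. Qed.

Lemma dom_psi x a : (phi x @` dom x) a -> dom x (psi x a).
Proof. by move=> [y xy <-]; rewrite phiK. Qed.

Lemma psi_phi_self x : psi x (phi x x) = x.
Proof. exact: phiK (dom_self x). Qed.

Lemma range_self x : (phi x @` dom x) (phi x x).
Proof. by exists x => //; exact: dom_self. Qed.

Lemma cnbhs_self x (O : set X) : cnbhs x O -> O x.
Proof. by move/nbhs_singleton; rewrite /preimage /= psi_phi_self. Qed.

End LocalCharts.

Lemma cnbhsI (X : charted R) (x : X) (O O' : set X) :
  cnbhs x O -> cnbhs x O' -> cnbhs x (O `&` O').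
Proof. by move=> xO xO'; exact: filterI. Qed.

Lemma cnbhsS (X : charted R) (x : X) (O O' : set X) :
  O `<=` O' -> cnbhs x O -> cnbhs x O'.
Proof. by move=> OO'; apply: filterS => a; exact: OO'. Qed.

Lemma cnbhsT (X : charted R) (x : X) (O : set X) : (forall y, O y) -> cnbhs x O.
Proof. by move=> OT; apply: filterE => a; exact: OT. Qed.

Section SmoothAt.
Variables (X Y Z : charted R).
Variables (lX : local_charts X) (lY : local_charts Y).

Lemma smooth_at_continuous (F : X -> Y) x (O : set Y) :
  smooth_at F x -> cnbhs (F x) O -> cnbhs x (F @^-1` O).
Proof.
case=> U [oU Ux sU dU cU] nO.
have := Csmooth_continuous cU Ux; rewrite /prop_for /continuous_at /=.
rewrite (psi_phi_self lX) => /(_ _ nO) nF.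
have nU : \forall a \near phi x x, U a by exact: open_nbhs_nbhs.
apply: filterS2 nU nF => a Ua; rewrite /preimage /= (phiK lY) //.
exact: dU.
Qed.

Lemma smooth_at_differentiable (F : X -> Y) x :
  smooth_at F x -> differentiable (phi (F x) \o F \o psi x) (phi x x).
Proof. by case=> U [oU Ux sU dU cU]; exact: Csmooth_differentiable cU Ux. Qed.

Hypothesis fY : findim (model Y).

Lemma smooth_at_comp (F : X -> Y) (F' : Y -> Z) x :
  smooth_at F x -> smooth_at F' (F x) ->
  smooth_at (F' \o F) x /\ mdiff (F' \o F) x = mdiff F' (F x) \o mdiff F x.
Proof.
move=> sF sF'; have dF := smooth_at_differentiable sF.
case: sF sF' => U [oU Ux sU dU cU] [U' [oU' Ux' sU' dU' cU']].
pose f := phi (F x) \o F \o psi x.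
pose f' := phi (F' (F x)) \o F' \o psi (F x).
have cf a : U a -> {for a, continuous f} by exact: Csmooth_continuous.
pose O := U `&` f @^-1` U'.
have oO : open O by exact: open_preimage_in.
have fx : f (phi x x) = phi (F x) (F x) by rewrite /f /= (psi_phi_self lX).
have Ox : O (phi x x) by split=> //; rewrite /preimage /= fx.
have eO a : O a -> f' (f a) = (phi ((F' \o F) x) \o (F' \o F) \o psi x) a.
  by move=> [Ua _]; rewrite /f' /f /= (phiK lY) //; exact: dU.
have cO : Csmooth O (fun a => f' (f a)).
  apply: (Csmooth_comp fY oO oU') cU' => [a []//|].
  by apply: Csmooth_sub cU => a [].
have sc : Csmooth O (phi ((F' \o F) x) \o (F' \o F) \o psi x).
  exact: Csmooth_eq eO cO.
split.
  exists O; split=> // a [Ua U'fa]; first exact: sU.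
  by have := dU' _ U'fa; rewrite /f /= (phiK lY) //; exact: dU.
have df' : differentiable f' (f (phi x x)).
  by rewrite fx; exact: Csmooth_differentiable cU' Ux'.
have nO : \forall a \near phi x x, (f' \o f) a = (phi ((F' \o F) x) \o (F' \o F) \o psi x) a.
  by apply: filterS (open_nbhs_nbhs (conj oO Ox)) => a /eO.
have [_ e] := near_eq_differentiable nO (differentiable_comp (dF : differentiable f (phi x x)) df').
have dF0 : differentiable f (phi x x) := dF.
by rewrite /mdiff e (diff_comp dF0 df') fx.
Qed.

End SmoothAt.

Section Tangent.

Lemma ge_min_id_l (a b : R) : Num.min a b <= a.
Proof. by rewrite ge_min lexx. Qed.

Lemma ge_min_id_r (a b : R) : Num.min a b <= b.
Proof. by rewrite ge_min lexx orbT. Qed.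

(** A tangent cone condition, one-sided in eps and read in the preferred chart at [x]. Nothing is
    asked of the way the approximating point depends on eps. *)
Definition tangent (X : charted R) (S : set X) (x : X) (v : model X) : Prop :=
  forall eta : R, 0 < eta -> \forall eps \near 0^'+,
    exists2 a, `|a - (phi x x + eps *: v)| <= eta * eps & S (psi x a).

Section Approx.
Variables (V W : normedModType R) (f : V -> W) (a0 v : V).

Lemma tangent_near (P : set V) (eta : R) : 0 <= eta -> nbhs a0 P ->
  \forall eps \near 0^'+, forall a, `|a - (a0 + eps *: v)| <= eta * eps -> P a.
Proof.
move=> eta0 /nbhs_ballP[r /= r0 rP].
have c0 : `|eps *: v| + eta * eps @[eps --> (0 : R)] -->
    `|(0 : R) *: v| + eta * 0.
  apply: cvgD; first by apply: cvg_norm; exact: scalel_continuous.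
  by apply: cvgMl_tmp; exact: cvg_id.
rewrite scale0r normr0 mulr0 addr0 in c0.
have h0 : \forall eps \near 0^'+, `|eps *: v| + eta * eps < r.
  exact: nbhs_nbhs_right (@cvgr_lt _ _ _ _ _ _ c0 _ r0).
near=> eps => a ha.
have h : `|eps *: v| + eta * eps < r by near: eps.
apply: rP; rewrite -ball_normE /= distrC; apply: le_lt_trans h.
have -> : a - a0 = eps *: v + (a - (a0 + eps *: v)).
  by rewrite opprD (addrA a) [RHS]addrC subrK.
by apply: (le_trans (ler_normD _ _)); rewrite lerD2l.
Unshelve. all: by end_near. Qed.

Lemma tangent_diff : differentiable f a0 -> forall eta : R, 0 < eta ->
  exists2 eta' : R, 0 < eta' & \forall eps \near 0^'+, forall a,
    `|a - (a0 + eps *: v)| <= eta' * eps ->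
    `|f a - (f a0 + eps *: 'd f a0 v)| <= eta * eps.
Proof.
move=> df eta eta0.
have [K K0 hK] := linear_lipschitz (diff_continuous df).
(* The second bound controls the linear part, whose norm is at most [K]; the first keeps |a - a0|
   below (|v| + 1) eps, which is what the remainder term needs. *)
pose eta' := Num.min 1 (eta / 2 / K).
have eta'0 : 0 < eta' by rewrite lt_min ltr01 !divr_gt0.
exists eta' => //.
pose c := eta / 2 / (`|v| + 1).
have c0 : 0 < c by rewrite !divr_gt0 // ltr_wpDl.
have /eqaddoP/(_ _ c0) hd := diff_locally df.
have hd' : \forall a \near a0, `|f a - (f a0 + 'd f a0 (a - a0))| <= c * `|a - a0|.
  have : \forall y \near (0 : V),
     `|(f \o shift a0 - (cst (f a0) + 'd f a0)) y| <= c * `|y| by exact: hd.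
  rewrite (near_shift a0 0) /=; apply: filterS => a.
  by rewrite /= !fctE /= sub0r subrK.
near=> eps => a ha.
have eps0 : 0 < eps by [].
have : `|f a - (f a0 + 'd f a0 (a - a0))| <= c * `|a - a0|.
  move: a ha; near: eps.
  exact: tangent_near (ltW eta'0) hd'.
have -> : f a - (f a0 + eps *: 'd f a0 v) =
   (f a - (f a0 + 'd f a0 (a - a0))) + 'd f a0 (a - (a0 + eps *: v)).
  rewrite -linearZZ (_ : 'd f a0 (a - (a0 + eps *: v)) = 'd f a0 (a - a0) - 'd f a0 (eps *: v)).
    by rewrite !opprD !addrA subrK.
  by rewrite -linearB; congr ('d f a0 _); rewrite opprD addrA.
move=> h1; apply: (le_trans (ler_normD _ _)).
have h2 : `|'d f a0 (a - (a0 + eps *: v))| <= eta / 2 * eps.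
  apply: (le_trans (hK _)); apply: (@le_trans _ _ (K * (eta' * eps))).
    by rewrite ler_wpM2l // ltW.
  rewrite mulrA ler_wpM2r ?(ltW eps0) //.
  apply: (@le_trans _ _ (K * (eta / 2 / K))); last by rewrite mulrC divfK ?gt_eqF.
  by rewrite ler_wpM2l ?(ltW K0) // ge_min lexx orbT.
have h3 : c * `|a - a0| <= eta / 2 * eps.
  have : `|a - a0| <= (`|v| + 1) * eps.
    have -> : a - a0 = eps *: v + (a - (a0 + eps *: v)).
      by rewrite opprD (addrA a) [RHS]addrC subrK.
    apply: (le_trans (ler_normD _ _)); rewrite normrZ (gtr0_norm eps0).
    rewrite mulrDl mul1r mulrC lerD2l; apply: (le_trans ha).
    by rewrite ler_piMl ?(ltW eps0) // ge_min lexx.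
  move=> /(ler_wpM2l (ltW c0)) /le_trans; apply.
  by rewrite mulrA /c divfK ?gt_eqF // ltr_wpDl.
apply: (le_trans (lerD (le_trans h1 h3) h2)).
by rewrite -mulrDl ler_wpM2r ?(ltW eps0) //; lra.
Unshelve. all: by end_near. Qed.

End Approx.

Variables (X Y : charted R) (lX : local_charts X) (lY : local_charts Y).
Variables (S : set X) (x : X).

(** At a point of [S] close to x + eps v the two maps agree, and each is within eta eps / 2 of its
    first-order expansion; dividing by eps bounds the difference of the differentials by an
    arbitrary eta. *)
Lemma mdiff_eq_on_tangent (F F' : X -> Y) (v : model X) :
  smooth_at F x -> smooth_at F' x -> F x = F' x ->
  cnbhs x [set y | S y -> F y = F' y] -> tangent S x v ->
  mdiff F x v = mdiff F' x v.
Proof.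
move=> sF sF' Fx nF tv.
have dF := smooth_at_differentiable sF.
have dF' := smooth_at_differentiable sF'.
rewrite /mdiff -Fx in dF' *.
set f := phi (F x) \o F \o psi x in dF *.
set f' := phi (F x) \o F' \o psi x in dF' *.
apply/eqP; rewrite -subr_eq0 -normr_le0; apply/ler_addgt0Pl => eta eta0.
rewrite addr0.
have eta20 : 0 < eta / 2 by rewrite divr_gt0.
have [e1 e10 h1] := tangent_diff v dF eta20.
have [e2 e20 h2] := tangent_diff v dF' eta20.
pose e := Num.min e1 e2.
have e0 : 0 < e by rewrite lt_min e10.
have h3 := tangent_near v (ltW e0) nF.
have [eps] : exists eps : R, [/\ 0 < eps,
    exists2 a, `|a - (phi x x + eps *: v)| <= e * eps & S (psi x a),
    forall a, `|a - (phi x x + eps *: v)| <= e1 * eps ->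
      `|f a - (f (phi x x) + eps *: 'd f (phi x x) v)| <= eta / 2 * eps,
    forall a, `|a - (phi x x + eps *: v)| <= e2 * eps ->
      `|f' a - (f' (phi x x) + eps *: 'd f' (phi x x) v)| <= eta / 2 * eps &
    forall a, `|a - (phi x x + eps *: v)| <= e * eps ->
      S (psi x a) -> F (psi x a) = F' (psi x a)].
  have te := tv _ e0.
  apply: (@filter_ex _ (0^'+)).
  near=> eps; split=> //; by near: eps.
case=> eps0 [a ha Sa] k1 k2 k3.
have {}k1 := k1 a (le_trans ha (ler_wpM2r (ltW eps0) (ge_min_id_l e1 e2))).
have {}k2 := k2 a (le_trans ha (ler_wpM2r (ltW eps0) (ge_min_id_r e1 e2))).
have {}k3 : f a = f' a by rewrite /f /f' /= k3.
have k0 : f (phi x x) = f' (phi x x) by rewrite /f /f' /= (psi_phi_self lX) Fx.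
rewrite -(ler_pM2r eps0) -{1}(gtr0_norm eps0) mulrC -normrZ.
have -> : eps *: ('d f (phi x x) v - 'd f' (phi x x) v) =
  (f' a - (f' (phi x x) + eps *: 'd f' (phi x x) v)) -
  (f a - (f (phi x x) + eps *: 'd f (phi x x) v)).
  rewrite k3 k0 scalerBr !opprD !opprK !addrA.
  rewrite (AC (2*1*1*1*1) ((1*4)*(2*5)*(3*6)))/=.
  by rewrite subrr addNr !add0r addrC.
apply: (le_trans (ler_normB _ _)); apply: (le_trans (lerD k2 k1)).
by rewrite -mulrDl -splitr.
Unshelve. all: by end_near. Qed.

End Tangent.
End Charts.

(** * Differentials of maps defined on subsets *)

Section SubsetDifferential.
Variable R : realType.

Section TangentPush.
Variables (X Y : charted R) (lX : local_charts X) (lY : local_charts Y).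

(** The images under [F] of the points approximating x + eps v serve as approximating points of
    [S']. *)
Lemma tangent_push (S : set X) (S' : set Y) (F : X -> Y) x v :
  smooth_at F x -> tangent S x v -> cnbhs x [set y | S y -> S' (F y)] ->
  tangent S' (F x) (mdiff F x v).
Proof.
move=> sF tv nF eta eta0.
have dF := smooth_at_differentiable sF.
have [e e0 h1] := tangent_diff v dF eta0.
have h2 := tangent_near v (ltW e0) nF.
case: sF => U [oU Ux sU dU cU].
have h3 := tangent_near v (ltW e0) (open_nbhs_nbhs (conj oU Ux)).
have te := tv _ e0.
near=> eps.
have [a ha Sa] : exists2 a, `|a - (phi x x + eps *: v)| <= e * eps & S (psi x a).
  by near: eps.
exists (phi (F x) (F (psi x a))).
  have : forall a, `|a - (phi x x + eps *: v)| <= e * eps ->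
    `|(phi (F x) \o F \o psi x) a - ((phi (F x) \o F \o psi x) (phi x x) +
       eps *: 'd (phi (F x) \o F \o psi x) (phi x x) v)| <= eta * eps.
    by near: eps.
  by move=> /(_ a ha); rewrite /= (psi_phi_self lX).
have Ua : U a by move: a ha {Sa}; near: eps.
rewrite (phiK lY); last exact: dU.
have : S (psi x a) -> S' (F (psi x a)) by move: a ha {Sa Ua}; near: eps.
exact.
Unshelve. all: by end_near. Qed.

Lemma level_set_tangent_chart n (h : X -> 'rV[R]_n) (S : set X) (U : set (model X))
    x v : open U -> U (phi x x) -> Csmooth U (h \o psi x) ->
  (forall w, exists v, 'd (h \o psi x) (phi x x) v = w) ->
  (forall a, U a -> h (psi x a) = h x -> S (psi x a)) ->
  'd (h \o psi x) (phi x x) v = 0 -> tangent S x v.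
Proof.
move=> oU Ux ch surj hS dv eta eta0.
have h1 := level_set_tangent oU Ux (ch 1%N) surj dv eta0.
have h2 := tangent_near v (ltW eta0) (open_nbhs_nbhs (conj oU Ux)).
near=> eps.
have [a ha ea] : exists2 b, `|b - (phi x x + eps *: v)| <= eta * eps &
   (h \o psi x) b = (h \o psi x) (phi x x) by near: eps.
exists a => //; apply: hS; last by rewrite -[h x](congr1 h (psi_phi_self lX x)).
by move: a ha {ea}; near: eps.
Unshelve. all: by end_near. Qed.

End TangentPush.

Section Sdiff.
Variables (X Y : charted R) (lX : local_charts X) (lY : local_charts Y).
Implicit Types (S : set X) (f : X -> Y).

Definition extendable S f x := exists F, local_extension (restr (S := S) f) x F.

Lemma mdiff_linear f x : linear (mdiff f x).
Proof. by move=> a u v; exact: linearP. Qed.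

Lemma sdiff_linear S f x : linear (@sdiff R X Y S f x).
Proof.
rewrite /sdiff; have [[L [F [eF _]]]|nex] := pselect (exists L, (exists F,
    local_extension (restr (S := S) f) x F /\ L = mdiff F x)).
  have [|F' [_ ->]] := @xgetPex _ (fun=> 0) [set L | exists F,
    local_extension (restr (S := S) f) x F /\ L = mdiff F x].
    by exists (mdiff F x), F.
  exact: mdiff_linear.
(* Without an extension the default value of [xget] is the zero map, which is linear too. *)
rewrite xgetPN; last by move=> L hL; apply: nex; exists L.
by move=> a u v; rewrite scaler0 addr0.
Qed.

(** Whichever extension [xget] has chosen agrees with [F] on [S] near [x], so both have the same
    differential on tangent vectors. *)
Lemma sdiff_ext S f x F v : S x -> local_extension (restr (S := S) f) x F ->
  tangent S x v -> @sdiff R X Y S f x v = mdiff F x v.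
Proof.
move=> Sx eF tv.
have [|F' [[sF' nF'] e]] := @xgetPex _ (fun=> 0) [set L | exists F,
    local_extension (restr (S := S) f) x F /\ L = mdiff F x].
  by exists (mdiff F x), F.
rewrite /sdiff e; case: eF => sF nF.
apply: (mdiff_eq_on_tangent lX (S := S)) => //.
  by have := cnbhs_self lX nF => /= /(_ Sx) ->; have := cnbhs_self lX nF' => /= /(_ Sx) ->.
by apply: cnbhsS (cnbhsI nF nF') => y [/= h h'] Sy; rewrite (h Sy) (h' Sy).
Qed.

Lemma smooth_extendable S f x : smooth_at f x -> extendable S f x.
Proof. by move=> sf; exists f; split=> //; exact: cnbhsT. Qed.

Lemma sdiff_smooth S f x v : S x -> smooth_at f x -> tangent S x v ->
  @sdiff R X Y S f x v = mdiff f x v.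
Proof. by move=> Sx sf tv; apply: sdiff_ext => //; split=> //; exact: cnbhsT. Qed.

Lemma eq_sdiff S f f' x : (forall y, S y -> f y = f' y) ->
  @sdiff R X Y S f x = @sdiff R X Y S f' x.
Proof.
move=> ff'; rewrite /sdiff; suff -> : restr (S := S) f = restr (S := S) f' by [].
by apply/funext => -[y Sy]; exact: ff'.
Qed.

End Sdiff.

Section SdiffComp.
Variables (X Y Z : charted R).
Variables (lX : local_charts X) (lY : local_charts Y) (lZ : local_charts Z).
Hypothesis fY : findim (model Y).

(** Chain rule: extensions of the two maps compose to an extension of the composite. Extendability
    and tangency are returned along with the formula so that it can be iterated. *)
Lemma sdiff_comp (S : set X) (S' : set Y) (f : X -> Y) (f' : Y -> Z) x v :
  S x -> (forall y, S y -> S' (f y)) ->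
  extendable S f x -> extendable S' f' (f x) -> tangent S x v ->
  [/\ extendable S (f' \o f) x, tangent S' (f x) (@sdiff R X Y S f x v) &
      @sdiff R X Z S (f' \o f) x v =
      @sdiff R Y Z S' f' (f x) (@sdiff R X Y S f x v)].
Proof.
move=> Sx SS' [F eF] [F' eF'] tv.
have Fx : F x = f x by case: eF => _ nF; have := cnbhs_self lX nF => /=; apply.
have dfx := sdiff_ext lX Sx eF tv.
case: (eF) => sF nF.
have nFS : cnbhs x [set y | S y -> S' (F y)].
  by apply: cnbhsS nF => y h Sy; rewrite (h Sy); exact: SS'.
have tS' : tangent S' (f x) (@sdiff R X Y S f x v).
  by rewrite dfx -Fx; exact: (tangent_push lX lY sF tv nFS).
have [sF' nF'] := eF'; rewrite -Fx in sF' nF'.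
have [sc dc] := smooth_at_comp lX lY fY sF sF'.
have ec : local_extension (restr (S := S) (f' \o f)) x (F' \o F).
  split=> //; have := smooth_at_continuous lX lY sF nF'.
  move=> /(cnbhsI nF); apply: cnbhsS => y [/= h h'] Sy.
  have e := h Sy; rewrite /restr /= in e; rewrite /restr /= -e.
  by apply: h'; rewrite e; exact: SS'.
split=> //; first by exists (F' \o F).
rewrite (sdiff_ext lX Sx ec tv) dc /= dfx.
have tS'' : tangent S' (f x) (mdiff F x v) by rewrite -dfx.
by rewrite (sdiff_ext lY _ eF' tS'') ?Fx //; exact: SS'.
Qed.

End SdiffComp.

Section Products.
Variables (X Y Z : charted R).
Variables (lX : local_charts X) (lY : local_charts Y) (lZ : local_charts Z).

Lemma prodC_local_charts : local_charts (prodC X Y).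
Proof.
split=> [[x y]|[x y] [x' y'] [/= d d']|[x y]].
- by split; apply: dom_self.
- by rewrite (phiK lX) // (phiK lY).
- have -> : @phi R (prodC X Y) (x, y) @` @dom R (prodC X Y) (x, y)
      = (phi x @` dom x) `*` (phi y @` dom y).
    apply/seteqP; split=> [_ [[a b] [/= da db] <-]|[_ _] [/= [a da <-] [b db <-]]].
      by split; [exists a|exists b].
    by exists (a, b).
  by apply: openX; apply: open_range.
Qed.

Lemma smooth_at_pair (F : X -> Y) (F' : X -> Z) x :
  smooth_at F x -> smooth_at F' x ->
  smooth_at (Y := prodC Y Z) (fun y => (F y, F' y)) x /\
  @mdiff R X (prodC Y Z) (fun y => (F y, F' y)) x =
    fun v => (mdiff F x v, mdiff F' x v).
Proof.
move=> sF sF'.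
have dF := smooth_at_differentiable sF.
have dF' := smooth_at_differentiable sF'.
case: sF sF' => U [oU Ux sU dU cU] [U' [oU' Ux' sU' dU' cU']].
split; last exact: (diff_pair dF dF').
have oUU' : open (U `&` U') by exact: openI.
exists (U `&` U'); split=> // [a [/sU //]|a [Ua U'a]|].
  by split; [exact: dU|exact: dU'].
apply: (Csmooth_pair (f := phi (F x) \o F \o psi x)
   (g := phi (F' x) \o F' \o psi x)) => //.
  by apply: Csmooth_sub cU => a [].
by apply: Csmooth_sub cU' => a [].
Qed.

Lemma smooth_at_id (x : X) :
  smooth_at (fun y : X => y) x /\ mdiff (fun y : X => y) x = id.
Proof.
have e a : (phi x @` dom x) a -> a = (phi x \o (fun y => y) \o psi x) a.
  by move=> da; rewrite /= (psiK lX).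
have oR := open_range lX x.
split.
  exists (phi x @` dom x); split=> //.
  - exact: range_self.
  - by move=> a; exact: dom_psi.
  - apply: (Csmooth_eq oR e); exact: Csmooth_id.
have nR : \forall a \near phi x x, a = (phi x \o (fun y => y) \o psi x) a.
  by apply: filterS (open_nbhs_nbhs (conj oR (range_self lX x))) => a /e.
have [_] := near_eq_differentiable nR (@ex_diff _ _ _ _ _ _ _ (is_diff_id (phi x x))).
by rewrite /mdiff => ->; rewrite diff_val.
Qed.

Lemma smooth_at_cst (x : X) (y : Y) :
  smooth_at (fun _ : X => y) x /\ mdiff (fun _ : X => y) x = fun=> 0.
Proof.
split; last exact: (diff_cst (phi y y) (phi x x)).
exists (phi x @` dom x); split=> //.
- exact: (open_range lX).
- exact: range_self.
- by move=> a _; exact: dom_self.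
- exact: Csmooth_cst.
Qed.

Lemma smooth_at_fst (p : prodC X Y) :
  smooth_at (X := prodC X Y) (Y := X) (fun q => q.1) p /\
  @mdiff R (prodC X Y) X (fun q => q.1) p = fun v => v.1.
Proof.
have lP := prodC_local_charts; have oR := open_range lP p.
have e a : (phi p @` dom p) a ->
    a.1 = (phi p.1 \o (fun q : prodC X Y => q.1) \o psi p) a.
  by move=> [q [/= d _] <-] /=; rewrite (phiK lX).
split.
  exists (phi p @` dom p); split=> //.
  - exact: range_self.
  - by move=> a /(dom_psi lP) [].
  - apply: (Csmooth_eq oR e); exact: Csmooth_fst.
have nR : \forall a \near phi p p,
    a.1 = (phi p.1 \o (fun q : prodC X Y => q.1) \o psi p) a.
  by apply: filterS (open_nbhs_nbhs (conj oR (range_self lP p))) => a /e.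
have cf : continuous (fst : model X * model Y -> model X).
  by move=> a; exact: cvg_fst.
have [_] := near_eq_differentiable nR (linear_differentiable (phi p p) cf).
by rewrite /mdiff => ->; rewrite diff_lin.
Qed.

Lemma smooth_at_snd (p : prodC X Y) :
  smooth_at (X := prodC X Y) (Y := Y) (fun q => q.2) p /\
  @mdiff R (prodC X Y) Y (fun q => q.2) p = fun v => v.2.
Proof.
have lP := prodC_local_charts; have oR := open_range lP p.
have e a : (phi p @` dom p) a ->
    a.2 = (phi p.2 \o (fun q : prodC X Y => q.2) \o psi p) a.
  by move=> [q [/= _ d] <-] /=; rewrite (phiK lY).
split.
  exists (phi p @` dom p); split=> //.
  - exact: range_self.
  - by move=> a /(dom_psi lP) [].
  - apply: (Csmooth_eq oR e); exact: Csmooth_snd.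
have nR : \forall a \near phi p p,
    a.2 = (phi p.2 \o (fun q : prodC X Y => q.2) \o psi p) a.
  by apply: filterS (open_nbhs_nbhs (conj oR (range_self lP p))) => a /e.
have cf : continuous (snd : model X * model Y -> model Y).
  by move=> a; exact: cvg_snd.
have [_] := near_eq_differentiable nR (linear_differentiable (phi p p) cf).
by rewrite /mdiff => ->; rewrite diff_lin.
Qed.

Lemma sdiff_pair (S : set X) (f : X -> Y) (f' : X -> Z) x v :
  S x -> extendable S f x -> extendable S f' x -> tangent S x v ->
  extendable (Y := prodC Y Z) S (fun y => (f y, f' y)) x /\
  @sdiff R X (prodC Y Z) S (fun y => (f y, f' y)) x v =
  (@sdiff R X Y S f x v, @sdiff R X Z S f' x v).
Proof.
move=> Sx [F eF] [F' eF'] tv.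
have eP : local_extension (@restr R X (prodC Y Z) S (fun y => (f y, f' y)))
    x (fun y => (F y, F' y)).
  case: eF eF' => sF nF [sF' nF']; split; first by case: (smooth_at_pair sF sF').
  apply: cnbhsS (cnbhsI nF nF') => y [/= h h'] Sy.
  by rewrite (h Sy) (h' Sy).
split; first by eexists; exact: eP.
rewrite (sdiff_ext lX Sx eP tv) (sdiff_ext lX Sx eF tv) (sdiff_ext lX Sx eF' tv).
by case: (smooth_at_pair eF.1 eF'.1) => _ ->.
Qed.

End Products.
End SubsetDifferential.

(** * Changes of chart acting on tangent vectors *)

Section Transitions.
Variable R : realType.

Lemma diff_comp_near (U V W : normedModType R) (f : U -> V) (g : V -> W)
    (h : U -> W) x y v :
  f x = y -> differentiable f x -> differentiable g y ->
  (\forall a \near x, g (f a) = h a) -> 'd h x v = 'd g y ('d f x v).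
Proof.
move=> <- df dg n; have [_ e] := near_eq_differentiable n (differentiable_comp df dg).
have e2 := diff_comp df dg.
exact: etrans (congr1 (fun k : U -> W => k v) e)
              (congr1 (fun k : U -> W => k v) e2).
Qed.

(** Converts a tangent vector at [z] from the chart of [x] to that of [y]. A vector at [z] being
    stored in the chart of [z], [transition z y z] reads it in the chart of [y]. *)
Definition transition (X : charted R) (x y z : X) : model X -> model X :=
  'd (phi y \o psi x) (phi x z).

Section Atlas.
Variables (X : charted R) (aX : atlas X).
Implicit Types x y z w : X.

Lemma atlas_local : local_charts X. Proof. by case: aX. Qed.
Lemma atlas_findim : findim (model X). Proof. by case: aX. Qed.
Let lX := atlas_local.

Lemma transition_smooth x y :
  open (phi x @` (dom x `&` dom y)) /\
  Csmooth (phi x @` (dom x `&` dom y)) (phi y \o psi x).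
Proof. by case: aX. Qed.

Lemma transition_differentiable x y z : dom x z -> dom y z ->
  differentiable (phi y \o psi x) (phi x z).
Proof.
move=> xz yz; have [_ c] := transition_smooth x y.
by apply: (Csmooth_differentiable c); exists z.
Qed.

Lemma transition_linear x y z : linear (transition x y z).
Proof. by move=> a u v; exact: linearP. Qed.

Lemma transition_comp x y w z v : dom x z -> dom y z -> dom w z ->
  transition y w z (transition x y z v) = transition x w z v.
Proof.
move=> xz yz wz.
have d1 := transition_differentiable xz yz.
have d2 := transition_differentiable yz wz.
have [no c] := transition_smooth x y.
apply/esym/(diff_comp_near v _ d1 d2); first by rewrite /= (phiK lX).
have m : (phi x @` (dom x `&` dom y)) (phi x z) by exists z.
apply: filterS (open_nbhs_nbhs (conj no m)) => _ [z' [xz' yz'] <-] /=.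
by rewrite (phiK lX xz') (phiK lX yz').
Qed.

Lemma transition_id x z v : dom x z -> transition x x z v = v.
Proof.
move=> xz; have oR := open_range lX x.
have n : \forall a \near phi x z, a = (phi x \o psi x) a.
  have m : (phi x @` dom x) (phi x z) by exists z.
  by apply: filterS (open_nbhs_nbhs (conj oR m)) => a da; rewrite /= (psiK lX).
have [_ e] := near_eq_differentiable n (@ex_diff _ _ _ _ _ _ _ (is_diff_id (phi x z))).
by rewrite /transition e diff_val.
Qed.

Lemma transitionK x y z v : dom x z -> dom y z ->
  transition y x z (transition x y z v) = v.
Proof. by move=> xz yz; rewrite transition_comp // transition_id. Qed.

End Atlas.

(** Conjugation by changes of charts turns smoothness in one pair of charts, around [x0] and [y0],
    into smoothness in the preferred charts of nearby points; the formula expresses the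
    differentials at all of these points through one map between models. *)
Lemma smooth_at_chart (X Y : charted R) (aX : atlas X) (aY : atlas Y)
    (F : X -> Y) (x0 x : X) (y0 : Y) (U : set (model X)) :
  open U -> U `<=` phi x0 @` dom x0 ->
  (forall a, U a -> dom y0 (F (psi x0 a))) ->
  Csmooth U (phi y0 \o F \o psi x0) -> dom x0 x -> U (phi x0 x) ->
  smooth_at F x /\
  forall v, transition (F x) y0 (F x) (mdiff F x v) =
    'd (phi y0 \o F \o psi x0) (phi x0 x) (transition x x0 x v).
Proof.
move=> oU sU dU cU dx Ux.
have lX := atlas_local aX; have lY := atlas_local aY.
set f := phi y0 \o F \o psi x0 in cU *.
pose y := F x.
have dy : dom y0 y by have := dU _ Ux; rewrite (phiK lX).
have [no1 c1] := transition_smooth aX x x0.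
have [no2 c2] := transition_smooth aY y0 y.
(* Shrinks [U] so that [F] lands in the charts of both [y0] and [y]; [O] does the same on the
   source, for [x] and [x0]. *)
pose O1 := U `&` f @^-1` (phi y0 @` (dom y0 `&` dom y)).
have oO1 : open O1.
  by apply: open_preimage_in => // a; exact: Csmooth_continuous.
pose O := phi x @` (dom x `&` dom x0) `&` (phi x0 \o psi x) @^-1` O1.
have oO : open O by apply: open_preimage_in => // a; exact: Csmooth_continuous.
have fx : f (phi x0 x) = phi y0 y by rewrite /f /= (phiK lX).
have tx : (phi x0 \o psi x) (phi x x) = phi x0 x by rewrite /= (psi_phi_self lX).
have Ox : O (phi x x).
  split; first by exists x => //; split=> //; exact: dom_self.
  rewrite /preimage; split; rewrite /= (psi_phi_self lX) //.
  by rewrite fx; exists y => //; split=> //; exact: dom_self.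
have OE a : O a -> [/\ dom x (psi x a), dom x0 (psi x a), U (phi x0 (psi x a)),
   dom y0 (F (psi x a)) & dom y (F (psi x a))].
  move=> [[z [dz dz0] <-]]; rewrite /preimage /O1 /preimage /= !(phiK lX dz).
  case=> Uz; rewrite /f /= (phiK lX dz0) => -[y1 [d1 d2] /(congr1 (psi y0))].
  have dF : dom y0 (F z) by have := dU _ Uz; rewrite (phiK lX dz0).
  by rewrite (phiK lY d1) (phiK lY dF) => e1; split=> //; rewrite -e1.
pose g a := (phi y \o psi y0) (f ((phi x0 \o psi x) a)).
have eO a : O a -> g a = (phi y \o F \o psi x) a.
  move=> /OE[d1 d2 Ua d3 d4].
  by rewrite /g /f /= (phiK lX) // (phiK lY).
have cg : Csmooth O g.
  apply: (Csmooth_comp (f := fun a => f ((phi x0 \o psi x) a)) (atlas_findim aY) oO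
    no2 _ _ c2) => [a [_ []]//|].
  apply: (Csmooth_comp (f := phi x0 \o psi x) (g := f) (atlas_findim aX) oO oU).
  - by move=> a [_ []].
  - by apply: Csmooth_sub c1 => a [].
  - exact: cU.
have sF : smooth_at F x.
  exists O; split=> // [a [[z [dz _] <-] _]|a /OE[]//|]; first by exists z.
  exact: Csmooth_eq eO cg.
split=> // v.
have D1 := transition_differentiable aX (dom_self lX x) dx.
have D2 : differentiable f (phi x0 x) by exact: Csmooth_differentiable cU Ux.
have D3 := smooth_at_differentiable sF.
have D4 : differentiable (phi y0 \o psi y) (phi y y).
  by apply: transition_differentiable => //; exact: dom_self.
have nO := open_nbhs_nbhs (conj oO Ox).
rewrite -(diff_comp_near (h := f \o (phi x0 \o psi x)) v tx D1 D2); last first.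
  exact: filterE.
apply/esym/(diff_comp_near v _ D3 D4); first by rewrite /= (psi_phi_self lX).
apply: filterS nO => a /OE[d1 d2 Ua d3 d4].
by rewrite /f /= (phiK lX) // (phiK lY).
Qed.

End Transitions.

(** * Charts of products, powers and tangent bundles *)

Section Atlases.
Variable R : realType.

Lemma manifold_atlas (M : manifold R) : atlas M.
Proof.
have oT (x y : M) : open (phi x @` (dom x `&` dom y)).
  have -> : phi x @` (dom x `&` dom y) = (phi x @` dom x) `&` psi x @^-1` dom y.
    apply/seteqP; split=> [_ [z [xz yz] <-]|_ [[z xz <-]]].
      by split; [exists z|rewrite /preimage /= mphiK ?inE].
    by rewrite /preimage /= mphiK ?inE // => yz; exists z.
  apply: open_preimage_in; [exact: mphi_open| |exact: mdom_open].
  by move=> a da; apply: mpsi_cont; rewrite inE.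
split=> //; last exact: mtransition.
- split=> [x|x y xy|x]; [exact: mdomx|by rewrite /= mphiK ?inE|exact: mphi_open].
- exact: findim_mx.
Qed.

Section Prod.
Variables (X Y : charted R).

Lemma prodC_atlas : atlas X -> atlas Y -> atlas (prodC X Y).
Proof.
move=> aX aY; have lX := atlas_local aX; have lY := atlas_local aY.
have e (p q : prodC X Y) : phi p @` (dom p `&` dom q) =
    (phi p.1 @` (dom p.1 `&` dom q.1)) `*` (phi p.2 @` (dom p.2 `&` dom q.2)).
  apply/seteqP; split=> [_ [[a b] [[/= ? ?] [/= ? ?]] <-]|[_ _] [/= [a [? ?] <-] [b [? ?] <-]]].
    by split; [exists a|exists b].
  by exists (a, b).
have oT (p q : prodC X Y) : open (phi p @` (dom p `&` dom q)).
  by rewrite e; apply: openX; [case: (transition_smooth aX p.1 q.1)|case: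
    (transition_smooth aY p.2 q.2)].
split=> //; first exact: prodC_local_charts.
  exact: findim_prod (atlas_findim aX) (atlas_findim aY).
move=> p q; have [no1 c1] := transition_smooth aX p.1 q.1.
have [no2 c2] := transition_smooth aY p.2 q.2.
have oe := oT p q; rewrite e in oe; rewrite e.
apply: (Csmooth_pair (f := fun a : model X * model Y => (phi q.1 \o psi p.1) a.1)
  (g := fun a : model X * model Y => (phi q.2 \o psi p.2) a.2) oe).
- apply: (Csmooth_comp (f := fst) (atlas_findim aX) oe no1) c1 => [a []//|].
  exact: Csmooth_fst.
- apply: (Csmooth_comp (f := snd) (atlas_findim aY) oe no2) c2 => [a []//|].
  exact: Csmooth_snd.
Qed.

End Prod.

Lemma row_linear m n (i : 'I_m) : linear (row i : 'M[R]_(m, n) -> 'rV[R]_n).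
Proof. by move=> a u v; exact: linearP. Qed.

Lemma row_continuous m n (i : 'I_m) :
  continuous (row i : 'M[R]_(m, n) -> 'rV[R]_n).
Proof. exact: findim_linear_continuous (findim_mx _ _ _) (@row_linear m n i). Qed.

Lemma powC_local_charts (M : manifold R) k : local_charts (powC M k).
Proof.
have lM := atlas_local (manifold_atlas M).
split=> [x i|x y xy|x]; first exact: (dom_self lM).
  apply/funext => i; rewrite /= -[RHS](phiK lM (xy i)).
  by apply: (congr1 (@psi R M (x i))); apply/rowP => j; rewrite !mxE.
rewrite openE => _ [y xy <-].
pose P i (A : 'M[R]_(k, mdim M)) := (phi (x i) @` dom (x i)) (row i A).
have nP : \forall A \near (@phi R (powC M k) x y : 'M[R]_(k, mdim M)), forall i : 'I_k, P i A.
  apply: (@filter_forall _ _ P _ (nbhs_filter (@phi R (powC M k) x y : 'M[R]_(k, mdim M)))) => i.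
  have := @row_continuous k (mdim M) i (@phi R (powC M k) x y)
    (@phi R M (x i) @` dom (x i)).
  apply.
  apply: open_nbhs_nbhs; split; first exact: open_range lM _.
  by exists (y i) => //; apply/rowP => j; rewrite !mxE.
apply: filterS nP => A PA.
exists (@psi R (powC M k) x A) => [i|]; first exact: (dom_psi lM (PA i)).
apply/matrixP => i j; rewrite mxE.
have := congr1 (fun r : 'rV[R]_(mdim M) => r ord0 j) (psiK lM (PA i)).
by rewrite [X in _ = X]mxE.
Qed.

Lemma smooth_at_proj (M : manifold R) k (i : 'I_k) (x : powC M k) :
  smooth_at (Y := M) (fun y : powC M k => y i) x.
Proof.
have lP := powC_local_charts M k; have lM := atlas_local (manifold_atlas M).
exists (phi x @` dom x); split=> //.
- exact: open_range.
- exact: range_self.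
- by move=> a /(dom_psi lP) /(_ i).
- apply: (@Csmooth_eq R _ _ _ (row i)); first exact: (open_range lP).
    move=> _ [y xy <-]; rewrite (_ : row i _ = phi (x i) (y i)) /=.
      by have /(congr1 (fun z : powC M k => z i)) /= -> := phiK lP xy.
    by apply/rowP => j; rewrite !mxE.
  by apply: Csmooth_linear; [exact: row_linear|exact: row_continuous].
Qed.

Lemma tanC_local_charts (X : charted R) : atlas X -> local_charts (tanC X).
Proof.
move=> aX; have lX := atlas_local aX.
split=> [[x v]|[x v] [y w] /= xy|[x v]]; first exact: (dom_self lX).
- rewrite (phiK lX xy); congr pair.
  exact: (transitionK aX w (dom_self lX y) xy).
(* Transitions are invertible, so every vector of the model occurs as a fibre coordinate. *)
- have -> : @phi R (tanC X) (x, v) @` @dom R (tanC X) (x, v)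
     = (phi x @` dom x) `*` setT.
    apply/seteqP; split=> [_ [[y w] /= xy <-]|[_ w] [/= [y xy <-] _]].
      by split=> //=; exists y.
    exists (y, transition x y y w) => //; congr pair.
    exact: (transitionK aX w xy (dom_self lX y)).
  by apply: openX; [exact: open_range|exact: openT].
Qed.

Lemma tanC_range (X : charted R) (aX : atlas X) (p : tanC X) a :
  (phi p.1 @` dom p.1) a.1 -> (phi p @` dom p) a.
Proof.
have lX := atlas_local aX.
case: p a => [x v] [a w] /= [y xy <-].
exists (y, transition x y y w) => //; congr pair.
exact: (transitionK aX w xy (dom_self lX y)).
Qed.

Lemma tanC_findim (X : charted R) : atlas X -> findim (model (tanC X)).
Proof. by move=> aX; apply: findim_prod; apply: atlas_findim. Qed.

End Atlases.

(** * Smoothness in charts *)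

Section Germs.
Variable R : realType.

(** Hiding the neighbourhood lets a formula assembled from several local maps be proved smooth
    without intersecting their domains by hand. *)
Definition smooth_germ (V W : normedModType R) (f : V -> W) (a : V) : Prop :=
  exists U, [/\ open U, U a & Csmooth U f].

Section GermTheory.
Variables V W Z : normedModType R.
Implicit Types (a : V).

Lemma germ_continuous (f : V -> W) a : smooth_germ f a -> {for a, continuous f}.
Proof. by move=> [U [oU Ua cU]]; exact: Csmooth_continuous cU Ua. Qed.

Lemma germ_near (f : V -> W) a (P : set W) :
  smooth_germ f a -> nbhs (f a) P -> \forall x \near a, P (f x).
Proof. by move=> sf; exact: germ_continuous sf P. Qed.

Lemma germ_comp (f : V -> W) (g : W -> Z) a : findim W ->
  smooth_germ f a -> smooth_germ g (f a) -> smooth_germ (fun x => g (f x)) a.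
Proof.
move=> fW [U [oU Ua cU]] [U' [oU' Ua' cU']].
have oO : open (U `&` f @^-1` U').
  by apply: open_preimage_in => // x; exact: Csmooth_continuous.
exists (U `&` f @^-1` U'); split=> //.
apply: (Csmooth_comp fW oO oU') cU' => [x []//|].
by apply: Csmooth_sub cU => x [].
Qed.

Lemma germ_pair (f : V -> W) (g : V -> Z) a :
  smooth_germ f a -> smooth_germ g a -> smooth_germ (fun x => (f x, g x)) a.
Proof.
move=> [U [oU Ua cU]] [U' [oU' Ua' cU']]; have oUU' := openI oU oU'.
exists (U `&` U'); split=> //; apply: Csmooth_pair => //.
  by apply: Csmooth_sub cU => x [].
by apply: Csmooth_sub cU' => x [].
Qed.

Lemma germ_add (f g : V -> W) a :
  smooth_germ f a -> smooth_germ g a -> smooth_germ (fun x => f x + g x) a.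
Proof.
move=> [U [oU Ua cU]] [U' [oU' Ua' cU']]; have oUU' := openI oU oU'.
exists (U `&` U'); split=> //; apply: Csmooth_add => //.
  by apply: Csmooth_sub cU => x [].
by apply: Csmooth_sub cU' => x [].
Qed.

Lemma germ_opp (f : V -> W) a :
  smooth_germ f a -> smooth_germ (fun x => - f x) a.
Proof. by move=> [U [oU Ua cU]]; exists U; split=> //; exact: Csmooth_opp. Qed.

Lemma germ_cst (w : W) a : smooth_germ (fun=> w) a.
Proof. by exists setT; split=> //; [exact: openT|exact: Csmooth_cst]. Qed.

Lemma germ_linear (f : V -> W) a : findim V -> linear f -> smooth_germ f a.
Proof.
move=> fV lf; exists setT; split=> //; first exact: openT.
by apply: Csmooth_linear => //; exact: findim_linear_continuous.
Qed.

Lemma germ_near_eq (f g : V -> W) a :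
  smooth_germ f a -> (\forall x \near a, f x = g x) -> smooth_germ g a.
Proof.
move=> [U [oU Ua cU]] fg.
have : nbhs a [set x | f x = g x] by exact: fg.
rewrite nbhsE; case=> O [oO Oa] sO.
have oUO := openI oU oO; exists (U `&` O); split=> //.
apply: (@Csmooth_eq _ _ _ _ f) => // [x [_ /sO]//|].
by apply: Csmooth_sub cU => x [].
Qed.

End GermTheory.

Lemma germ_diff (V W Z : normedModType R) (p w : V -> W) (f : W -> Z) a :
  findim W -> smooth_germ f (p a) -> smooth_germ p a -> smooth_germ w a ->
  smooth_germ (fun x => 'd f (p x) (w x)) a.
Proof.
move=> fW [U' [oU' Ua' cU']] [U [oU Ua cU]] [Q [oO Oa cO]].
have oUO := openI oU oO.
have oO' : open ((U `&` Q) `&` p @^-1` U').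
  by apply: open_preimage_in => // x [Ux _]; exact: Csmooth_continuous cU Ux.
exists ((U `&` Q) `&` p @^-1` U'); split=> //.
apply: (Csmooth_diff fW oO' oU') cU' => [x []//||].
  by apply: Csmooth_sub cU => x [[]].
by apply: Csmooth_sub cO => x [[]].
Qed.

Lemma smooth_at_germ (X Y : charted R) (F : X -> Y) x :
  smooth_at F x -> smooth_germ (phi (F x) \o F \o psi x) (phi x x).
Proof. by case=> U [oU Ux _ _ cU]; exists U. Qed.

Lemma cnbhs_dom (X : charted R) (lX : local_charts X) (x : X) :
  cnbhs x [set y | dom x y].
Proof.
apply: filterS (open_nbhs_nbhs (conj (open_range lX x) (range_self lX x))) => a.
exact: dom_psi.
Qed.

Lemma nbhs_cnbhs (X : charted R) (lX : local_charts X) (x : X) (P : set (model X)) :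
  nbhs (phi x x) P -> cnbhs x [set y | P (phi x y)].
Proof.
move=> nP; apply: filterS2 nP
  (open_nbhs_nbhs (conj (open_range lX x) (range_self lX x))) => a Pa ra.
by rewrite /preimage /= (psiK lX).
Qed.

(** Ensures that a local extension around [x0] is also one around every nearby point, although
    [cnbhs] refers to a different chart at each point. *)
Lemma cnbhs_near (X : charted R) (aX : atlas X) (x0 : X) (O : set X) :
  cnbhs x0 O -> cnbhs x0 [set x | cnbhs x O].
Proof.
have lX := atlas_local aX.
rewrite {1}/cnbhs nbhsE; case=> U [oU Ux] sU.
have := nbhs_cnbhs lX (open_nbhs_nbhs (conj oU Ux)).
move=> /(cnbhsI (cnbhs_dom lX x0)); apply: cnbhsS => x [/= dx Ux'].
have [no c] := transition_smooth aX x x0.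
have m : (phi x @` (dom x `&` dom x0)) (phi x x).
  by exists x => //; split=> //; exact: dom_self.
have ct := Csmooth_continuous c m.
have nU : nbhs ((phi x0 \o psi x) (phi x x)) U.
  by rewrite /= (psi_phi_self lX); exact: open_nbhs_nbhs (conj oU Ux').
have n1 : nbhs (phi x x) ((phi x0 \o psi x) @^-1` U) := ct _ nU.
have n2 := open_nbhs_nbhs (conj no m).
change (nbhs (phi x x) (psi x @^-1` O)); apply: filterS2 n1 n2 => a Ua [z [xz dz]
  ez]; move: Ua; rewrite -ez.
rewrite /preimage /= (phiK lX xz) => /sU.
by rewrite /preimage /= (phiK lX dz).
Qed.

(** Makes the dependence of [mdiff F x] on [x] visible: in the charts at [x0] and [F x0] it is the
    derivative of one fixed smooth map. *)
Lemma smooth_at_cnbhs (X Y : charted R) (aX : atlas X) (aY : atlas Y)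
    (F : X -> Y) (x0 : X) : smooth_at F x0 ->
  cnbhs x0 [set x | [/\ dom x0 x, smooth_at F x, dom (F x0) (F x) &
    forall v, transition (F x) (F x0) (F x) (mdiff F x v) =
      'd (phi (F x0) \o F \o psi x0) (phi x0 x) (transition x x0 x v)]].
Proof.
have lX := atlas_local aX.
case=> U [oU Ux sU dU cU].
have := nbhs_cnbhs lX (open_nbhs_nbhs (conj oU Ux)).
move=> /(cnbhsI (cnbhs_dom lX x0)); apply: cnbhsS => x [/= dx Ux'].
have [sF e] := smooth_at_chart aX aY oU sU dU cU dx Ux'.
by split=> //; have := dU _ Ux'; rewrite (phiK lX).
Qed.

Lemma transition_prod (X Y : charted R) (aX : atlas X) (aY : atlas Y)
    (p q r : prodC X Y) v w : dom p r -> dom q r ->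
  transition p q r (v, w) =
  (transition p.1 q.1 r.1 v, transition p.2 q.2 r.2 w) :> model X * model Y.
Proof.
move=> [pr1 pr2] [qr1 qr2].
have d1 := transition_differentiable aX pr1 qr1.
have d2 := transition_differentiable aY pr2 qr2.
have cf : continuous (fst : model X * model Y -> model X).
  by move=> a; exact: cvg_fst.
have cs : continuous (snd : model X * model Y -> model Y).
  by move=> a; exact: cvg_snd.
have df := linear_differentiable (phi p r) cf.
have ds := linear_differentiable (phi p r) cs.
pose h1 := (phi q.1 \o psi p.1) \o (fst : model X * model Y -> model X).
pose h2 := (phi q.2 \o psi p.2) \o (snd : model X * model Y -> model Y).
have d3 : differentiable h1 (phi p r) by exact: differentiable_comp df d1.
have d4 : differentiable h2 (phi p r) by exact: differentiable_comp ds d2.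
have e := congr1 (fun k : model X * model Y -> model X * model Y => k (v, w))
  (diff_pair d3 d4).
have e1 := diff_comp_near (h := h1) (v, w) (erefl (phi p r).1) df d1 (filterE _ (fun=> erefl)).
have e2 := diff_comp_near (h := h2) (v, w) (erefl (phi p r).2) ds d2 (filterE _ (fun=> erefl)).
apply: (etrans e); rewrite e1 e2; congr pair.
  exact (congr1 ('d (phi q.1 \o psi p.1) (phi p.1 r.1))
    (congr1 (fun k : model X * model Y -> model X => k (v, w)) (diff_lin (phi p r) cf))).
exact (congr1 ('d (phi q.2 \o psi p.2) (phi p.2 r.2))
    (congr1 (fun k : model X * model Y -> model Y => k (v, w)) (diff_lin (phi p r) cs))).
Qed.

Lemma smooth_at_of_germ (X Y : charted R) (lX : local_charts X) (F : X -> Y) x :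
  smooth_germ (phi (F x) \o F \o psi x) (phi x x) ->
  cnbhs x [set y | dom (F x) (F y)] -> smooth_at F x.
Proof.
move=> [U [oU Ux cU]]; rewrite /cnbhs nbhsE; case=> O [oO Ox] sO.
have oR := open_range lX x; have oV := openI (openI oU oO) oR.
exists ((U `&` O) `&` (phi x @` dom x)); split=> //.
- by split=> //; exact: range_self.
- by move=> a [[_ Oa] _]; exact: sO.
- by apply: Csmooth_sub cU => a [[]].
Qed.

Lemma germ_sum (V W : normedModType R) n (f : 'I_n -> V -> W) a :
  (forall i, smooth_germ (f i) a) -> smooth_germ (fun x => \sum_(i < n) f i x) a.
Proof.
move=> sf; elim: (index_enum _) => [|i r IH].
  by under eq_fun do rewrite big_nil; exact: germ_cst.
by under eq_fun do rewrite big_cons; exact: germ_add.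
Qed.

Lemma smooth_at_powC (X : charted R) (M : manifold R) k (F : X -> powC M k) x :
  local_charts X -> (forall i : 'I_k, smooth_at (Y := M) (fun y => F y i) x) ->
  smooth_at F x.
Proof.
move=> lX sF; apply: smooth_at_of_germ => //; last first.
  apply: (@filter_forall _ _ (fun i a => @dom R M (F x i) (F (psi x a) i)) _
    (nbhs_filter (phi x x))) => i.
  case: (sF i) => U [oU Ux _ dU _].
  by apply: filterS (open_nbhs_nbhs (conj oU Ux)) => a /dU.
(* Inserts a vector as the i-th row of a zero matrix; a matrix is the sum of these, which reduces
   the claim to its rows. *)
pose L (i : 'I_k) (r : 'rV[R]_(mdim M)) : 'M[R]_(k, mdim M) :=
  \matrix_(i', j) (if i' == i then r ord0 j else 0).
have lL i : linear (L i).
  move=> b u v; apply/matrixP => i' j; rewrite !mxE.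
  by case: eqP => _; rewrite ?mxE // mulr0 addr0.
have gi i : smooth_germ (fun a => L i (@phi R M (F x i) (F (psi x a) i))) (phi x x).
  apply: (germ_comp (f := fun a => @phi R M (F x i) (F (psi x a) i)) (g := L i)).
  - exact: findim_mx.
  - exact: smooth_at_germ (sF i).
  - by apply: germ_linear (lL i); exact: findim_mx.
apply: germ_near_eq (germ_sum gi) _; apply: filterE => a.
apply/matrixP => i j; rewrite summxE (bigD1 i) //= !mxE eqxx big1 ?addr0 //.
by move=> i' /negbTE ni; rewrite mxE eq_sym ni.
Qed.

End Germs.

Section SmoothSub.
Variable R : realType.
Variables (X Y : charted R) (lX : local_charts X) (aY : atlas Y).
Variables (S : set X) (b : {x | S x} -> Y) (v : {x | S x} -> model Y).

Let exist_svalP (y : {x | S x}) : exist _ (sval y) (svalP y) = y.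
Proof. by case: y => z Sz; apply: eq_exist. Qed.

(** The germ is the fibre coordinate of a local extension, in the chart at [b x0]. With the converse
    below, smoothness of vector-valued cochains becomes a question about germs. *)
Lemma smooth_sub_germ (x0 : {x | S x}) :
  smooth_sub (Y := tanC Y) (fun x => (b x, v x)) ->
  exists2 nu, smooth_germ nu (phi (sval x0) (sval x0)) &
    cnbhs (sval x0) [set x | forall Sx : S x,
      dom (b x0) (b (exist _ x Sx)) /\
      transition (b (exist _ x Sx)) (b x0) (b (exist _ x Sx)) (v (exist _ x Sx))
        = nu (phi (sval x0) x)].
Proof.
move=> sm; have [F [sF nF]] := sm x0.
have Fx : F (sval x0) = (b x0, v x0).
  by have := cnbhs_self lX nF (svalP x0) => /= ->; rewrite exist_svalP.
have gF := smooth_at_germ sF.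
case: sF => U [oU Ux sU dU _]; rewrite Fx in gF dU.
exists (fun a => (@phi R (tanC Y) (b x0, v x0) (F (psi (sval x0) a))).2).
  apply: (germ_comp (f := @phi R (tanC Y) (b x0, v x0) \o F \o psi (sval x0))
    (g := snd) (tanC_findim aY) gF).
  by exists setT; split=> //; [exact: openT|exact: Csmooth_snd].
have nU := nbhs_cnbhs lX (open_nbhs_nbhs (conj oU Ux)).
apply: cnbhsS (cnbhsI (cnbhs_dom lX (sval x0)) (cnbhsI nU nF)) => x [/= dx [Ux' Fx']] Sx.
have := dU _ Ux'; rewrite (phiK lX dx) (Fx' Sx) => d.
by split=> //; rewrite (phiK lX dx) (Fx' Sx).
Qed.

(* The extension is built in the chart at [b x0], where only the coordinates of
   the vectors have to be extended: the base points are those of [B]. *)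
Lemma smooth_sub_of_germ :
  (forall x0 : {x | S x},
   (exists2 B : X -> Y, smooth_at B (sval x0) & forall y, b y = B (sval y)) /\
   exists2 nu, smooth_germ nu (phi (sval x0) (sval x0)) &
     cnbhs (sval x0) [set x | forall Sx : S x, dom (b x0) (b (exist _ x Sx)) ->
      transition (b (exist _ x Sx)) (b x0) (b (exist _ x Sx)) (v (exist _ x Sx))
        = nu (phi (sval x0) x)]) ->
  smooth_sub (Y := tanC Y) (fun x => (b x, v x)).
Proof.
move=> H x0; have [[B sB bB] [nu gnu hnu]] := H x0.
have lY := atlas_local aY; have lT := tanC_local_charts aY.
have gB := smooth_at_germ sB; rewrite -bB in gB.
case: sB => U [oU Ux sU dU _]; rewrite -bB in dU.
pose p : tanC Y := (b x0, v x0).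
pose beta := phi (b x0) \o B \o psi (sval x0).
pose F y := @psi R (tanC Y) p (beta (phi (sval x0) y), nu (phi (sval x0) y)).
have nU := nbhs_cnbhs lX (open_nbhs_nbhs (conj oU Ux)).
have nA : cnbhs (sval x0) [set x | forall Sx : S x, F x = (b (exist _ x Sx), v (exist _ x Sx))].
  apply: cnbhsS (cnbhsI (cnbhs_dom lX (sval x0)) (cnbhsI nU hnu)) => x [/= dx [Ux' hx]] Sx.
  have e : b (exist _ x Sx) = B x by rewrite bB.
  have db : dom (b x0) (b (exist _ x Sx)).
    by have := dU _ Ux'; rewrite (phiK lX dx) e.
  rewrite -[RHS](phiK lT (x := p)) // /F; apply: (congr1 (@psi R (tanC Y) p)); congr pair.
    by rewrite /beta /= (phiK lX dx) e.
  exact: esym (hx Sx db).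
have Fx : F (sval x0) = p.
  by have := cnbhs_self lX nA (svalP x0) => /= ->; rewrite exist_svalP.
have rB : \forall a \near phi (sval x0) (sval x0),
    (phi (b x0) @` dom (b x0)) (beta a) /\ phi (sval x0) (psi (sval x0) a) = a.
  apply: filterS (open_nbhs_nbhs (conj oU Ux)) => a Ua; split.
    by exists (B (psi (sval x0) a)) => //; exact: dU.
  by rewrite (psiK lX) //; exact: sU.
exists F; split=> //; apply: smooth_at_of_germ => //; rewrite Fx.
  apply: germ_near_eq (germ_pair gB gnu) _.
  apply: filterS rB => a [ra ea]; rewrite /F /= ea.
  by rewrite -[LHS](psiK lT (x := p)) //; exact: tanC_range.
apply: filterS rB => a [ra ea]; rewrite /F /preimage /= ea.
exact: (dom_psi lY).
Qed.

End SmoothSub.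

(** * Tangent vectors of equalizers and differentiation of identities *)

Section Equalizers.
Variable R : realType.

Lemma tangentT (X : charted R) (lX : local_charts X) (x : X) v :
  tangent [set: X] x v.
Proof.
move=> eta eta0; near=> eps; have eps0 : 0 < eps by [].
exists (phi x x + eps *: v) => //.
by rewrite subrr normr0 mulr_ge0 // ltW.
Unshelve. all: by end_near. Qed.

(** Near [x] the equalizer is a level set of the difference of [F] and [F'], read in the chart at
    their common value, and the surjectivity hypothesis is transversality. With [F'] constant this
    covers the fibres of a submersion. *)
Lemma tangent_equalizer (X : charted R) (M : manifold R) (F F' : X -> M) x v :
  local_charts X -> smooth_at F x -> smooth_at F' x -> F x = F' x ->
  (forall w, exists v, mdiff F x v - mdiff F' x v = w) ->
  mdiff F x v = mdiff F' x v -> tangent [set y | F y = F' y] x v.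
Proof.
move=> lX sF sF' Fx surj dv.
have lM := atlas_local (manifold_atlas M).
have dF := smooth_at_differentiable sF.
have dF' := smooth_at_differentiable sF'.
case: sF sF' => U [oU Ux sU dU cU] [U' [oU' Ux' sU' dU' cU']].
rewrite -Fx in dU' cU' dF'.
have e := diffB dF dF'.
have {}e w : 'd ((phi (F x) \o F \o psi x) - (phi (F x) \o F' \o psi x)) (phi x x) w =
  mdiff F x w - mdiff F' x w.
  by have /(congr1 (fun k : model X -> model M => k w)) := e; rewrite /mdiff -Fx.
pose h (y : X) : model M := phi (F x) (F y) - phi (F x) (F' y).
have oUU' : open (U `&` U') by exact: openI.
have c1 : Csmooth (U `&` U') (phi (F x) \o F \o psi x).
  by apply: Csmooth_sub cU => a [].
have c2 : Csmooth (U `&` U') (phi (F x) \o F' \o psi x).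
  by apply: Csmooth_sub cU' => a [].
have ch : Csmooth (U `&` U') (h \o psi x).
  have c3 := Csmooth_opp oUU' c2.
  have c4 := Csmooth_add oUU' c1 c3.
  exact: c4.
have UUx : (U `&` U') (phi x x) by split.
have surj' : forall w, exists v, 'd (h \o psi x) (phi x x) v = w.
  by move=> w; have [u <-] := surj w; exists u; exact: e.
have dv' : 'd (h \o psi x) (phi x x) v = 0.
  by rewrite [LHS]e dv subrr.
have hS a : (U `&` U') a -> h (psi x a) = h x -> F (psi x a) = F' (psi x a).
  move=> [Ua U'a]; rewrite /h -Fx subrr => /eqP; rewrite subr_eq0 => /eqP.
  move=> /(congr1 (psi (F x))).
  rewrite (phiK lM (dU _ Ua)) (phiK lM (dU' _ U'a)); exact.
have key := @level_set_tangent_chart R X lX (mdim M) h.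
have key' := key [set y | F y = F' y] (U `&` U') x v oUU' UUx ch surj' hS dv'.
exact: key'.
Qed.

Section SdiffSmooth.
Variables (X Y Z : charted R).
Variables (lX : local_charts X) (lY : local_charts Y).
Hypothesis fY : findim (model Y).

Lemma sdiff_comp_smooth (S : set X) (f : X -> Y) (f' : Y -> Z) x v :
  S x -> extendable S f x -> smooth_at f' (f x) -> tangent S x v ->
  @sdiff R X Z S (f' \o f) x v = mdiff f' (f x) (@sdiff R X Y S f x v).
Proof.
move=> Sx ef sf' tv.
have [_ _ ->] := @sdiff_comp R X Y Z lX lY fY S setT f f' x v Sx (fun _ _ => I) ef
  (smooth_extendable setT sf') tv.
by rewrite (sdiff_smooth lY) //; exact: tangentT.
Qed.

Lemma mdiff_sdiff (S : set X) (f : X -> Y) (f' : Y -> Z) (h : X -> Z) x v :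
  S x -> extendable S f x -> smooth_at f' (f x) -> smooth_at h x ->
  (forall y, S y -> f' (f y) = h y) -> tangent S x v ->
  mdiff f' (f x) (@sdiff R X Y S f x v) = mdiff h x v.
Proof.
move=> Sx ef sf' sh e tv; rewrite -(sdiff_comp_smooth Sx ef sf' tv).
by rewrite (@eq_sdiff R X Z S (f' \o f) h x e) sdiff_smooth.
Qed.

(** The form in which groupoid identities, valid on [S] only, are differentiated. *)
Lemma sdiff_sdiff (S : set X) (S' : set Y) (f : X -> Y) (f' : Y -> Z)
    (h : X -> Z) x v :
  S x -> (forall y, S y -> S' (f y)) -> extendable S f x ->
  extendable S' f' (f x) -> (forall y, S y -> f' (f y) = h y) ->
  tangent S x v ->
  @sdiff R Y Z S' f' (f x) (@sdiff R X Y S f x v) = @sdiff R X Z S h x v.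
Proof.
move=> Sx SS' ef ef' e tv.
have [_ _ <-] := sdiff_comp lX lY fY Sx SS' ef ef' tv.
by rewrite (@eq_sdiff R X Z S (f' \o f) h x e).
Qed.

Lemma mdiff_mdiff (f : X -> Y) (f' : Y -> Z) (h : X -> Z) x v :
  smooth_at f x -> smooth_at f' (f x) -> (forall y, f' (f y) = h y) ->
  mdiff f' (f x) (mdiff f x v) = mdiff h x v.
Proof.
move=> sf sf' e; have [_ d] := smooth_at_comp lX lY fY sf sf'.
rewrite -[LHS]/((mdiff f' (f x) \o mdiff f x) v) -d.
by rewrite (_ : f' \o f = h) //; apply/funext.
Qed.

End SdiffSmooth.

End Equalizers.

(** * Isomorphisms of complexes *)

Section LinearFunctions.

Lemma linear_fun0 (R : realType) (V W : lmodType R) (f : V -> W) : linear f -> f 0 = 0.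
Proof. by move=> lf; have := lf (-1) 0 0; rewrite scaler0 addr0 scaleN1r addNr. Qed.

Lemma linear_funD (R : realType) (V W : lmodType R) (f : V -> W) x y :
  linear f -> f (x + y) = f x + f y.
Proof. by move=> lf; rewrite -{1}[x]scale1r lf scale1r. Qed.

Lemma linear_funZ (R : realType) (V W : lmodType R) (f : V -> W) a x :
  linear f -> f (a *: x) = a *: f x.
Proof. by move=> lf; rewrite -{1}[a *: x]addr0 lf (linear_fun0 lf) addr0. Qed.

Lemma linear_funN (R : realType) (V W : lmodType R) (f : V -> W) x :
  linear f -> f (- x) = - f x.
Proof. by move=> lf; rewrite -scaleN1r (linear_funZ _ _ lf) scaleN1r. Qed.

Lemma linear_fun_sum (R : realType) (V W : lmodType R) (f : V -> W) I (r : seq I) (F : I -> V) :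
  linear f -> f (\sum_(i <- r) F i) = \sum_(i <- r) f (F i).
Proof.
move=> lf; elim: r => [|i r IH]; first by rewrite !big_nil linear_fun0.
by rewrite !big_cons (linear_funD _ _ lf) IH.
Qed.

End LinearFunctions.

Section ComplexIso.
Variable R : realType.
Variables (C C' : complex R).
Variable S : forall k, ambient C k -> ambient C' k.
(* [S] is injective only where the symbol is defined, i.e. on [P]. *)
Variable P : forall k, set (ambient C k).

Hypothesis S_linear : forall k, linear (@S k).
Hypothesis P_linear : forall k a x y, @P k x -> @P k y -> @P k (a *: x + y).
Hypothesis P_cochain : forall k c, @cochain _ C k c -> @P k c.
Hypothesis P_codiff : forall k c, @cochain _ C k c -> @P k.+1 (@codiff _ C k c).
Hypothesis S_inj : forall k x, @P k x -> @S k x = 0 -> x = 0.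
Hypothesis S_cochain : forall k, @S k @` @cochain _ C k = @cochain _ C' k.
Hypothesis S_codiff : forall k c, @cochain _ C k c ->
  @S k.+1 (@codiff _ C k c) = @codiff _ C' k (@S k c).

Lemma image_hclass k (c : ambient C k) : @S k @` hclass c = hclass (@S k c).
Proof.
have SB : @S k @` @coboundary _ C k = @coboundary _ C' k.
  case: k c => [|k] c.
    apply/seteqP; split=> [_ [_ -> <-]|_ ->]; first exact: linear_fun0.
    by exists 0 => //; exact: linear_fun0.
  apply/seteqP; split=> [_ [_ [x cx <-] <-]|_ [x' cx' <-]].
    by exists (@S k x); [rewrite -S_cochain; exists x|exact: esym (S_codiff cx)].
  have : (@S k @` @cochain _ C k) x' by rewrite S_cochain.
  move=> [x cx <-]; exists (@codiff _ C k x); first by exists x.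
  exact: S_codiff.
rewrite /hclass -SB; apply/seteqP; split=> [_ [_ [b Bb <-] <-]|_ [_ [b Bb <-] <-]].
  by exists (@S k b); [exists b|rewrite (linear_funD _ _ (@S_linear k))].
by exists (c + b); [exists b|rewrite (linear_funD _ _ (@S_linear k))].
Qed.

Lemma P_hclass k (c x : ambient C k) : cocycle c -> hclass c x -> @P k x.
Proof.
move=> [cc _] [b Bb <-]; rewrite -[c]scale1r; apply: P_linear; first exact: P_cochain.
case: k c {x} cc b Bb => [|k] c cc b /=; last by move=> [d cd <-]; exact: P_codiff.
(* In degree 0 the only coboundary is 0, which lies in [P] as - c + c. *)
move=> ->; have := P_linear (-1) (P_cochain cc) (P_cochain cc).
by rewrite scaleN1r addNr.
Qed.

(** Direct image acts on whole cosets, so no representative is chosen. [P] contains every class of a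
    cocycle and every codifferential of a cochain, the two places where injectivity of [S] is
    applied. *)
Lemma complex_iso : cohomology_iso (fun k A => @S k @` A).
Proof.
move=> k; split; last first.
  move=> a A B _ _; apply/seteqP; split=> [_ [_ [x Ax [y By <-]] <-]|].
    exists (@S k x); first by exists x.
    by exists (@S k y); [exists y|rewrite S_linear].
  move=> _ [_ [x Ax <-] [_ [y By <-] <-]]; exists (a *: x + y).
    by exists x => //; exists y.
  by rewrite S_linear.
split.
- move=> _ [c [cc dc] <-]; exists (@S k c); last by rewrite image_hclass.
  split; first by rewrite -S_cochain; exists c.
  by rewrite -S_codiff // dc (linear_fun0 (@S_linear k.+1)).
- move=> A B; rewrite !inE => -[c zc <-] [d zd <-] e.
  have sub c1 d1 : cocycle c1 -> cocycle d1 ->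
      @S k @` hclass c1 = @S k @` hclass d1 -> hclass c1 `<=` hclass d1.
    move=> z1 z2 e1 x hx.
    have [y hy Sxy] : (@S k @` hclass d1) (@S k x) by rewrite -e1; exists x.
    suff -> : x = y by [].
    apply/eqP; rewrite -subr_eq0; apply/eqP/S_inj.
      rewrite addrC -scaleN1r; apply: P_linear.
        exact: P_hclass z2 hy.
      exact: P_hclass z1 hx.
    rewrite (linear_funD _ _ (@S_linear k)) (linear_funN _ (@S_linear k)) Sxy.
    exact: subrr.
  by apply/seteqP; split; apply: sub.
- move=> _ [c' [cc' dc'] <-].
  have : (@S k @` @cochain _ C k) c' by rewrite S_cochain.
  move=> [c cc Sc]; exists (hclass c); last by rewrite image_hclass Sc.
  (* The preimage [c] is a cocycle: its codifferential lies in [P] and [S] sends it to that of [c'],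
     which is 0. *)
  exists c => //; split=> //; apply: S_inj; first exact: P_codiff.
  by rewrite S_codiff // Sc.
Qed.

End ComplexIso.

(** * The tangent groupoid *)

Section LieGroupoid.
Variable R : realType.
Variable G : lie_groupoid R.
Local Notation M := (objects G).
Local Notation s := (@src R G).
Local Notation t := (@tgt R G).
Local Notation "1_ x" := (unt x) (at level 9, x at level 2).
Local Notation "g ∘ h" := (mul g h) (at level 40, left associativity).

Let aG : atlas G := manifold_atlas G.
Let aM : atlas M := manifold_atlas M.
Let lG : local_charts G := atlas_local aG.
Let lM : local_charts M := atlas_local aM.
Let fG : findim (model G) := atlas_findim aG.
Let fM : findim (model M) := atlas_findim aM.
Let aGG : atlas (prodC G G) := prodC_atlas aG aG.
Let lGG : local_charts (prodC G G) := atlas_local aGG.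
Let fGG : findim (model (prodC G G)) := atlas_findim aGG.

Lemma unt_inv (x : M) : inv 1_x = 1_x :> G.
Proof. by rewrite -[LHS](unt_mul (inv 1_x)) tgt_inv src_unt mul_inv tgt_unt. Qed.

Lemma mulK (g h : G) : s g = t h -> g ∘ h ∘ inv h = g.
Proof. by move=> gh; rewrite -mulA ?tgt_inv // mul_inv -gh mul_unt. Qed.

Lemma mul_mulV (g b h : G) : s g = t h -> s b = t h ->
  g ∘ h ∘ inv (b ∘ h) = g ∘ inv b.
Proof.
move=> gh bh; have tb : t (inv b) = t h by rewrite tgt_inv.
have e : h = inv b ∘ (b ∘ h).
  by rewrite mulA ?src_inv // inv_mul bh unt_mul.
rewrite [X in g ∘ X]e mulA ?src_inv ?tgt_inv ?tgt_mul ?gh //.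
by rewrite mulK // src_mul ?tb // src_inv tgt_mul.
Qed.

Lemma smooth_src g : smooth_at s g. Proof. by case: (@src_submersion R G). Qed.
Lemma smooth_tgt g : smooth_at t g. Proof. by case: (@tgt_submersion R G). Qed.

Definition composables : set (prodC G G) := [set p | s p.1 = t p.2].
Definition divisibles : set (prodC G G) := [set p | s p.1 = s p.2].
Definition src_fibre (x : M) : set G := [set b | s b = x].
Definition tgt_fibre (x : M) : set G := [set b | t b = x].

Lemma smooth_at_fst_comp (f : G -> M) (p : prodC G G) : smooth_at f p.1 ->
  smooth_at (X := prodC G G) (fun q => f q.1) p /\
  @mdiff R (prodC G G) M (fun q => f q.1) p = fun v => mdiff f p.1 v.1.
Proof.
move=> sf; have [s1 d1] := smooth_at_fst lG lG p.
have [s2 d2] := smooth_at_comp lGG lG fG s1 sf.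
by split=> //; rewrite [LHS]d2 d1.
Qed.

Lemma smooth_at_snd_comp (f : G -> M) (p : prodC G G) : smooth_at f p.2 ->
  smooth_at (X := prodC G G) (fun q => f q.2) p /\
  @mdiff R (prodC G G) M (fun q => f q.2) p = fun v => mdiff f p.2 v.2.
Proof.
move=> sf; have [s1 d1] := smooth_at_snd lG lG p.
have [s2 d2] := smooth_at_comp lGG lG fG s1 sf.
by split=> //; rewrite [LHS]d2 d1.
Qed.

Lemma mdiff0 (X Y : charted R) (f : X -> Y) x : mdiff f x 0 = 0.
Proof. exact: linear0. Qed.

(** Transversality holds because [s] is a submersion: vectors of the form (v, 0) suffice. *)
Lemma tangent_composables g h X Y : s g = t h ->
  mdiff s g X = mdiff t h Y -> @tangent R (prodC G G) composables (g, h) (X, Y).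
Proof.
move=> gh XY; have [s1 d1] := @smooth_at_fst_comp s (g, h) (smooth_src g).
have [s2 d2] := @smooth_at_snd_comp t (g, h) (smooth_tgt h).
apply: (tangent_equalizer lGG s1 s2 gh) => [w|]; rewrite d1 d2 //.
have [_ /(_ g w) [v <-]] := @src_submersion R G.
by exists (v, 0); rewrite mdiff0 subr0.
Qed.

Lemma tangent_divisibles g h X Y : s g = s h ->
  mdiff s g X = mdiff s h Y -> @tangent R (prodC G G) divisibles (g, h) (X, Y).
Proof.
move=> gh XY; have [s1 d1] := @smooth_at_fst_comp s (g, h) (smooth_src g).
have [s2 d2] := @smooth_at_snd_comp s (g, h) (smooth_src h).
apply: (tangent_equalizer lGG s1 s2 gh) => [w|]; rewrite d1 d2 //.
have [_ /(_ g w) [v <-]] := @src_submersion R G.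
by exists (v, 0); rewrite mdiff0 subr0.
Qed.

Lemma tangent_src_fibre a x X : s a = x -> mdiff s a X = 0 ->
  tangent (src_fibre x) a X.
Proof.
move=> sa dX; have [s2 d2] := smooth_at_cst lG lM a x.
apply: (tangent_equalizer lG (smooth_src a) s2 sa) => [w|]; rewrite d2 //.
have [_ /(_ a w) [v <-]] := @src_submersion R G.
by exists v; rewrite subr0.
Qed.

Lemma tangent_tgt_fibre a x X : t a = x -> mdiff t a X = 0 ->
  tangent (tgt_fibre x) a X.
Proof.
move=> ta dX; have [s2 d2] := smooth_at_cst lG lM a x.
apply: (tangent_equalizer lG (smooth_tgt a) s2 ta) => [w|]; rewrite d2 //.
have [_ /(_ a w) [v <-]] := @tgt_submersion R G.
by exists v; rewrite subr0.
Qed.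

Lemma extendable_mul g h : s g = t h ->
  @extendable R (prodC G G) G composables (fun p => p.1 ∘ p.2) (g, h).
Proof. by move=> gh; exact: (@mul_smooth R G (exist _ ((g, h) : prodC G G) gh)). Qed.

Lemma smooth_at_pair_cst (g : G) a :
  smooth_at (Y := prodC G G) (fun b : G => (b, g)) a /\
  @mdiff R G (prodC G G) (fun b => (b, g)) a = fun v => (v, 0).
Proof.
have [s1 d1] := smooth_at_id lG a; have [s2 d2] := smooth_at_cst lG lG a g.
by have [? ->] := smooth_at_pair s1 s2; rewrite d1 d2.
Qed.

Lemma smooth_at_cst_pair (g : G) a :
  smooth_at (Y := prodC G G) (fun b : G => (g, b)) a /\
  @mdiff R G (prodC G G) (fun b => (g, b)) a = fun v => (0, v).
Proof.
have [s1 d1] := smooth_at_id lG a; have [s2 d2] := smooth_at_cst lG lG a g.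
by have [? ->] := smooth_at_pair s2 s1; rewrite d1 d2.
Qed.

(** Right translation is multiplication along b |-> (b, g), so smoothness of [mul] also makes it
    extendable. *)
Lemma rtr_dmul g a X : s a = t g -> mdiff s a X = 0 ->
  extendable (src_fibre (t g)) (fun b : G => b ∘ g) a /\
  rtr g a X = dmul a g X 0.
Proof.
move=> ag dX; have [s1 d1] := smooth_at_pair_cst g a.
have tX := tangent_src_fibre ag dX.
have [e _ d] := @sdiff_comp R G (prodC G G) G lG lGG fGG (src_fibre (t g))
  composables (fun b => (b, g)) (fun p => p.1 ∘ p.2) a X ag (fun _ => id)
  (smooth_extendable _ s1) (extendable_mul ag) tX.
by split=> //; rewrite /rtr [LHS]d (sdiff_smooth lG ag s1 tX) d1.
Qed.

Lemma ltr_dmul g a X : s g = t a -> mdiff t a X = 0 ->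
  extendable (tgt_fibre (s g)) (fun b : G => g ∘ b) a /\
  ltr g a X = dmul g a 0 X.
Proof.
move=> ag dX; have [s1 d1] := smooth_at_cst_pair g a.
have tX := tangent_tgt_fibre (esym ag) dX.
have [e _ d] := @sdiff_comp R G (prodC G G) G lG lGG fGG (tgt_fibre (s g))
  composables (fun b => (g, b)) (fun p => p.1 ∘ p.2) a X (esym ag) (fun _ => @esym _ _ _)
  (smooth_extendable _ s1) (extendable_mul ag) tX.
by split=> //; rewrite /ltr [LHS]d (sdiff_smooth lG (esym ag) s1 tX) d1.
Qed.

(** The derivative of s(gh) = s(h). *)
Lemma dmul_src g h X Y : s g = t h -> mdiff s g X = mdiff t h Y ->
  mdiff s (g ∘ h) (dmul g h X Y) = mdiff s h Y.
Proof.
move=> gh XY; have tXY := tangent_composables gh XY.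
have [s2 d2] := @smooth_at_snd_comp s (g, h) (smooth_src h).
have S2 : composables (g, h) := gh.
have e := mdiff_sdiff lGG lG fG S2 (extendable_mul gh) (smooth_src (g ∘ h)) s2
  (fun p => @src_mul R G p.1 p.2) tXY.
exact: etrans e (congr1 (fun k : TG G * TG G -> TM G => k (X, Y)) d2).
Qed.

Lemma dmul_tgt g h X Y : s g = t h -> mdiff s g X = mdiff t h Y ->
  mdiff t (g ∘ h) (dmul g h X Y) = mdiff t g X.
Proof.
move=> gh XY; have tXY := tangent_composables gh XY.
have [s2 d2] := @smooth_at_fst_comp t (g, h) (smooth_tgt g).
have S2 : composables (g, h) := gh.
have e := mdiff_sdiff lGG lG fG S2 (extendable_mul gh) (smooth_tgt (g ∘ h)) s2
  (fun p => @tgt_mul R G p.1 p.2) tXY.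
exact: etrans e (congr1 (fun k : TG G * TG G -> TM G => k (X, Y)) d2).
Qed.

Lemma mdiff_src_inv g X : mdiff s (inv g) (mdiff (@inv R G) g X) = mdiff t g X.
Proof.
exact: (mdiff_mdiff lG lG fG X (@inv_smooth R G g) (smooth_src _) (@src_inv R G)).
Qed.

Lemma mdiff_tgt_inv g X : mdiff t (inv g) (mdiff (@inv R G) g X) = mdiff s g X.
Proof.
exact: (mdiff_mdiff lG lG fG X (@inv_smooth R G g) (smooth_tgt _) (@tgt_inv R G)).
Qed.

Lemma ddiv_dmul p q X Y : s p = s q -> mdiff s p X = mdiff s q Y ->
  @extendable R (prodC G G) G divisibles (fun a => a.1 ∘ inv a.2) (p, q) /\
  ddiv p q X Y = dmul p (inv q) X (mdiff (@inv R G) q Y).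
Proof.
move=> pq XY; have tXY := tangent_divisibles pq XY.
have S2 : divisibles (p, q) by [].
have [s1 d1] := smooth_at_fst lG lG ((p, q) : prodC G G).
have [s2 d2] := smooth_at_snd lG lG ((p, q) : prodC G G).
have [s3 d3] := smooth_at_comp lGG lG fG s2 (@inv_smooth R G q).
have [s4 d4] := smooth_at_pair s1 s3.
have pq' : s p = t (inv q) by rewrite tgt_inv.
have [|e _ d] := @sdiff_comp R (prodC G G) (prodC G G) G lGG lGG fGG divisibles
  composables (fun a => (a.1, inv a.2)) (fun p => p.1 ∘ p.2) (p, q) (X, Y) S2 _
  (smooth_extendable _ s4) (extendable_mul pq') tXY.
  by move=> a; rewrite /composables /= tgt_inv.
by split=> //; rewrite /ddiv [LHS]d (sdiff_smooth lGG S2 s4 tXY) d4 d1 d3 d2.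
Qed.


Lemma rtr_src g a X : s a = t g -> mdiff s a X = 0 ->
  mdiff s (a ∘ g) (rtr g a X) = 0.
Proof.
move=> ag dX; have [_ ->] := rtr_dmul ag dX.
have XY : mdiff s a X = mdiff t g 0 by rewrite dX mdiff0.
exact: etrans (dmul_src ag XY) (mdiff0 _ _).
Qed.

Lemma rtr_tgt g a X : s a = t g -> mdiff s a X = 0 ->
  mdiff t (a ∘ g) (rtr g a X) = mdiff t a X.
Proof.
move=> ag dX; have [_ ->] := rtr_dmul ag dX.
have XY : mdiff s a X = mdiff t g 0 by rewrite dX mdiff0.
exact: dmul_tgt ag XY.
Qed.

Lemma ltr_src g a X : s g = t a -> mdiff t a X = 0 ->
  mdiff s (g ∘ a) (ltr g a X) = mdiff s a X.
Proof.
move=> ag dX; have [_ ->] := ltr_dmul ag dX.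
have XY : mdiff s g 0 = mdiff t a X by rewrite dX mdiff0.
exact: dmul_src ag XY.
Qed.

Lemma ddiv_src p q X Y : s p = s q -> mdiff s p X = mdiff s q Y ->
  mdiff s (p ∘ inv q) (ddiv p q X Y) = mdiff t q Y.
Proof.
move=> pq XY; have [_ ->] := ddiv_dmul pq XY.
have pq' : s p = t (inv q) by rewrite tgt_inv.
have XY' : mdiff s p X = mdiff t (inv q) (mdiff (@inv R G) q Y).
  by rewrite mdiff_tgt_inv.
exact: etrans (dmul_src pq' XY') (mdiff_src_inv q Y).
Qed.

(** The derivative of (bg)g^-1 = b in [b], along a source fibre. *)
Lemma rtrK g a X : s a = t g -> mdiff s a X = 0 ->
  rtr (inv g) (a ∘ g) (rtr g a X) = X.
Proof.
move=> ag dX; have tX := tangent_src_fibre ag dX.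
have [e1 _] := rtr_dmul ag dX.
have ag' : s (a ∘ g) = t (inv g) by rewrite src_mul // tgt_inv.
have [e2 _] := rtr_dmul ag' (mdiff0 _ _).
have [s3 d3] := smooth_at_id lG a.
have m (b : G) : src_fibre (t g) b -> src_fibre (t (inv g)) (b ∘ g).
  by move=> bg; rewrite /src_fibre /= src_mul // tgt_inv.
have e := sdiff_sdiff (h := fun b => b) lG lG fG ag m e1 e2 (fun b bg => mulK bg) tX.
apply: (etrans e); apply: (etrans (sdiff_smooth lG ag s3 tX)).
exact (congr1 (fun k : TG G -> TG G => k X) d3).
Qed.

(** The derivative of (b(gh))h^-1 = bg in [b]: only the numerator moves. *)
Lemma ddiv_rtr g h a X : s g = t h -> s a = t g -> mdiff s a X = 0 ->
  ddiv (a ∘ (g ∘ h)) h (rtr (g ∘ h) a X) 0 = rtr g a X.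
Proof.
move=> gh ag dX; have ag' : s a = t (g ∘ h) by rewrite tgt_mul.
have tX := tangent_src_fibre ag' dX.
have [e1 _] := rtr_dmul ag' dX.
have [s2 d2] := smooth_at_cst lG lG a h.
have [e3 d3] := sdiff_pair lG ag' e1 (smooth_extendable _ s2) tX.
have pq : s (a ∘ (g ∘ h)) = s h by rewrite !src_mul.
have [e4 _] := ddiv_dmul pq (etrans (mdiff0 _ _) (esym (mdiff0 _ _))).
have m (b : G) : src_fibre (t (g ∘ h)) b -> divisibles ((b ∘ (g ∘ h), h) : prodC G G).
  by move=> bg; rewrite /divisibles /= !src_mul.
have c (b : G) : src_fibre (t (g ∘ h)) b -> b ∘ (g ∘ h) ∘ inv h = b ∘ g.
  move=> bg; have {}bg : s b = t g by rewrite -(tgt_mul gh).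
  by rewrite mulA // mulK // src_mul.
have e := sdiff_sdiff (h := fun b => b ∘ g) lG lGG fGG ag' m e3 e4 c tX.
have e5 : rtr g a X = @sdiff R G G (src_fibre (t (g ∘ h))) (fun b => b ∘ g) a X.
  by rewrite /rtr (tgt_mul gh).
have d4 := etrans (sdiff_smooth lG ag' s2 tX)
  (congr1 (fun k : TG G -> TG G => k X) d2).
by rewrite e5 -e d3 d4.
Qed.

(** The derivative of (gh)h^-1 = g, with both arrows moving. *)
Lemma ddiv_dmulK g h X Y : s g = t h -> mdiff s g X = mdiff t h Y ->
  ddiv (g ∘ h) h (dmul g h X Y) Y = X.
Proof.
move=> gh XY; have tXY := tangent_composables gh XY.
have S2 : composables (g, h) := gh.
have e1 := extendable_mul gh.
have [s2 d2] := smooth_at_snd lG lG ((g, h) : prodC G G).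
have [e3 d3] := sdiff_pair lGG S2 e1 (smooth_extendable _ s2) tXY.
have pq : s (g ∘ h) = s h by rewrite src_mul.
have [e4 _] := ddiv_dmul pq (etrans (mdiff0 _ _) (esym (mdiff0 _ _))).
have m (p : prodC G G) : composables p -> divisibles ((p.1 ∘ p.2, p.2) : prodC G G).
  by move=> bg; rewrite /divisibles /= src_mul.
have [s5 d5] := smooth_at_fst lG lG ((g, h) : prodC G G).
have e := sdiff_sdiff (h := fun p : prodC G G => p.1) lGG lGG fGG S2 m e3 e4
  (fun p bg => mulK bg) tXY.
have e6 := etrans e (etrans (sdiff_smooth lGG S2 s5 tXY)
  (congr1 (fun k : TG G * TG G -> TG G => k (X, Y)) d5)).
have d4 := etrans (sdiff_smooth lGG S2 s2 tXY)
  (congr1 (fun k : TG G * TG G -> TG G => k (X, Y)) d2).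
by rewrite -[RHS]e6 d3 d4.
Qed.

(** The derivative of (gh)(bh)^-1 = g b^-1 at a unit [b]: only the denominator moves, and the
    right-hand side gives the left translate of di X that enters the quasi-action on A. *)
Lemma ddiv_0_rtr g h X : s g = t h -> mdiff s 1_(t h) X = 0 ->
  ddiv (g ∘ h) h 0 (rtr h 1_(t h) X) =
  ltr g 1_(s g) (mdiff (@inv R G) 1_(s g) X).
Proof.
move=> gh dX; have ah : s 1_(t h) = t h by rewrite src_unt.
have tX := tangent_src_fibre ah dX.
have [e1 _] := rtr_dmul ah dX.
have [s2 d2] := smooth_at_cst lG lG 1_(t h) (g ∘ h).
have [e3 d3] := sdiff_pair lG ah (smooth_extendable _ s2) e1 tX.
have pq : s (g ∘ h) = s (1_(t h) ∘ h) by rewrite !src_mul.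
have [e4 _] := ddiv_dmul pq (etrans (mdiff0 _ _) (esym (mdiff0 _ _))).
have m (b : G) : src_fibre (t h) b -> divisibles ((g ∘ h, b ∘ h) : prodC G G).
  by move=> bh; rewrite /divisibles /= !src_mul.
have c (b : G) : src_fibre (t h) b -> g ∘ h ∘ inv (b ∘ h) = g ∘ inv b.
  by move=> bh; exact: mul_mulV.
have e := sdiff_sdiff (h := fun b => g ∘ inv b) lG lGG fGG ah m e3 e4 c tX.
have si := @inv_smooth R G 1_(t h).
have m' (b : G) : src_fibre (t h) b -> tgt_fibre (s g) (inv b).
  by move=> bh; rewrite /tgt_fibre /= tgt_inv gh.
have gi : s g = t (inv 1_(t h)) by rewrite tgt_inv src_unt.
have [e5 _] := ltr_dmul gi (mdiff0 _ _).
have e' := sdiff_sdiff (h := fun b => g ∘ inv b) lG lG fG ah m' (smooth_extendable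
  _ si) e5 (fun _ _ => erefl) tX.
have e6 : ltr g 1_(s g) (mdiff (@inv R G) 1_(s g) X) =
  @sdiff R G G (src_fibre (t h)) (fun b => g ∘ inv b) 1_(t h) X.
  by rewrite -e' (sdiff_smooth lG ah si tX) unt_inv /ltr gh.
have d4 := etrans (sdiff_smooth lG ah s2 tX)
  (congr1 (fun k : TG G -> TG G => k X) d2).
by rewrite e6 -e d3 d4 unt_mul.
Qed.

Lemma inv_inv (g : G) : inv (inv g) = g.
Proof.
have := mulK (esym (tgt_inv g)); rewrite mul_inv => e.
by rewrite -[RHS]e -(src_inv g) -(tgt_inv (inv g)) unt_mul.
Qed.

Section Linearity.

Lemma rtr_linear g a : linear (rtr g a : TG G -> TG G).
Proof. exact (@sdiff_linear R G G [set b | s b = t g] (fun b => b ∘ g) a). Qed.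

Lemma ltr_linear g a : linear (ltr g a : TG G -> TG G).
Proof. exact (@sdiff_linear R G G [set b | t b = s g] (fun b => g ∘ b) a). Qed.

Lemma ddiv_linear p q (a : R) X Y X' Y' :
  ddiv p q (a *: X + X') (a *: Y + Y') = a *: ddiv p q X Y + ddiv p q X' Y' :> TG G.
Proof.
have := @sdiff_linear R (prodC G G) G [set a | s a.1 = s a.2]
  (fun a => a.1 ∘ inv a.2) (p, q).
exact: (fun h => h a (X, Y) (X', Y')).
Qed.

End Linearity.

(** * The splitting of vectors by the connection *)

Section Splitting.
Variable sigma : ehresmann G.

Lemma conn_lin g : linear (sigma g : TM G -> TG G).
Proof. by move=> a u v; exact: conn_linear. Qed.

Lemma omega_linear g : linear (omega sigma g : TG G -> TG G).
Proof.
move=> a X Y; rewrite /omega mdiff_linear conn_lin -rtr_linear.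
by rewrite scalerBr opprD addrACA.
Qed.

Lemma vertical_part_src g (X : TG G) : mdiff s g (X - sigma g (mdiff s g X)) = 0.
Proof.
by rewrite (linear_funD _ _ (mdiff_linear s g)) (linear_funN _ (mdiff_linear s g))
  conn_split subrr.
Qed.

Lemma rtrVK g (X : TG G) : mdiff s g X = 0 ->
  rtr g 1_(t g) (rtr (inv g) g X) = X.
Proof.
move=> dX; have gi : s g = t (inv g) by rewrite tgt_inv.
by have := rtrK gi dX; rewrite inv_inv mul_inv.
Qed.

Lemma rtr_inv_src g (X : TG G) : mdiff s g X = 0 ->
  mdiff s 1_(t g) (rtr (inv g) g X) = 0.
Proof.
move=> dX; have gi : s g = t (inv g) by rewrite tgt_inv.
by have := rtr_src gi dX; rewrite mul_inv.
Qed.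

Lemma omega_algebroid g X : algebroid (t g) (omega sigma g X).
Proof. exact: rtr_inv_src (vertical_part_src g X). Qed.

Lemma rtr_omega g (X : TG G) :
  rtr g 1_(t g) (omega sigma g X) = X - sigma g (mdiff s g X).
Proof. exact: rtrVK (vertical_part_src g X). Qed.

Lemma rtr_unt_src g (u : TG G) : mdiff s 1_(t g) u = 0 ->
  mdiff s g (rtr g 1_(t g) u) = 0.
Proof.
move=> du; have ug : s 1_(t g) = t g by rewrite src_unt.
by have := rtr_src ug du; rewrite unt_mul.
Qed.

Lemma omega_rtr g (u : TG G) : mdiff s 1_(t g) u = 0 ->
  omega sigma g (rtr g 1_(t g) u) = u.
Proof.
move=> du; have ug : s 1_(t g) = t g by rewrite src_unt.
rewrite /omega rtr_unt_src // (linear_fun0 (conn_lin g)) subr0.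
by have := rtrK ug du; rewrite unt_mul.
Qed.

Lemma omega_conn g (w : TM G) : omega sigma g (sigma g w) = 0.
Proof. by rewrite /omega conn_split subrr (linear_fun0 (@rtr_linear _ _)). Qed.

Lemma actA_opp g (y : TG G) : actA sigma g (- y) = - actA sigma g y.
Proof.
rewrite /actA (linear_funN _ (@mdiff_linear R _ _ _ _)).
by rewrite (linear_funN _ (@ltr_linear _ _)) (linear_funN _ (@omega_linear g)).
Qed.

(** Apply dt to X = r_g (omega X) + sigma (ds X); since t(bg) = t(b), dt of the first summand is the
    anchor. *)
Lemma tgt_split g (X : TG G) :
  mdiff t g X = anchor (t g) (omega sigma g X) + actTM sigma g (mdiff s g X).
Proof.
have ug : s 1_(t g) = t g by rewrite src_unt.
have du : mdiff s 1_(t g) (omega sigma g X) = 0 by exact: omega_algebroid.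
have := rtr_tgt ug du; rewrite unt_mul rtr_omega /anchor /actTM => <-.
rewrite (linear_funD _ _ (@mdiff_linear R _ _ _ _)).
by rewrite (linear_funN _ (@mdiff_linear R _ _ _ _)) subrK.
Qed.

(* Split [X = r_gh x + sigma_gh w] and [Y = r_h y + sigma_h w], and write
   [sigma_gh w = r_gh (K w) + dm (sigma_g (lambda_h w), sigma_h w)].  By linearity
   of [dm-bar] the quotient [X Y^-1] is
   [r_g x + r_g (K w) + sigma_g (lambda_h w) + l_g (di y)]. *)
Lemma omega_ddiv g h (X Y : TG G) : s g = t h ->
  mdiff s (g ∘ h) X = mdiff s h Y ->
  omega sigma g (ddiv (g ∘ h) h X Y) =
  actA sigma g (- omega sigma h Y) + omega sigma (g ∘ h) X
    + curvature sigma g h (mdiff s h Y).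
Proof.
move=> gh XY; set w := mdiff s h Y in XY *.
set x := omega sigma (g ∘ h) X; set y := omega sigma h Y.
set A := sigma g (actTM sigma h w); set B := sigma h w.
set K := curvature sigma g h w.
have ltg : t (g ∘ h) = t g by rewrite tgt_mul.
have AB : mdiff s g A = mdiff t h B by rewrite conn_split.
have dK : mdiff s (g ∘ h) (sigma (g ∘ h) w - dmul g h A B) = 0.
  rewrite (linear_funD _ _ (@mdiff_linear R _ _ _ _)).
  rewrite (linear_funN _ (@mdiff_linear R _ _ _ _)) conn_split.
  by rewrite (dmul_src gh AB) conn_split subrr.
have eK : rtr (g ∘ h) 1_(t g) K = sigma (g ∘ h) w - dmul g h A B.
  by rewrite -ltg; exact: rtrVK dK.
have aK : mdiff s 1_(t g) K = 0 by rewrite -ltg; exact: rtr_inv_src dK.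
have ax : mdiff s 1_(t g) x = 0 by rewrite -ltg; exact: omega_algebroid.
have ay : mdiff s 1_(t h) y = 0 by exact: omega_algebroid.
have ug : s 1_(t g) = t g by rewrite src_unt.
have eX : X = (rtr (g ∘ h) 1_(t g) x + rtr (g ∘ h) 1_(t g) K) + dmul g h A B.
  by rewrite -addrA eK subrK -ltg rtr_omega XY subrK.
have eY : Y = rtr h 1_(t h) y + B by rewrite rtr_omega subrK.
have dD (X1 Y1 X2 Y2 : TG G) : ddiv (g ∘ h) h (X1 + X2) (Y1 + Y2) =
    ddiv (g ∘ h) h X1 Y1 + ddiv (g ∘ h) h X2 Y2.
  by have := ddiv_linear (g ∘ h) h 1 X1 Y1 X2 Y2; rewrite !scale1r.
have -> : ddiv (g ∘ h) h X Y = rtr g 1_(t g) x + rtr g 1_(t g) K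
    + ltr g 1_(s g) (mdiff (@inv R G) 1_(s g) y) + A.
  have ur (v : TG G) : mdiff s 1_(t g) v = 0 ->
      ddiv (g ∘ h) h (rtr (g ∘ h) 1_(t g) v) 0 = rtr g 1_(t g) v.
    move=> dv; have := ddiv_rtr gh ug dv.
    by rewrite -{1}ltg unt_mul.
  rewrite [in LHS]eX [in LHS]eY dD (ddiv_dmulK gh AB); congr (_ + _).
  rewrite -[rtr h _ _]add0r -[rtr (g ∘ h) _ x + _]addr0 dD.
  rewrite -[in X in ddiv _ _ _ X + _](addr0 (0 : TG G)) dD !ur //.
  by rewrite (ddiv_0_rtr gh ay).
have wD X1 X2 : omega sigma g (X1 + X2) = omega sigma g X1 + omega sigma g X2.
  exact: linear_funD (@omega_linear g).
rewrite wD wD wD (omega_rtr ax) (omega_rtr aK) omega_conn addr0.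
by rewrite actA_opp /actA opprK [LHS]addrC addrA.
Qed.

End Splitting.

(** * The cochain map *)

Section NerveFaces.

Lemma nerve_eq k (g h : nerve G k) : sval g = sval h -> g = h.
Proof. by case: g h => g cg [h ch] /= e; apply: eq_exist. Qed.

Lemma arr1_cons_unt k (p : nerve G k) : arr1 (cons_unt p) = 1_(base p).
Proof.
by case: k p => [|k] p; rewrite /arr1 /= /cons_unt_arr; case: unliftP => // j /(congr1 val).
Qed.

Lemma face0_cons_unt k (p : nerve G k) : face 0 (cons_unt p) = p.
Proof.
case: k p => [|k] p; apply: nerve_eq.
  exact: etrans (congr1 s (arr1_cons_unt p)) (src_unt _).
apply/funext => j; rewrite /= /face_arr /= /cons_unt_arr; case: unliftP => [i|//].
by move=> /lift_inj ->.
Qed.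

Lemma base_face0 k (g : nerve G k.+1) : base (face 0 g) = s (arr1 g).
Proof.
case: k g => [|k] g //; rewrite /base /arr1 /= /face_arr /=.
apply: esym; apply: (svalP g); exact: erefl.
Qed.

Lemma arr1_face0 k (g : nerve G k.+2) : arr1 (face 0 g) = arr2 g.
Proof. by []. Qed.

Lemma arr1_face1 k (g : nerve G k.+2) : arr1 (face 1 g) = arr1 g ∘ arr2 g.
Proof.
rewrite /arr1 /arr2 /= /face_arr /=.
by congr (sval g _ ∘ _); exact: val_inj.
Qed.

Lemma arr1_faceSS k i (g : nerve G k.+2) : arr1 (face i.+2 g) = arr1 g.
Proof. by rewrite /arr1 /= /face_arr /=; congr (sval g _); exact: val_inj. Qed.

Lemma src_arr1 k (g : nerve G k.+2) : s (arr1 g) = t (arr2 g).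
Proof. exact: (svalP g). Qed.

(** This and the next simplicial identity tell what remains of a face once the first arrow is
    dropped; length 2 is treated apart because the result is then an object. *)
Lemma face0_face1 k (g : nerve G k.+2) : face 0 (face 1 g) = face 0 (face 0 g).
Proof.
case: k g => [|k] g; apply: nerve_eq.
  exact: etrans (congr1 s (arr1_face1 g)) (src_mul (src_arr1 g)).
by apply/funext => j; rewrite /= /face_arr /=.
Qed.

Lemma face0_faceSS k i (g : nerve G k.+2) :
  face 0 (face i.+2 g) = face i.+1 (face 0 g).
Proof.
case: k g => [|k] g; apply: nerve_eq.
  exact: etrans (congr1 s (arr1_faceSS i g)) (src_arr1 g).
apply/funext => j; rewrite /= /face_arr /= !ltnS /bump /= add1n.
have -> : widen_ord (leqnSn k.+2) (lift ord0 j) = lift ord0 (widen_ord (leqnSn k.+1) j).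
  by apply: val_inj.
by rewrite !eqSS.
Qed.

End NerveFaces.

(** * Compatibility with the codifferentials *)

Section Projectable.

(** The algebraic half of [def_cochain] in positive degree, isolated because the symbol computations
    use it without smoothness. *)
Definition projectable k (c : nerve G k.+1 -> TG G) : Prop :=
  forall g g' : nerve G k.+1, face 0 g = face 0 g' ->
    mdiff s (arr1 g) (c g) = mdiff s (arr1 g') (c g').

Lemma symbol_face0 k (c : nerve G k.+1 -> TG G) g : projectable c ->
  symbol c (face 0 g) = mdiff s (arr1 g) (c g).
Proof. by move=> pc; apply: pc; rewrite face0_cons_unt. Qed.

(** The right-invariant field is tangent to source fibres, while ds l_g di = ds di = dt turns the
    left-invariant one into the anchor. *)
Lemma src_unit_codiff (a : nerve G 0 -> TG G) (g : nerve G 1) :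
  (forall x : nerve G 0, algebroid (base x) (a x)) ->
  mdiff s (arr1 g) (@def_codiff R G 0 a g) = anchor (base (face 0 g)) (a (face 0 g)).
Proof.
move=> aA; pose a' (x : M) : TG G := a (exist _ x I).
have a1 x : mdiff s 1_x (a' x) = 0 := aA (exist _ x I).
have gi : s (arr1 g) = t (inv 1_(s (arr1 g))) by rewrite tgt_inv src_unt.
have di : mdiff t (inv 1_(s (arr1 g))) (mdiff (@inv R G) 1_(s (arr1 g)) (a' (s (arr1 g)))) = 0.
  by rewrite mdiff_tgt_inv.
have := ltr_src gi di; rewrite mdiff_src_inv unt_inv mul_unt => e.
rewrite -[LHS]/(mdiff s (arr1 g) (rinv_field a' (arr1 g) + linv_field a' (arr1 g))).
rewrite (linear_funD _ _ (@mdiff_linear R G M s (arr1 g))) /rinv_field.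
by rewrite (rtr_unt_src (a1 _)) add0r; exact: e.
Qed.

(** The division term contributes dt of its denominator, because s(pq^-1) = t(q); every other term
    projects to a value of the symbol. The right-hand side sees only [face 0 g], whence
    projectability of the codifferential. *)
Lemma src_codiff k (c : nerve G k.+1 -> TG G) (g : nerve G k.+2) : projectable c ->
  mdiff s (arr1 g) (def_codiff c g) =
  - mdiff t (arr1 (face 0 g)) (c (face 0 g))
  + \sum_(2 <= i < k.+2) (-1) ^+ i *: symbol c (face i.-1 (face 0 g))
  + (-1) ^+ k.+2 *: symbol c (face k.+1 (face 0 g)).
Proof.
move=> pc; rewrite /def_codiff.
have ls := @mdiff_linear R G M s (arr1 g).
rewrite (linear_funD _ _ ls) (linear_funD _ _ ls) (linear_funN _ ls) (linear_funZ _ _ ls).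
rewrite (linear_fun_sum _ _ ls) -(face0_faceSS k g) (symbol_face0 _ pc) arr1_faceSS.
congr (_ + _); congr (_ + _).
  congr (- _).
  have pq : s (arr1 g ∘ arr2 g) = s (arr2 g) by rewrite src_mul // src_arr1.
  have XY : mdiff s (arr1 g ∘ arr2 g) (c (face 1 g)) = mdiff s (arr2 g) (c (face 0 g)).
    by rewrite -arr1_face1 -(arr1_face0 g); apply: pc; exact: face0_face1.
  by have := ddiv_src pq XY; rewrite (mulK (src_arr1 g)).
rewrite [LHS]big_seq [RHS]big_seq; apply: eq_bigr => i; rewrite mem_index_iota.
case: i => [|[|i]] // _; rewrite (linear_funZ _ _ ls) -face0_faceSS.
by rewrite (symbol_face0 _ pc) arr1_faceSS.
Qed.

Lemma projectable_codiff k (c : nerve G k.+1 -> TG G) :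
  projectable c -> projectable (def_codiff c).
Proof. by move=> pc g g' gg'; rewrite !src_codiff // gg'. Qed.

Lemma projectable_codiff0 (a : nerve G 0 -> TG G) :
  (forall x : nerve G 0, algebroid (base x) (a x)) ->
  projectable (@def_codiff R G 0 a).
Proof. by move=> aA g g' gg'; rewrite !src_unit_codiff // gg'. Qed.

Variable sigma : ehresmann G.

(** Here the sign of - omega is visible: on the left-invariant field it gives [actA], by definition,
    and on the right-invariant one minus the value of [a] at the target. *)
Lemma split_codiff0 (a : nerve G 0 -> TG G) :
  (forall x : nerve G 0, algebroid (base x) (a x)) ->
  @split_cochain R G sigma 1 (@def_codiff R G 0 a) =
  @ad_codiff R G sigma 0 (@split_cochain R G sigma 0 a).
Proof.
move=> aA; rewrite /split_cochain /ad_codiff; congr pair; apply/funext => g.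
  rewrite /quasi_codiff big_geq // addr0 expr1 scaleN1r /actA /def_codiff.
  rewrite (linear_funD _ _ (@omega_linear sigma (arr1 g))) opprD addrC.
  congr (_ - _); rewrite /rinv_field omega_rtr //.
  exact: (aA (exist _ (t (arr1 g)) I)).
by rewrite /symbol src_unit_codiff // face0_cons_unt.
Qed.

Lemma split_codiff k (c : nerve G k.+1 -> TG G) : projectable c ->
  @split_cochain R G sigma k.+2 (def_codiff c) =
  @ad_codiff R G sigma k.+1 (@split_cochain R G sigma k.+1 c).
Proof.
move=> pc; rewrite /split_cochain /ad_codiff; congr pair; apply/funext => g /=.
  have wl := @omega_linear sigma (arr1 g).
  rewrite /quasi_codiff /def_codiff.
  have XY : mdiff s (arr1 g ∘ arr2 g) (c (face 1 g)) = mdiff s (arr2 g) (c (face 0 g)).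
    by rewrite -arr1_face1 -(arr1_face0 g); apply: pc; exact: face0_face1.
  (* The division term alone yields the quasi-action term, the i = 1 face and the curvature; the
     remaining faces keep the first arrow [arr1 g], so [omega] applies to them termwise. *)
  have e := omega_ddiv sigma (src_arr1 g) XY.
  rewrite (linear_funD _ _ wl) (linear_funD _ _ wl) (linear_funN _ wl) (linear_funZ _ _ wl).
  rewrite (linear_fun_sum _ _ wl) e.
  rewrite [in RHS]big_ltn // expr1 scaleN1r.
  rewrite -(arr1_face0 g) (symbol_face0 _ pc) -arr1_face1 arr1_face0.
  rewrite !opprD opprK -scalerN arr1_faceSS -sumrN.
  have -> : \sum_(2 <= i < k.+2) - omega sigma (arr1 g) ((-1) ^+ i *: c (face i g)) =
    \sum_(2 <= i < k.+2) (-1) ^+ i *: - omega sigma (arr1 (face i g)) (c (face i g)).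
    rewrite [LHS]big_seq [RHS]big_seq; apply: eq_bigr => i; rewrite mem_index_iota.
    by case: i => [|[|i]] // _; rewrite arr1_faceSS (linear_funZ _ _ wl) scalerN.
  rewrite opprK -!addrA; congr (_ + _); congr (_ + _).
  by rewrite opprK [LHS]addrC -addrA.
(* Splitting - dt c gives the anchor of - omega c and the quasi-action on the symbol; the other
   faces match after the shift of index by one, which absorbs a sign. *)
rewrite {1}/symbol src_codiff // face0_cons_unt (tgt_split sigma) /quasi_codiff.
rewrite -(symbol_face0 _ pc) !opprD.
rewrite /anchor (linear_funN _ (@mdiff_linear R G M t _)).
rewrite big_add1 /= exprS mulN1r scaleNr.
under eq_bigr do rewrite exprS mulN1r scaleNr.
by rewrite sumrN -!addrA [LHS]addrC -!addrA.
Qed.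

End Projectable.

(** * Smoothness of the splitting *)

(** A single extension of [mul] around (g0, h0) computes [dmul] at every nearby composable pair, so
    in fixed charts [dmul] is the derivative of one germ [m]. *)
Lemma mul_germ (g0 h0 : G) : s g0 = t h0 ->
  exists2 m : TG G * TG G -> TG G,
    smooth_germ m (@phi R G g0 g0, @phi R G h0 h0) &
    @cnbhs R (prodC G G) (g0, h0) [set p | s p.1 = t p.2 ->
      forall X Y, mdiff s p.1 X = mdiff t p.2 Y ->
      @transition R G (p.1 ∘ p.2) (g0 ∘ h0) (p.1 ∘ p.2) (dmul p.1 p.2 X Y) =
      'd m (@phi R G g0 p.1, @phi R G h0 p.2)
        (@transition R G p.1 g0 p.1 X, @transition R G p.2 h0 p.2 Y)].
Proof.
move=> gh; have [F [sF nF]] := extendable_mul gh.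
have Fp : F (g0, h0) = g0 ∘ h0.
  by have := cnbhs_self lGG nF => /=; apply.
exists (@phi R G (g0 ∘ h0) \o F \o @psi R (prodC G G) (g0, h0)).
  by have := smooth_at_germ sF; rewrite Fp.
have n1 := smooth_at_cnbhs aGG aG sF; have n2 := cnbhs_near aGG nF.
apply: cnbhsS (cnbhsI n1 n2) => -[g h] [[/= dp sFp dF hF] nFp] gh' X Y XY.
have tXY := tangent_composables gh' XY.
have Sp : composables (g, h) := gh'.
have Fgh : F (g, h) = g ∘ h by have := cnbhs_self lGG nFp => /= /(_ gh').
have e1 : dmul g h X Y = mdiff F ((g, h) : prodC G G) (X, Y).
  exact: (sdiff_ext lGG Sp (conj sFp nFp) tXY).
have := hF (X, Y); rewrite Fgh Fp -e1 => e2; apply: (etrans e2).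
have d1 : dom ((g, h) : prodC G G) ((g, h) : prodC G G) by exact: dom_self.
by rewrite (@transition_prod R G G aG aG (g, h) (g0, h0) (g, h) X Y d1 dp).
Qed.

Section Sigma.
Variable sigma : ehresmann G.

(** The germ [K] lives on the ambient model, where g and the base point of v are separate
    coordinates; the base point must be fed in as s(g) when [K] is used. *)
Lemma conn_germ (g0 : G) (v0 : TM G) :
  exists2 K : TG G * (TM G * TM G) -> TG G,
    smooth_germ K (@phi R G g0 g0,
      (@phi R M (s g0) (s g0), @transition R M (s g0) (s g0) (s g0) v0)) &
    nbhs (@phi R G g0 g0,
      (@phi R M (s g0) (s g0), @transition R M (s g0) (s g0) (s g0) v0))
      [set a | forall (g : G) v, dom g0 g -> dom (s g0) (s g) ->
        a = (@phi R G g0 g, (@phi R M (s g0) (s g), @transition R M (s g) (s g0) (s g) v)) ->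
        @transition R G g g0 g (sigma g v) = K a].
Proof.
pose X := prodC G (tanC M); pose S : set X := [set p | s p.1 = p.2.1].
have lX : local_charts X := prodC_local_charts lG (tanC_local_charts aM).
pose p0 : {p : X | S p} := exist _ ((g0, (s g0, v0)) : X) erefl.
have [K gK nK] := @smooth_sub_germ R X G lX aG S (fun p => (sval p).1)
  (fun p => sigma (sval p).1 (sval p).2.2) p0 (@conn_smooth R G sigma).
exists K; first exact: gK.
apply: (@filterS _ _ (nbhs_filter (@phi R X (sval p0) (sval p0))) _ _ _ nK) => a ha g v dg dsg ea.
have dp : dom (sval p0) ((g, (s g, v)) : X) by split.
have := phiK lX dp; rewrite -[phi _ _]/(@phi R G g0 g, (@phi R M (s g0) (s g),
  @transition R M (s g) (s g0) (s g) v)) -ea => e.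
have at_point (P : set X) : (@psi R X (sval p0) @^-1` P) a -> P (g, (s g, v)).
  by move=> h; exact: (eq_ind _ P h _ e).
have [_ e2] := at_point _ ha (erefl : S (g, (s g, v))).
by rewrite ea; exact: e2.
Qed.

Definition nerve_local_charts k : local_charts (nerve_ambient G k) :=
  match k with
  | 0%N => lM
  | k'.+1 => powC_local_charts G k'.+1
  end.

Lemma nerve_findim k : findim (model (nerve_ambient G k)).
Proof. by case: k => [|k]; exact: findim_mx. Qed.

Lemma smooth_arr1 k (x : powC G k.+1) :
  smooth_at (Y := G) (fun y : powC G k.+1 => y ord0) x.
Proof. exact: smooth_at_proj. Qed.

(** Extends [base] to non-composable strings, so that smoothness can be stated on the ambient space;
    [cons_ambient] and [face_ambient] do the same for [cons_unt] and [face 0]. *)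
Definition base_ambient k : nerve_ambient G k -> M :=
  match k return nerve_ambient G k -> M with
  | 0%N => id
  | k'.+1 => fun x => t (x ord0)
  end.

Lemma smooth_base k (x : nerve_ambient G k) : smooth_at (@base_ambient k) x.
Proof.
case: k x => [|k] x; first by case: (smooth_at_id lM x).
have [s1 _] := smooth_at_comp (nerve_local_charts k.+1) lG fG
  (smooth_arr1 x) (smooth_tgt (x ord0)).
exact: s1.
Qed.

Lemma base_ambientE k (g : nerve G k) : base g = base_ambient (sval g).
Proof. by case: k g. Qed.

Lemma smooth_unt_base k (x : nerve_ambient G k) :
  smooth_at (Y := G) (fun y => 1_(base_ambient y)) x.
Proof.
have [s1 _] := smooth_at_comp (nerve_local_charts k) lM fM
  (smooth_base x) (@unt_smooth R G (base_ambient x)).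
exact: s1.
Qed.

(** Right translation by g^-1 is dm(-, 0) at (g, g^-1), so in fixed charts [omega] is composed from
    the germs of [mul], inversion, [s] and [sigma]. *)
Lemma smooth_omega k (c : nerve G k.+1 -> TG G) :
  smooth_sub (Y := tanC G) (fun g => (arr1 g, c g)) ->
  smooth_sub (Y := tanC G)
    (fun g => (1_(base g), - omega sigma (arr1 g) (c g))).
Proof.
pose lN : local_charts (powC G k.+1) := nerve_local_charts k.+1.
move=> sc; apply: (smooth_sub_of_germ lN aG) => x0; split.
  exists (fun y => 1_(base_ambient (k := k.+1) y)); first exact: (@smooth_unt_base k.+1 (sval x0)).
  by move=> y; rewrite base_ambientE.
case: x0 => z0 Sz0; set x0 := exist _ z0 Sz0; rewrite [sval _]/=.
pose g0 : G := (z0 : powC G k.+1) ord0.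
have [nu0 gnu0 n0] := smooth_sub_germ lN aG x0 sc.
pose a0 := @phi R (powC G k.+1) z0 z0.
pose gam := @phi R G g0 \o (fun y : powC G k.+1 => y ord0) \o @psi R (powC G k.+1) z0.
have ggam : smooth_germ gam a0 := smooth_at_germ (smooth_arr1 z0).
pose sl := @phi R M (s g0) \o s \o @psi R G g0.
pose il := @phi R G (inv g0) \o (@inv R G) \o @psi R G g0.
have gi : s g0 = t (inv g0) by rewrite tgt_inv.
have [m gm nm] := mul_germ gi.
have [K gK nK] := conn_germ g0 (mdiff s g0 (c x0)).
have gamE (x : powC G k.+1) : dom z0 x -> gam (@phi R (powC G k.+1) z0 x) = @phi R G g0 (x ord0).
  by move=> dx; exact (congr1 (fun y : powC G k.+1 => @phi R G g0 (y ord0)) (phiK lN dx)).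
have slE (g : G) : dom g0 g -> sl (@phi R G g0 g) = @phi R M (s g0) (s g).
  by move=> dg; exact (congr1 (fun h : G => @phi R M (s g0) (s h)) (phiK lG dg)).
have ilE (g : G) : dom g0 g -> il (@phi R G g0 g) = @phi R G (inv g0) (inv g).
  by move=> dg; exact (congr1 (fun h : G => @phi R G (inv g0) (inv h)) (phiK lG dg)).
have dz : dom z0 z0 := dom_self lN z0.
have dg0 : dom g0 g0 := dom_self lG g0.
have gam0 : gam a0 = @phi R G g0 g0 := gamE _ dz.
have gsl : smooth_germ sl (gam a0) by rewrite gam0; exact: smooth_at_germ (smooth_src g0).
have gil : smooth_germ il (gam a0) by rewrite gam0; exact: smooth_at_germ (@inv_smooth R G g0).
have cs := smooth_at_cnbhs aG aM (smooth_src g0).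
(* In coordinates, [w] is ds c, [kap] the argument (g, (s g, ds c)) of the connection, and [nu] the
   value - omega (c). *)
pose w a := 'd sl (gam a) (nu0 a).
pose kap a := (gam a, (sl (gam a), w a)).
pose nu a := - 'd m (gam a, il (gam a)) (nu0 a - K (kap a), 0).
have kap0 : kap a0 = (@phi R G g0 g0, (@phi R M (s g0) (s g0),
    @transition R M (s g0) (s g0) (s g0) (mdiff s g0 (c x0)))).
  have [_ _ _ hs] := cnbhs_self lG cs.
  have [_ e] := cnbhs_self lN n0 Sz0.
  by rewrite /kap /w gam0 slE // -e hs.
have gil' := germ_comp (fG : findim (TG G)) ggam gil.
have gsl' := germ_comp (fG : findim (TG G)) ggam gsl.
have gw : smooth_germ w a0 by exact: germ_diff.
have gkap : smooth_germ kap a0 := germ_pair ggam (germ_pair gsl' gw).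
have gKk : smooth_germ (fun a => K (kap a)) a0.
  apply: germ_comp gkap _; last by rewrite kap0.
  exact: findim_prod fG (findim_prod fM fM).
exists nu.
  apply: germ_opp; apply: germ_diff.
  - exact: findim_prod fG fG.
  - by rewrite gam0 ilE.
  - exact: germ_pair ggam gil'.
  - exact: germ_pair (germ_add gnu0 (germ_opp gKk)) (germ_cst _ _).
rewrite -kap0 in nK.
have nk := nbhs_cnbhs lN (germ_near gkap nK).
have ns := smooth_at_continuous lN lG (smooth_arr1 z0) cs.
have [si _] := smooth_at_comp lN lG fG (smooth_arr1 z0) (@inv_smooth R G g0).
have [sp _] := smooth_at_pair (smooth_arr1 z0) si.
have nm' := smooth_at_continuous lN lGG sp nm.
have nd := cnbhs_dom lN z0.
apply: cnbhsS (cnbhsI nd (cnbhsI n0 (cnbhsI nk (cnbhsI ns nm')))) => x.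
case=> dx [h0 [hk [[dg _ dsg hs] hm]]] Sx _.
pose g : G := x ord0.
have [_ e0] := h0 Sx.
set X := c (exist _ x Sx) in e0 *.
pose Z := X - sigma g (mdiff s g X).
have dZ : mdiff s g Z = 0 := vertical_part_src sigma g X.
have gi' : s g = t (inv g) by rewrite tgt_inv.
have eo : omega sigma g X = dmul g (inv g) Z 0 by case: (rtr_dmul gi' dZ).
have dZ0 : mdiff s g Z = mdiff t (inv g) 0 by rewrite dZ mdiff0.
have := hm gi' Z 0 dZ0; rewrite -eo /= !mul_inv => e1.
have ek : kap (@phi R (powC G k.+1) z0 x) = (@phi R G g0 g, (@phi R M (s g0) (s g),
    @transition R M (s g) (s g0) (s g) (mdiff s g X))).
  by rewrite /kap /w (gamE _ dx) (slE _ dg) -e0 hs.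
have eK : @transition R G g g0 g (sigma g (mdiff s g X)) =
    K (kap (@phi R (powC G k.+1) z0 x)).
  exact: hk dg dsg ek.
have lt := @transition_linear R G g g0 g.
have eZ : @transition R G g g0 g Z =
    nu0 (@phi R (powC G k.+1) z0 x) - K (kap (@phi R (powC G k.+1) z0 x)).
  by rewrite /Z (linear_funD _ _ lt) (linear_funN _ lt) eK -e0.
have eT := linear_fun0 (@transition_linear R G (inv g) (inv g0) (inv g)).
apply: (etrans (linear_funN (omega sigma g X)
  (@transition_linear R G 1_(t g) 1_(t g0) 1_(t g)))).
by rewrite e1 eZ eT /nu (gamE _ dx) (ilE _ dg).
Qed.

End Sigma.

Lemma exist_sval k (p : nerve G k) (Sp : nerve_set (sval p)) :
  exist _ (sval p) Sp = p.
Proof. exact: nerve_eq. Qed.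

Definition cons_ambient k : nerve_ambient G k -> powC G k.+1 :=
  match k return nerve_ambient G k -> powC G k.+1 with
  | 0%N => fun x => cons_unt_arr x (fun i : 'I_0 => 1_x)
  | k'.+1 => fun g => cons_unt_arr (t (g ord0)) g
  end.

Lemma cons_ambientE k (p : nerve G k) : sval (cons_unt p) = cons_ambient (sval p).
Proof. by case: k p. Qed.

Lemma smooth_cons k (x : nerve_ambient G k) : smooth_at (@cons_ambient k) x.
Proof.
apply: (smooth_at_powC (nerve_local_charts k)) => i.
have sb := smooth_unt_base x.
case: k x i sb => [|k] x i sb.
  rewrite (_ : (fun y => _) = (fun y => 1_(base_ambient (k := 0) y))) //.
  by apply/funext => y; rewrite /= /cons_unt_arr; case: unliftP => // -[].
case: (unliftP ord0 i) => [j ->|->].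
  rewrite (_ : (fun y => _) = (fun y : powC G k.+1 => y j)).
    exact: smooth_at_proj.
  by apply/funext => y; rewrite /= /cons_unt_arr liftK.
rewrite (_ : (fun y => _) = (fun y => 1_(base_ambient (k := k.+1) y))) //.
by apply/funext => y; rewrite /= /cons_unt_arr unlift_none.
Qed.

Lemma base_cons_unt k (p : nerve G k) : base p = s (arr1 (cons_unt p)).
Proof. by rewrite arr1_cons_unt src_unt. Qed.

(** The symbol is [c] pulled back along p |-> (1, p) and then projected by ds; both steps have
    smooth ambient expressions. *)
Lemma smooth_symbol k (c : nerve G k.+1 -> TG G) :
  smooth_sub (Y := tanC G) (fun g => (arr1 g, c g)) ->
  smooth_sub (Y := tanC M) (fun p : nerve G k => (base p, symbol c p)).
Proof.
pose lN : local_charts (powC G k.+1) := nerve_local_charts k.+1.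
pose lK : local_charts (nerve_ambient G k) := nerve_local_charts k.
move=> sc; apply: (smooth_sub_of_germ lK aM) => x0; split.
  exists (@base_ambient k); first exact: smooth_base.
  exact: base_ambientE.
pose q0 := cons_unt x0; pose z0 := sval x0; pose w0 : powC G k.+1 := sval q0.
have ew : cons_ambient z0 = w0 by rewrite -cons_ambientE.
have [nu0 gnu0 n0] := smooth_sub_germ lN aG q0 sc.
pose g0 : G := w0 ord0.
pose C := @phi R (powC G k.+1) w0 \o (@cons_ambient k) \o @psi R (nerve_ambient G k) z0.
pose a0 := @phi R (nerve_ambient G k) z0 z0.
have gC : smooth_germ C a0.
  by have := smooth_at_germ (smooth_cons z0); rewrite ew.
have CE (x : nerve_ambient G k) : dom z0 x ->
    C (@phi R (nerve_ambient G k) z0 x) = @phi R (powC G k.+1) w0 (cons_ambient x).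
  by move=> dx; exact (congr1 (fun y => @phi R (powC G k.+1) w0 (cons_ambient y)) (phiK lK dx)).
pose gam := @phi R G g0 \o (fun y : powC G k.+1 => y ord0) \o @psi R (powC G k.+1) w0.
have ggam : smooth_germ gam (@phi R (powC G k.+1) w0 w0) := smooth_at_germ (smooth_arr1 w0).
have gamE (x : powC G k.+1) : dom w0 x -> gam (@phi R (powC G k.+1) w0 x) = @phi R G g0 (x ord0).
  by move=> dx; exact (congr1 (fun y : powC G k.+1 => @phi R G g0 (y ord0)) (phiK lN dx)).
pose sl := @phi R M (s g0) \o s \o @psi R G g0.
have dw : dom w0 w0 := dom_self lN w0.
have C0 : C a0 = @phi R (powC G k.+1) w0 w0.
  by rewrite (CE _ (dom_self lK z0)) ew.
have gam0 : gam (C a0) = @phi R G g0 g0 by rewrite C0 (gamE _ dw).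
have gsl : smooth_germ sl (gam (C a0)).
  by rewrite gam0; exact: smooth_at_germ (smooth_src g0).
exists (fun a => 'd sl (gam (C a)) (nu0 (C a))).
  apply: (germ_diff (p := fun a => gam (C a)) (w := fun a => nu0 (C a)) fG gsl).
    by apply: germ_comp gC _; [exact: findim_mx|rewrite C0].
  by apply: germ_comp gC _; [exact: findim_mx|rewrite C0].
have cs := smooth_at_cnbhs aG aM (smooth_src g0).
have ns := smooth_at_continuous lN lG (smooth_arr1 w0) cs.
have nw := cnbhs_dom lN w0.
have nC := cnbhsI nw (cnbhsI n0 ns); rewrite -ew in nC.
have nC' := smooth_at_continuous lK lN (smooth_cons z0) nC.
apply: cnbhsS (cnbhsI (cnbhs_dom lK z0) nC') => x [dx].
rewrite [cons_ambient z0]ew => -[dwx [h0 [dg _ dsg hs]]] Sx _.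
pose y : nerve G k := exist _ x Sx; pose q := cons_unt y.
have eq : sval q = cons_ambient x by rewrite cons_ambientE.
have [_ e0] : dom (arr1 q0) (arr1 q) /\
   transition (arr1 q) (arr1 q0) (arr1 q) (c q) = nu0 (@phi R (powC G k.+1) w0 (cons_ambient x)).
  have Sq : @nerve_set R G k.+1 (cons_ambient x) by rewrite -eq; exact: svalP q.
  have e := @nerve_eq k.+1 (exist _ (cons_ambient x) Sq) q (esym eq).
  exact: (eq_ind _ (fun q' : nerve G k.+1 => dom (arr1 q0) (arr1 q') /\
    transition (arr1 q') (arr1 q0) (arr1 q') (c q') = nu0 _) (h0 Sq) _ e).
rewrite -/y (CE _ dx) !base_cons_unt (gamE _ dwx) -e0.
have := hs (c q); rewrite -eq; exact.
Qed.

Definition face_ambient k : powC G k.+1 -> nerve_ambient G k :=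
  match k return powC G k.+1 -> nerve_ambient G k with
  | 0%N => fun x => s (x ord0)
  | k'.+1 => fun x j => x (lift ord0 j)
  end.

Lemma face_ambientE k (g : nerve G k.+1) : sval (face 0 g) = face_ambient (sval g).
Proof. by case: k g. Qed.

Lemma smooth_face k (x : powC G k.+1) : smooth_at (@face_ambient k) x.
Proof.
case: k x => [|k] x.
  have [s1 _] := smooth_at_comp (nerve_local_charts 1) lG fG
    (smooth_arr1 x) (smooth_src (x ord0)).
  exact: s1.
apply: (smooth_at_powC (nerve_local_charts k.+2)) => j; exact: smooth_at_proj.
Qed.

(** Here r_g is dm(-, 0) at (1, g), and [v] is pulled back along [face 0] before it enters the
    connection. *)
Lemma smooth_glue (sigma : ehresmann G) k (u : nerve G k.+1 -> TG G)
    (v : nerve G k -> TM G) :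
  A_cochain u -> TM_cochain v ->
  smooth_sub (Y := tanC G) (fun g : nerve G k.+1 => (arr1 g,
    - rtr (arr1 g) 1_(t (arr1 g)) (u g) + sigma (arr1 g) (v (face 0 g)))).
Proof.
pose lN : local_charts (powC G k.+1) := nerve_local_charts k.+1.
pose lK : local_charts (nerve_ambient G k) := nerve_local_charts k.
move=> [uA su] sv; apply: (smooth_sub_of_germ lN aG) => x0; split.
  by exists (fun y : powC G k.+1 => y ord0); [exact: smooth_arr1|].
pose z0 : powC G k.+1 := sval x0; pose g0 : G := z0 ord0.
pose f0 := face 0 x0; pose y0 := sval f0.
have ef : face_ambient z0 = y0 by rewrite -face_ambientE.
have [nuu gu nu] := smooth_sub_germ lN aG x0 su.
have [nuv gv nv] := smooth_sub_germ lK aM f0 sv.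
pose a0 := @phi R (powC G k.+1) z0 z0.
pose F := @phi R (nerve_ambient G k) y0 \o (@face_ambient k) \o @psi R (powC G k.+1) z0.
have gF : smooth_germ F a0 by have := smooth_at_germ (smooth_face z0); rewrite ef.
have FE (x : powC G k.+1) : dom z0 x ->
    F (@phi R (powC G k.+1) z0 x) = @phi R (nerve_ambient G k) y0 (face_ambient x).
  by move=> dx; exact (congr1 (fun y => @phi R (nerve_ambient G k) y0 (face_ambient
    y)) (phiK lN dx)).
pose gam := @phi R G g0 \o (fun y : powC G k.+1 => y ord0) \o @psi R (powC G k.+1) z0.
have ggam : smooth_germ gam a0 := smooth_at_germ (smooth_arr1 z0).
have gamE (x : powC G k.+1) : dom z0 x -> gam (@phi R (powC G k.+1) z0 x) = @phi R G g0 (x ord0).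
  by move=> dx; exact (congr1 (fun y : powC G k.+1 => @phi R G g0 (y ord0)) (phiK lN dx)).
pose ut (h : G) : G := 1_(t h).
have sut (h : G) : smooth_at ut h.
  by have [] := smooth_at_comp lG lM fM (smooth_tgt h) (@unt_smooth R G (t h)).
pose sl := @phi R M (s g0) \o s \o @psi R G g0.
pose el := @phi R G (ut g0) \o ut \o @psi R G g0.
have slE (g : G) : dom g0 g -> sl (@phi R G g0 g) = @phi R M (s g0) (s g).
  by move=> dg; exact (congr1 (fun h : G => @phi R M (s g0) (s h)) (phiK lG dg)).
have elE (g : G) : dom g0 g -> el (@phi R G g0 g) = @phi R G (ut g0) (ut g).
  by move=> dg; exact (congr1 (fun h : G => @phi R G (ut g0) (ut h)) (phiK lG dg)).
have dz : dom z0 z0 := dom_self lN z0.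
have dg0 : dom g0 g0 := dom_self lG g0.
have gam0 : gam a0 = @phi R G g0 g0 := gamE _ dz.
have F0 : F a0 = @phi R (nerve_ambient G k) y0 y0 by rewrite (FE _ dz) ef.
have gsl : smooth_germ sl (gam a0) by rewrite gam0; exact: smooth_at_germ (smooth_src g0).
have gel : smooth_germ el (gam a0) by rewrite gam0; exact: smooth_at_germ (sut g0).
have cs := smooth_at_cnbhs aG aM (smooth_src g0).
have ug (g : G) : s (ut g) = t g by rewrite /ut src_unt.
have [m gm nm] := mul_germ (ug g0).
have [K gK nK] := conn_germ sigma g0 (v f0).
(* Coordinates of the argument (g, (s g, v)) of the connection. *)
pose kap a := (gam a, (sl (gam a), nuv (F a))).
have bf0 : base f0 = s g0 := base_face0 x0.
have kap0 : kap a0 = (@phi R G g0 g0, (@phi R M (s g0) (s g0),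
    @transition R M (s g0) (s g0) (s g0) (v f0))).
  have [_] := cnbhs_self lK nv (svalP f0); rewrite exist_sval bf0 => e.
  by rewrite /kap gam0 (slE _ dg0) F0 -e.
have gel' := germ_comp (fG : findim (TG G)) ggam gel.
have gsl' := germ_comp (fG : findim (TG G)) ggam gsl.
have gvF : smooth_germ (fun a => nuv (F a)) a0.
  by apply: germ_comp gF _; [exact: nerve_findim|rewrite F0].
have gkap : smooth_germ kap a0 := germ_pair ggam (germ_pair gsl' gvF).
have gKk : smooth_germ (fun a => K (kap a)) a0.
  apply: germ_comp gkap _; last by rewrite kap0.
  exact: findim_prod fG (findim_prod fM fM).
have gmm : smooth_germ (fun a => 'd m (el (gam a), gam a) (nuu a, 0)) a0.
  apply: germ_diff.
  - exact: findim_prod fG fG.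
  - by rewrite gam0 (elE _ dg0).
  - exact: germ_pair gel' ggam.
  - exact: germ_pair gu (germ_cst _ _).
exists (fun a => - 'd m (el (gam a), gam a) (nuu a, 0) + K (kap a)).
  exact: germ_add (germ_opp gmm) gKk.
rewrite -kap0 in nK.
have nk := nbhs_cnbhs lN (germ_near gkap nK).
have ns := smooth_at_continuous lN lG (smooth_arr1 z0) cs.
have [se _] := smooth_at_comp lN lG fG (smooth_arr1 z0) (sut g0).
have [sp _] := smooth_at_pair se (smooth_arr1 z0).
have nm' := smooth_at_continuous lN lGG sp nm.
have ef' : sval f0 = face_ambient z0 := esym ef.
rewrite ef' in nv.
have nv' := smooth_at_continuous lN lK (smooth_face z0) nv.
have nd := cnbhs_dom lN z0.
apply: cnbhsS (cnbhsI nd (cnbhsI nu (cnbhsI nv' (cnbhsI nk (cnbhsI ns nm'))))) => x.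
case=> dx [hu [hv [hk [[dg _ dsg hs] hm]]]] Sx _.
pose y : nerve G k.+1 := exist _ x Sx; rewrite -/y.
pose g : G := x ord0.
have [_ eu] := hu Sx; rewrite -/y in eu.
have eF : sval (face 0 y) = face_ambient x by rewrite face_ambientE.
have ev : @transition R M (s g) (s g0) (s g) (v (face 0 y)) =
    nuv (@phi R (nerve_ambient G k) y0 (face_ambient x)).
  have Sq : nerve_set (face_ambient x) by rewrite -eF; exact: svalP (face 0 y).
  have e := @nerve_eq k (exist _ (face_ambient x) Sq) (face 0 y) (esym eF).
  have [_] := eq_ind _ (fun q' : nerve G k => dom (base f0) (base q') /\
    transition (base q') (base f0) (base q') (v q') = nuv _) (hv Sq) _ e.
  by rewrite bf0 base_face0 ef.
have ek : kap (@phi R (powC G k.+1) z0 x) = (@phi R G g0 g, (@phi R M (s g0) (s g),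
    @transition R M (s g) (s g0) (s g) (v (face 0 y)))).
  by rewrite /kap (gamE _ dx) (slE _ dg) (FE _ dx) ev.
have eK : @transition R G g g0 g (sigma g (v (face 0 y))) =
    K (kap (@phi R (powC G k.+1) z0 x)).
  exact: hk dg dsg ek.
have uy : mdiff s (ut g) (u y) = 0 := uA y.
have [_ er] := rtr_dmul (ug g) uy.
have uy0 : mdiff s (ut g) (u y) = mdiff t g 0 by rewrite uy mdiff0.
have := hm (ug g) (u y) 0 uy0; rewrite -er /= !unt_mul => e1.
have lt := @transition_linear R G g g0 g.
have eT := linear_fun0 lt.
apply: (etrans (linear_funD _ _ lt)); rewrite (linear_funN _ lt).
rewrite eK e1 eT (gamE _ dx) (elE _ dg) -eu.
by [].
Qed.

(** * Bijectivity of the comparison map on cochains *)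

Section Isomorphism.
Variable sigma : ehresmann G.

Lemma conn_omega g (X : TG G) :
  X = rtr g 1_(t g) (omega sigma g X) + sigma g (mdiff s g X).
Proof. by rewrite rtr_omega subrK. Qed.

Lemma split_linear k :
  linear (@split_cochain R G sigma k : ambient (def_complex G) k -> ambient (ad_complex sigma) k).
Proof.
case: k => [|k] a c d //; congr pair; apply/funext => g.
  rewrite /= (@omega_linear sigma (arr1 g) a (c g) (d g)) opprD.
  by rewrite -scalerN.
exact: (@mdiff_linear R G M s (arr1 (cons_unt g)) a).
Qed.

Definition projectable_cochain k : set (ambient (def_complex G) k) :=
  match k return set (ambient (def_complex G) k) with
  | 0%N => setT
  | k'.+1 => @projectable k'
  end.

Lemma split_image k : @split_cochain R G sigma k @` @cochain R (def_complex G) k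
  = @cochain R (ad_complex sigma) k.
Proof.
(* In degree 0 the map is the identity and the two sets of cochains coincide. *)
case: k => [|k]; first exact: image_id.
apply/seteqP; split=> [_ [c [sc pc] <-]|[u v] [uA vM]].
  split; last exact: smooth_symbol.
  split; last exact: smooth_omega.
  move=> g; rewrite /algebroid /= (linear_funN _ (@mdiff_linear R G M s _)).
  by rewrite (omega_algebroid sigma (arr1 g) (c g)) oppr0.
have uA1 (g : nerve G k.+1) : mdiff s 1_(t (arr1 g)) (u g) = 0 by case: uA => + _; apply.
pose c (g : nerve G k.+1) : TG G :=
  - rtr (arr1 g) 1_(t (arr1 g)) (u g) + sigma (arr1 g) (v (face 0 g)).
have dc g : mdiff s (arr1 g) (c g) = v (face 0 g).
  have ls := @mdiff_linear R G M s (arr1 g).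
  rewrite (linear_funD _ _ ls) (linear_funN _ ls) conn_split.
  by rewrite (rtr_unt_src (uA1 g)) oppr0 add0r.
exists c; first split.
- exact: smooth_glue.
- by move=> g g' e; rewrite !dc e.
rewrite /split_cochain; congr pair; apply/funext => g; last first.
  by rewrite /symbol dc face0_cons_unt.
have wl := @omega_linear sigma (arr1 g).
rewrite (linear_funD _ _ wl) (linear_funN _ wl) omega_conn.
by rewrite (omega_rtr sigma (uA1 g)) addr0 opprK.
Qed.

(** Projectability carries the vanishing of the symbol from strings starting with a unit to all
    strings; then both summands of [c] vanish. *)
Lemma split_inj k (c : ambient (def_complex G) k) :
  projectable_cochain c -> split_cochain sigma c = 0 -> c = 0.
Proof.
case: k c => [|k] c //= pc e; apply/funext => g.
have eu : omega sigma (arr1 g) (c g) = 0.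
  have := congr1 (fun p : (nerve G k.+1 -> TG G) * (nerve G k -> TM G) => p.1 g) e.
  by move=> /= /eqP; rewrite oppr_eq0 => /eqP.
have ev : symbol c (face 0 g) = 0.
  exact: (congr1 (fun p : (nerve G k.+1 -> TG G) * (nerve G k -> TM G) => p.2 (face 0 g)) e).
rewrite [LHS](conn_omega (arr1 g)) eu -(symbol_face0 g pc) ev.
by rewrite (linear_fun0 (@rtr_linear _ _)) (linear_fun0 (@conn_lin sigma _)) addr0.
Qed.

End Isomorphism.

End LieGroupoid.

Theorem theorem1p4 (R : realType) (G : lie_groupoid R) (sigma : ehresmann G) :
  exists Phi : forall k,
      set (ambient (def_complex G) k) -> set (ambient (ad_complex sigma) k),
    cohomology_iso Phi /\
    (forall k (c : ambient (def_complex G) k),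
       cocycle c -> Phi k (hclass c) = hclass (split_cochain sigma c)).
Proof.
have Pc k c : @cochain R (def_complex G) k c -> projectable_cochain c.
  by case: k c => [|k] c // [].
have Pl k a x y : @projectable_cochain R G k x -> @projectable_cochain R G k y ->
    @projectable_cochain R G k (a *: x + y).
  case: k x y => [|k] x y // px py g g' e.
  have ls h := @mdiff_linear R G (objects G) (@src R G) (arr1 h) a (x h) (y h).
  by rewrite [LHS]ls [RHS]ls (px _ _ e) (py _ _ e).
have Pd k c : @cochain R (def_complex G) k c ->
    @projectable_cochain R G k.+1 (@codiff R (def_complex G) k c).
  by case: k c => [|k] c []; [move=> + _; exact: projectable_codiff0|move=> _;
    exact: projectable_codiff].
have Sd k c : @cochain R (def_complex G) k c ->
    split_cochain sigma (@codiff R (def_complex G) k c) =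
    @codiff R (ad_complex sigma) k (split_cochain sigma c).
  by case: k c => [|k] c []; [move=> + _; exact: split_codiff0|move=> _; exact: split_codiff].
have Sl := split_linear sigma; have Si := split_image sigma.
(* The direct image of a coset under the cochain map depends on sigma alone. *)
exists (fun k A => @split_cochain R G sigma k @` A); split.
  exact: (complex_iso Sl Pl Pc Pd (@split_inj R G sigma) Si Sd).
by move=> k c _; exact: (image_hclass Sl Si Sd).
Qed.
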